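(* Let $\mathbb{K}$ be a field, let $(\Lambda,M)$ and $(\Lambda',M')$ be marked $\mathbb{K}$-algebras, and let $V$ and $V'$ be bimodules over $\Lambda$ and $\Lambda'$ respectively. Then there is an isomorphism of chain complexes $$\Omega(\Lambda\otimes\Lambda',M\otimes\mathbb{K}+\mathbb{K}\otimes M',V\otimes V')\cong\Omega(\Lambda,M,V)\otimes\Omega(\Lambda',M',V').$$ In particular, $$\Omega(\Lambda\otimes\Lambda',M\otimes\mathbb{K}+\mathbb{K}\otimes M')\cong\Omega(\Lambda,M)\otimes\Omega(\Lambda',M')$$ and $$\mathsf{PHH}_*(\Lambda\otimes\Lambda',M\otimes\mathbb{K}+\mathbb{K}\otimes M')\cong\mathsf{PHH}_*(\Lambda,M)\otimes\mathsf{PHH}_*(\Lambda',M').$$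
   Context: Algebras are associative unital $\mathbb{K}$-algebras; tensor products are over $\mathbb{K}$. A marked algebra is a pair $(\Lambda,M)$ with $\Lambda$ an algebra and $M\subseteq\Lambda$ a vector subspace with $1\in M$. In $M\otimes\mathbb{K}+\mathbb{K}\otimes M'\subseteq\Lambda\otimes\Lambda'$, $\mathbb{K}$ denotes the span of the unit. For a $\Lambda$-bimodule $V$, $A(\Lambda,V)$ is the simplicial vector space with $A(\Lambda,V)_n=V\otimes\Lambda^{\otimes n}$ and $d_0(v\otimes\lambda_1\otimes\dots\otimes\lambda_n)=v\lambda_1\otimes\lambda_2\otimes\dots\otimes\lambda_n$, $d_i(v\otimes\lambda_1\otimes\dots\otimes\lambda_n)=v\otimes\lambda_1\otimes\dots\otimes\lambda_i\lambda_{i+1}\otimes\dots\otimes\lambda_n$ for $1\le i\le n-1$, $d_n(v\otimes\lambda_1\otimes\dots\otimes\lambda_n)=\lambda_nv\otimes\lambda_1\otimes\dots\otimes\lambda_{n-1}$, $s_i(v\otimes\lambda_1\otimes\dots\otimes\lambda_n)=v\otimes\lambda_1\otimes\dots\otimes\lambda_i\otimes1\otimes\lambda_{i+1}\otimes\dots\otimes\lambda_n$. Let $B(\Lambda,M,V)_n=V\otimes M^{\otimes n}\subseteq A(\Lambda,V)_n$. For a simplicial vector space $A$, $\mathsf{N}A$ is the Moore complex $\mathsf{N}_nA=\bigcap_{i\ne0}\ker d_i$, a subcomplex of the unnormalized complex $(A_n,\partial=\sum_i(-1)^id_i)$, and $\rho:A_n\to\mathsf{N}_nA$ is the projection along the degenerate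 part $\sum_is_i(A_{n-1})$. With $A=A(\Lambda,V)$ and $\overline{B}_n=\rho(B(\Lambda,M,V)_n)$, the complex $\Omega(\Lambda,M,V)$ is the subcomplex of $\mathsf{N}A$ with $\Omega_n(\Lambda,M,V)=\overline{B}_n\cap\partial^{-1}(\overline{B}_{n-1})$. Put $\Omega(\Lambda,M)=\Omega(\Lambda,M,\Lambda)$ and $\mathsf{PHH}_*(\Lambda,M)=H_*(\Omega(\Lambda,M))$ (path Hochschild homology). *)

(* Defs.v *)
From HB Require Import structures.
From mathcomp Require Import all_boot all_order all_algebra.
From mathcomp Require Import boolp.
From mathcomp Require Import zify.

Set Implicit Arguments.
Unset Strict Implicit.
Unset Printing Implicit Defensive.

Import GRing.Theory.
Local Open Scope ring_scope.
Local Open Scope quotient_scope.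

Definition linmap (K : fieldType) (U V : lmodType K) (f : U -> V)
    (fL : linear f) : {linear U -> V} :=
  HB.pack_for {linear U -> V} f (GRing.isLinear.Build K U V *:%R f fL).

Definition lin_iso (K : fieldType) (U V : lmodType K) : Prop :=
  exists f : {linear U -> V}, bijective f.

Section Span.
Variables (K : fieldType) (V : lmodType K).

Definition lcomb (s : seq (K * V)) : V := \sum_(c <- s) c.1 *: c.2.

Definition lspan (P : V -> Prop) : {pred V} := fun x =>
  `[< exists2 s : seq (K * V), (forall c, c \in s -> P c.2) & x = lcomb s >].

Variable P : V -> Prop.

Lemma lspan_submod : subsemimod_closed (lspan P).
Proof.
split.
  split; first by apply/asboolP; exists [::] => //; rewrite /lcomb big_nil.
  move=> _ _ /asboolP[s sP ->] /asboolP[t tP ->]; apply/asboolP.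
  exists (s ++ t); last by rewrite /lcomb big_cat.
  by move=> c; rewrite mem_cat => /orP[/sP|/tP].
move=> a _ /asboolP[s sP ->]; apply/asboolP.
exists [seq (a * c.1, c.2) | c <- s].
  by move=> _ /mapP[c cs ->]; exact: (sP c).
rewrite /lcomb big_map scaler_sumr; apply: eq_bigr => c _ /=.
by rewrite scalerA.
Qed.
HB.instance Definition _ := GRing.isSubmodClosed.Build K V (lspan P) lspan_submod.

Lemma mem_lspan x : P x -> x \in lspan P.
Proof.
move=> Px; apply/asboolP; exists [:: (1, x)].
  by move=> c; rewrite inE => /eqP->.
by rewrite /lcomb big_seq1 scale1r.
Qed.

Variables S T : submodClosed V.

Definition addsub : {pred V} := fun x =>
  `[< exists y z, [/\ y \in S, z \in T & x = y + z] >].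

Lemma addsub_submod : subsemimod_closed addsub.
Proof.
split.
  split; first by apply/asboolP; exists 0, 0; rewrite !rpred0 addr0.
  move=> _ _ /asboolP[x1 [x2 [h1 h2 ->]]] /asboolP[y1 [y2 [h3 h4 ->]]].
  apply/asboolP; exists (x1 + y1), (x2 + y2).
  by rewrite !rpredD // addrACA.
move=> a _ /asboolP[x1 [x2 [h1 h2 ->]]]; apply/asboolP.
by exists (a *: x1), (a *: x2); rewrite !rpredZ // scalerDr.
Qed.
HB.instance Definition _ :=
  GRing.isSubmodClosed.Build K V addsub addsub_submod.

End Span.

Section Subspace.
Variables (K : fieldType) (V : lmodType K) (S : submodClosed V).

Definition subspace_of : Type := {x : V | x \in S}.
HB.instance Definition _ := SubType.copy subspace_of {x : V | x \in S}.
HB.instance Definition _ := Choice.copy subspace_of {x : V | x \in S}.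
HB.instance Definition _ := [SubChoice_isSubLmodule of subspace_of by <:].
End Subspace.

Section QuotientSpace.
Variables (K : fieldType) (V : lmodType K) (S : submodClosed V).

(* Repackages S as a zmodClosed predicate, which is what Quotient.quot expects. *)
Definition subgroup : {pred V} := fun x => x \in S.

Lemma subgroup_submod : subsemimod_closed subgroup.
Proof.
split; last by move=> a x xS; exact: rpredZ.
by split; [exact: rpred0 | move=> x y xS yS; exact: rpredD].
Qed.
HB.instance Definition _ :=
  GRing.isSubmodClosed.Build K V subgroup subgroup_submod.

Definition quotspace : Type := Quotient.quot subgroup.
HB.instance Definition _ := GRing.Zmodule.on quotspace.

Definition quot_class (x : V) : quotspace := \pi_(Quotient.quot subgroup) x.

Lemma quot_classP x y : quot_class x = quot_class y <-> x - y \in S.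
Proof.
rewrite /quot_class; split.
  move/eqP; by rewrite -Quotient.idealrBE.
move=> h; apply/eqP; by rewrite -Quotient.idealrBE.
Qed.

Lemma quot_class_surj (q : quotspace) : exists x, q = quot_class x.
Proof. by exists (repr q); rewrite /quot_class reprK. Qed.

Lemma quot_classD x y : quot_class (x + y) = quot_class x + quot_class y.
Proof. by rewrite /quot_class raddfD. Qed.

Definition quot_scale (a : K) (q : quotspace) : quotspace :=
  quot_class (a *: repr q).

Lemma quot_scale_class a x : quot_scale a (quot_class x) = quot_class (a *: x).
Proof.
apply/quot_classP; rewrite -scalerBr; apply: rpredZ; apply/quot_classP.
by rewrite /quot_class reprK.
Qed.

Lemma quot_scaleA a b q : quot_scale a (quot_scale b q) = quot_scale (a * b) q.
Proof.
have [x ->] := quot_class_surj q.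
by rewrite !quot_scale_class scalerA.
Qed.
Lemma quot_scale1 : left_id 1 quot_scale.
Proof.
by move=> q; have [x ->] := quot_class_surj q; rewrite quot_scale_class scale1r.
Qed.
Lemma quot_scaleDr : right_distributive quot_scale +%R.
Proof.
move=> a q r; have [x ->] := quot_class_surj q.
have [y ->] := quot_class_surj r.
by rewrite -quot_classD !quot_scale_class scalerDr quot_classD.
Qed.
Lemma quot_scaleDl q : {morph quot_scale^~ q : a b / a + b}.
Proof.
move=> a b; have [x ->] := quot_class_surj q.
by rewrite !quot_scale_class scalerDl quot_classD.
Qed.
HB.instance Definition _ := GRing.Zmodule_isLmodule.Build K quotspace
  quot_scaleA quot_scale1 quot_scaleDr quot_scaleDl.

End QuotientSpace.

(* The vector space of formal linear combinations of elements of X, two of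
   them being identified when every map satisfying P sends them to the same
   vector.  Applied to the class of bilinear (multilinear) maps, this is the
   tensor product with its universal property. *)
Section Universal.
Variables (K : fieldType) (X : choiceType).

Definition formal_eval (W : lmodType K) (f : X -> W) (s : seq (K * X)) : W :=
  \sum_(c <- s) c.1 *: f c.2.

Variable P : forall W : lmodType K, (X -> W) -> Prop.

Definition formal_eq (s t : seq (K * X)) : bool :=
  `[< forall (W : lmodType K) (f : X -> W), P f ->
        formal_eval f s = formal_eval f t >].

Lemma formal_eq_equiv : equiv_class_of formal_eq.
Proof.
split=> [s|s t|t s u].
- exact/asboolP.
- by apply/asboolP/asboolP => h W f Pf; rewrite h.
- move=> /asboolP h1 /asboolP h2; apply/asboolP => W f Pf.
  by rewrite h1 // h2.
Qed.
Canonical formal_eq_equivrel := EquivRelPack formal_eq_equiv.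
Canonical formal_eq_encModRel := defaultEncModRel formal_eq.

Definition universal : Type := {eq_quot formal_eq}.
HB.instance Definition _ := Choice.on universal.
HB.instance Definition _ := EqQuotient.on universal.

Definition uclass (s : seq (K * X)) : universal := \pi_({eq_quot formal_eq}) s.

Lemma uclassP s t : uclass s = uclass t <->
  forall (W : lmodType K) (f : X -> W), P f -> formal_eval f s = formal_eval f t.
Proof.
rewrite /uclass; split.
  by move/eqP; rewrite eqmodE => /asboolP.
by move=> h; apply/eqP; rewrite eqmodE; apply/asboolP.
Qed.

Lemma uclass_repr q : uclass (repr q) = q.
Proof. exact: reprK. Qed.

Lemma formal_eval_repr s (W : lmodType K) (f : X -> W) : P f ->
  formal_eval f (repr (uclass s)) = formal_eval f s.
Proof. by move=> Pf; apply: (uclassP _ _).1 => //; rewrite uclass_repr. Qed.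

Definition fscale (a : K) (s : seq (K * X)) := [seq (a * c.1, c.2) | c <- s].

Lemma formal_eval_cat s t (W : lmodType K) (f : X -> W) :
  formal_eval f (s ++ t) = formal_eval f s + formal_eval f t.
Proof. by rewrite /formal_eval big_cat. Qed.

Lemma formal_eval_scale a s (W : lmodType K) (f : X -> W) :
  formal_eval f (fscale a s) = a *: formal_eval f s.
Proof.
rewrite /formal_eval /fscale big_map scaler_sumr.
by apply: eq_bigr => c _; rewrite scalerA.
Qed.

Lemma formal_eval_nil (W : lmodType K) (f : X -> W) : formal_eval f [::] = 0.
Proof. by rewrite /formal_eval big_nil. Qed.

Definition uzero : universal := uclass [::].
Definition uadd (p q : universal) : universal := uclass (repr p ++ repr q).
Definition uscale (a : K) (q : universal) : universal :=
  uclass (fscale a (repr q)).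
Definition uopp (q : universal) : universal := uscale (-1) q.

Lemma uaddE s t : uadd (uclass s) (uclass t) = uclass (s ++ t).
Proof.
apply/uclassP => W f Pf.
by rewrite !formal_eval_cat !formal_eval_repr.
Qed.
Lemma uscaleE a s : uscale a (uclass s) = uclass (fscale a s).
Proof.
apply/uclassP => W f Pf.
by rewrite !formal_eval_scale !formal_eval_repr.
Qed.

Lemma uaddA : associative uadd.
Proof.
move=> p q r; rewrite -(uclass_repr p) -(uclass_repr q) -(uclass_repr r).
by rewrite !uaddE catA.
Qed.
Lemma uaddC : commutative uadd.
Proof.
move=> p q; rewrite -(uclass_repr p) -(uclass_repr q) !uaddE.
by apply/uclassP => W f _; rewrite !formal_eval_cat addrC.
Qed.
Lemma uadd0 : left_id uzero uadd.
Proof. by move=> p; rewrite -(uclass_repr p) uaddE. Qed.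
Lemma uaddN : left_inverse uzero uopp uadd.
Proof.
move=> p; rewrite -(uclass_repr p) /uopp uscaleE uaddE.
apply/uclassP => W f _.
by rewrite formal_eval_cat formal_eval_scale scaleN1r addNr formal_eval_nil.
Qed.
HB.instance Definition _ :=
  GRing.isZmodule.Build universal uaddA uaddC uadd0 uaddN.

Lemma uscaleA a b q : uscale a (uscale b q) = uscale (a * b) q.
Proof.
rewrite -(uclass_repr q) !uscaleE; apply/uclassP => W f _.
by rewrite !formal_eval_scale scalerA.
Qed.
Lemma uscale1 : left_id 1 uscale.
Proof.
move=> q; rewrite -(uclass_repr q) !uscaleE; apply/uclassP => W f _.
by rewrite !formal_eval_scale scale1r.
Qed.
Lemma uscaleDr : right_distributive uscale +%R.
Proof.
move=> a p q; rewrite -(uclass_repr p) -(uclass_repr q).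
rewrite [_ + _]uaddE !uscaleE [_ + _]uaddE; apply/uclassP => W f _.
by rewrite !(formal_eval_scale, formal_eval_cat) scalerDr.
Qed.
Lemma uscaleDl q : {morph uscale^~ q : a b / a + b}.
Proof.
move=> a b /=; rewrite -(uclass_repr q) !uscaleE [RHS]uaddE.
apply/uclassP => W f _.
by rewrite !(formal_eval_scale, formal_eval_cat) scalerDl.
Qed.
HB.instance Definition _ := GRing.Zmodule_isLmodule.Build K universal
  uscaleA uscale1 uscaleDr uscaleDl.

Definition ugen (x : X) : universal := uclass [:: (1, x)].

(* Meaningful when P f holds: see ulift_linear and ulift_gen. *)
Definition ulift (W : lmodType K) (f : X -> W) (q : universal) : W :=
  formal_eval f (repr q).

Lemma ulift_linear (W : lmodType K) (f : X -> W) : P f -> linear (ulift f).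
Proof.
move=> Pf a p q; rewrite -(uclass_repr p) -(uclass_repr q).
rewrite [_ *: _]uscaleE [_ + _]uaddE /ulift !formal_eval_repr //.
by rewrite formal_eval_cat formal_eval_scale.
Qed.

Lemma ulift_gen (W : lmodType K) (f : X -> W) x : P f -> ulift f (ugen x) = f x.
Proof.
by move=> Pf; rewrite /ulift formal_eval_repr // /formal_eval big_seq1 scale1r.
Qed.

Lemma uclassE s : uclass s = formal_eval ugen s.
Proof.
elim: s => [|[a x] s IH]; first by rewrite formal_eval_nil.
rewrite /formal_eval big_cons -/(formal_eval ugen s) -IH /=.
rewrite [_ *: _]uscaleE [_ + _]uaddE; apply/uclassP => W f _.
by rewrite formal_eval_cat formal_eval_scale /formal_eval big_cons big_seq1 /=
  scale1r.
Qed.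

Lemma universal_ind (Q : universal -> Prop) :
  (forall a p q, Q p -> Q q -> Q (a *: p + q)) -> Q 0 ->
  (forall x, Q (ugen x)) -> forall q, Q q.
Proof.
move=> Qlin Q0 Qgen q; rewrite -(uclass_repr q) uclassE /formal_eval.
by elim: (repr q) => [|c s IH]; rewrite (big_nil, big_cons) //; exact: Qlin.
Qed.

Lemma ulift_unique (W : lmodType K) (f g : universal -> W) :
  linear f -> linear g -> (forall x, f (ugen x) = g (ugen x)) -> f =1 g.
Proof.
move=> fL gL fg; apply: universal_ind => //.
- by move=> a p q; rewrite fL gL => -> ->.
- have [f0 g0] := (fL (-1) 0 0, gL (-1) 0 0).
  by move: f0 g0; rewrite !scaler0 !add0r !scaleN1r !addNr => -> ->.
Qed.

(* A relation between values of ugen holds as soon as it holds between the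
   corresponding values of every f satisfying P. *)
Lemma ugen_rel a x y z :
  (forall (W : lmodType K) (f : X -> W), P f -> f z = a *: f x + f y) ->
  ugen z = a *: ugen x + ugen y.
Proof.
move=> h; rewrite [_ *: _]uscaleE [_ + _]uaddE; apply/uclassP => W f Pf.
rewrite formal_eval_cat formal_eval_scale /formal_eval !big_seq1 /= !scale1r.
exact: h.
Qed.

End Universal.

Section Tensor.
Variables (K : fieldType).

Definition bilinear_map (U V W : lmodType K) (f : U -> V -> W) : Prop :=
  (forall u, linear (f u)) /\ (forall v, linear (f^~ v)).

Variables (U V : lmodType K).

Definition bilinear_on (W : lmodType K) (f : U * V -> W) : Prop :=
  bilinear_map (fun u v => f (u, v)).

Definition tensor : Type := universal bilinear_on.
HB.instance Definition _ := GRing.Lmodule.on tensor.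

Definition tens (u : U) (v : V) : tensor := ugen bilinear_on (u, v).

Lemma tens_bilinear : bilinear_map tens.
Proof.
split=> [u a v w|v a u w]; apply: ugen_rel => W f [f1 f2].
  exact: f1.
exact: f2.
Qed.

Definition tensor_lift (W : lmodType K) (f : U -> V -> W) : tensor -> W :=
  ulift (fun p => f p.1 p.2).

Lemma tensor_lift_linear (W : lmodType K) (f : U -> V -> W) :
  bilinear_map f -> linear (tensor_lift f).
Proof. by move=> fB; apply: ulift_linear. Qed.

Lemma tensor_lift_tens (W : lmodType K) (f : U -> V -> W) u v :
  bilinear_map f -> tensor_lift f (tens u v) = f u v.
Proof. by move=> fB; rewrite /tensor_lift ulift_gen. Qed.

Lemma tensor_ext (W : lmodType K) (f g : tensor -> W) :
  linear f -> linear g -> (forall u v, f (tens u v) = g (tens u v)) -> f =1 g.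
Proof. by move=> fL gL fg; apply: ulift_unique => // -[u v]; exact: fg. Qed.

Definition tensor_sub (S : submodClosed U) (T : submodClosed V) :=
  lspan (fun x : tensor => exists u v, [/\ u \in S, v \in T & x = tens u v]).

End Tensor.

Section LinearFacts.
Variable K : fieldType.

Lemma linear_id (U : lmodType K) : linear (@id U).
Proof. by []. Qed.

Lemma linear_comp (U V W : lmodType K) (f : V -> W) (g : U -> V) :
  linear f -> linear g -> linear (fun x => f (g x)).
Proof. by move=> fL gL a x y; rewrite gL fL. Qed.

Lemma linear0f (U V : lmodType K) (f : U -> V) : linear f -> f 0 = 0.
Proof.
by move=> fL; have := fL (-1) 0 0; rewrite !scaler0 !add0r !scaleN1r !addNr.
Qed.

Lemma linear_scale (U V : lmodType K) (f : U -> V) (c : K) :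
  linear f -> linear (fun x => c *: f x).
Proof. by move=> fL a x y; rewrite fL scalerDr !scalerA mulrC. Qed.

Lemma linear_add (U V : lmodType K) (f g : U -> V) :
  linear f -> linear g -> linear (fun x => f x + g x).
Proof. by move=> fL gL a x y; rewrite fL gL scalerDr addrACA. Qed.

End LinearFacts.

Section TensorMaps.
Variable K : fieldType.

Section Maps.
Variables (U U' V V' : lmodType K) (f : U -> V) (g : U' -> V').

Definition tensor_map : tensor U U' -> tensor V V' :=
  tensor_lift (fun u u' => tens (f u) (g u')).

Hypotheses (fL : linear f) (gL : linear g).

Lemma tensor_map_bilinear : bilinear_map (fun u u' => tens (f u) (g u')).
Proof.
split=> [u a x y|u a x y]; rewrite ?fL ?gL; first exact: (tens_bilinear _ _).1.
exact: (tens_bilinear _ _).2.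
Qed.

Lemma tensor_map_linear : linear tensor_map.
Proof. exact/tensor_lift_linear/tensor_map_bilinear. Qed.

Lemma tensor_map_tens u u' : tensor_map (tens u u') = tens (f u) (g u').
Proof. by rewrite /tensor_map tensor_lift_tens //; exact: tensor_map_bilinear. Qed.

End Maps.

(* (u (x) u', v (x) v') |-> f u v (x) g u' v' *)
Section Maps2.
Variables (U U' V V' W W' : lmodType K).
Variables (f : U -> V -> W) (g : U' -> V' -> W').

Definition tensor_map2 (x : tensor U U') (y : tensor V V') : tensor W W' :=
  tensor_lift (fun u u' => tensor_map (f u) (g u') y) x.

Hypotheses (fB : bilinear_map f) (gB : bilinear_map g).

Lemma tensor_map2_aux y : bilinear_map (fun u u' => tensor_map (f u) (g u') y).
Proof.
split=> [u a x x'|u a x x'].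
  move: y; apply: tensor_ext.
  - exact: (tensor_map_linear (fB.1 _) (gB.1 _)).
  - apply: linear_add; last exact: (tensor_map_linear (fB.1 _) (gB.1 _)).
    exact: linear_scale (tensor_map_linear (fB.1 _) (gB.1 _)).
  - move=> v v'; rewrite !tensor_map_tens ?fB.1 ?gB.1 //; try exact: gB.1; try exact: fB.1.
    by rewrite gB.2 (tens_bilinear _ _).1.
move: y; apply: tensor_ext.
- exact: (tensor_map_linear (fB.1 _) (gB.1 _)).
- apply: linear_add; last exact: (tensor_map_linear (fB.1 _) (gB.1 _)).
  exact: linear_scale (tensor_map_linear (fB.1 _) (gB.1 _)).
- move=> v v'; rewrite !tensor_map_tens; try exact: gB.1; try exact: fB.1.
  by rewrite fB.2 (tens_bilinear _ _).2.
Qed.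

Lemma tensor_map2_bilinear : bilinear_map tensor_map2.
Proof.
split=> [x a y y'|y]; last exact/tensor_lift_linear/tensor_map2_aux.
move: x; apply: tensor_ext; first exact/tensor_lift_linear/tensor_map2_aux.
  apply: linear_add; last exact/tensor_lift_linear/tensor_map2_aux.
  by apply: linear_scale; exact/tensor_lift_linear/tensor_map2_aux.
move=> u u'; rewrite /tensor_map2 !tensor_lift_tens; try exact: tensor_map2_aux.
exact: (tensor_map_linear (fB.1 _) (gB.1 _)).
Qed.

Lemma tensor_map2_tens u u' v v' :
  tensor_map2 (tens u u') (tens v v') = tens (f u v) (g u' v').
Proof.
rewrite /tensor_map2 tensor_lift_tens; last exact: tensor_map2_aux.
by rewrite tensor_map_tens //; [exact: fB.1|exact: gB.1].
Qed.

End Maps2.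

End TensorMaps.

(* The library's algType is built on nzRingType and so excludes the zero
   algebra, which is allowed here: see kalgebra_of_algType for the link. *)
Record kalgebra (K : fieldType) := KAlgebra {
  kalgebra_sort :> lmodType K;
  amul : kalgebra_sort -> kalgebra_sort -> kalgebra_sort;
  aone : kalgebra_sort;
  amul_bilinear : bilinear_map amul;
  amulA : associative amul;
  amul1 : left_id aone amul;
  a1mul : right_id aone amul
}.
Arguments aone {K k}.

Lemma algType_bilinear (K : fieldType) (A : algType K) :
  bilinear_map (fun x y : A => x * y).
Proof.
split=> [x a y z|x a y z]; first by rewrite mulrDr scalerAr.
by rewrite mulrDl scalerAl.
Qed.

Definition kalgebra_of_algType (K : fieldType) (A : algType K) : kalgebra K :=
  KAlgebra (algType_bilinear A) (@mulrA A) (@mul1r A) (@mulr1 A).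

(* Equality of two maps that are linear in each of several tensor variables is
   checked on pure tensors. *)
Section TensorExt.
Variable K : fieldType.

Lemma tensor_ext2 (A A' B B' W : lmodType K)
    (f g : tensor A A' -> tensor B B' -> W) :
  bilinear_map f -> bilinear_map g ->
  (forall a a' b b', f (tens a a') (tens b b') = g (tens a a') (tens b b')) ->
  forall x y, f x y = g x y.
Proof.
move=> fB gB fg x y; move: x; apply: tensor_ext; [exact: fB.2|exact: gB.2|].
move=> a a'; move: y; apply: tensor_ext; [exact: fB.1|exact: gB.1|].
by move=> b b'.
Qed.

Lemma tensor_ext3 (A A' B B' C C' W : lmodType K)
    (f g : tensor A A' -> tensor B B' -> tensor C C' -> W) :
  (forall x, bilinear_map (f x)) -> (forall y z, linear (fun x => f x y z)) ->
  (forall x, bilinear_map (g x)) -> (forall y z, linear (fun x => g x y z)) ->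
  (forall a a' b b' c c', f (tens a a') (tens b b') (tens c c') =
    g (tens a a') (tens b b') (tens c c')) ->
  forall x y z, f x y z = g x y z.
Proof.
move=> fB fL gB gL fg x y z; move: x; apply: tensor_ext => // a a'.
exact: (tensor_ext2 (fB (tens a a')) (gB (tens a a')) (fg a a')).
Qed.
End TensorExt.

Section BilinearFacts.
Variable K : fieldType.
Variables (A B C D E : lmodType K).

Lemma trilinearl (f : A -> B -> C) (g : C -> D -> E) :
  bilinear_map f -> bilinear_map g ->
  (forall x, bilinear_map (fun y z => g (f x y) z)) /\
  (forall y z, linear (fun x => g (f x y) z)).
Proof.
move=> fB gB; split=> [x|y z].
  split=> [y|z]; first exact: gB.1.
  by apply: (linear_comp (gB.2 z)); exact: fB.1.
by apply: (linear_comp (gB.2 z)); exact: fB.2.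
Qed.

Lemma trilinearr (f : B -> C -> D) (g : A -> D -> E) :
  bilinear_map f -> bilinear_map g ->
  (forall x, bilinear_map (fun y z => g x (f y z))) /\
  (forall y z, linear (fun x => g x (f y z))).
Proof.
move=> fB gB; split=> [x|y z]; last exact: gB.2.
split=> [y|z]; apply: (linear_comp (gB.1 x)); [exact: fB.1|exact: fB.2].
Qed.
End BilinearFacts.

Section TensorAlgebra.
Variables (K : fieldType) (A B : kalgebra K).

Definition tensor_mul : tensor A B -> tensor A B -> tensor A B :=
  tensor_map2 (@amul _ A) (@amul _ B).

Lemma tensor_mul_bilinear : bilinear_map tensor_mul.
Proof. exact: tensor_map2_bilinear (amul_bilinear A) (amul_bilinear B). Qed.
Let mulB := tensor_mul_bilinear.

Lemma tensor_mulE a b a' b' :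
  tensor_mul (tens a b) (tens a' b') = tens (amul a a') (amul b b').
Proof. exact: tensor_map2_tens (amul_bilinear A) (amul_bilinear B) _ _ _ _. Qed.

Lemma tensor_mulA : associative tensor_mul.
Proof.
have [h1 h2] := trilinearr mulB mulB.
have [h3 h4] := trilinearl mulB mulB.
by apply: (tensor_ext3 h1 h2 h3 h4) => *; rewrite !tensor_mulE !amulA.
Qed.
Lemma tensor_mul1 : left_id (tens aone aone) tensor_mul.
Proof.
apply: tensor_ext => [||a b]; [exact: mulB.1|exact: linear_id|].
by rewrite tensor_mulE !amul1.
Qed.
Lemma tensor_1mul : right_id (tens aone aone) tensor_mul.
Proof.
apply: tensor_ext => [||a b]; [exact: mulB.2|exact: linear_id|].
by rewrite tensor_mulE !a1mul.
Qed.

Definition tensor_algebra : kalgebra K :=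
  KAlgebra tensor_mul_bilinear tensor_mulA tensor_mul1 tensor_1mul.

End TensorAlgebra.

Record bimodule (K : fieldType) (A : kalgebra K) := Bimodule {
  bimodule_sort :> lmodType K;
  lact : A -> bimodule_sort -> bimodule_sort;
  ract : bimodule_sort -> A -> bimodule_sort;
  lact_bilinear : bilinear_map lact;
  ract_bilinear : bilinear_map ract;
  lact1 : forall v, lact aone v = v;
  lactA : forall a b v, lact (amul a b) v = lact a (lact b v);
  ract1 : forall v, ract v aone = v;
  ractA : forall v a b, ract v (amul a b) = ract (ract v a) b;
  lractA : forall a v b, ract (lact a v) b = lact a (ract v b)
}.

Definition regular_bimodule (K : fieldType) (A : kalgebra K) : bimodule A :=
  Bimodule (amul_bilinear A) (amul_bilinear A)
    (@amul1 _ A) (fun a b v => esym (amulA a b v))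
    (@a1mul _ A) (@amulA _ A) (fun a v b => esym (amulA a v b)).

Section TensorBimodule.
Variables (K : fieldType) (A B : kalgebra K).
Variables (V : bimodule A) (W : bimodule B).

Definition tensor_lact : tensor A B -> tensor V W -> tensor V W :=
  tensor_map2 (@lact _ _ V) (@lact _ _ W).
Definition tensor_ract : tensor V W -> tensor A B -> tensor V W :=
  tensor_map2 (@ract _ _ V) (@ract _ _ W).

Lemma tensor_lact_bilinear : bilinear_map tensor_lact.
Proof. exact: tensor_map2_bilinear (lact_bilinear V) (lact_bilinear W). Qed.
Lemma tensor_ract_bilinear : bilinear_map tensor_ract.
Proof. exact: tensor_map2_bilinear (ract_bilinear V) (ract_bilinear W). Qed.

Lemma tensor_lactE a b v w :
  tensor_lact (tens a b) (tens v w) = tens (lact a v) (lact b w).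
Proof. exact: tensor_map2_tens (lact_bilinear V) (lact_bilinear W) _ _ _ _. Qed.
Lemma tensor_ractE a b v w :
  tensor_ract (tens v w) (tens a b) = tens (ract v a) (ract w b).
Proof. exact: tensor_map2_tens (ract_bilinear V) (ract_bilinear W) _ _ _ _. Qed.

Let lB := tensor_lact_bilinear.
Let rB := tensor_ract_bilinear.
Let mB := tensor_mul_bilinear A B.

Lemma tensor_lact1 x : tensor_lact (tens aone aone) x = x.
Proof.
move: x; apply: tensor_ext => [||v w]; [exact: lB.1|exact: linear_id|].
by rewrite tensor_lactE !lact1.
Qed.
Lemma tensor_lactA a b x :
  tensor_lact (tensor_mul a b) x = tensor_lact a (tensor_lact b x).
Proof.
have [h1 h2] := trilinearl mB lB; have [h3 h4] := trilinearr lB lB.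
move: a b x; apply: (tensor_ext3 h1 h2 h3 h4) => *.
by rewrite tensor_mulE !tensor_lactE !lactA.
Qed.
Lemma tensor_ract1 x : tensor_ract x (tens aone aone) = x.
Proof.
move: x; apply: tensor_ext => [||v w]; [exact: rB.2|exact: linear_id|].
by rewrite tensor_ractE !ract1.
Qed.
Lemma tensor_ractA x a b :
  tensor_ract x (tensor_mul a b) = tensor_ract (tensor_ract x a) b.
Proof.
have [h1 h2] := trilinearr mB rB; have [h3 h4] := trilinearl rB rB.
move: x a b; apply: (tensor_ext3 h1 h2 h3 h4) => *.
by rewrite tensor_mulE !tensor_ractE !ractA.
Qed.
Lemma tensor_lractA a x b :
  tensor_ract (tensor_lact a x) b = tensor_lact a (tensor_ract x b).
Proof.
have [h1 h2] := trilinearl lB rB; have [h3 h4] := trilinearr rB lB.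
move: a x b; apply: (tensor_ext3 h1 h2 h3 h4) => *.
by rewrite !(tensor_lactE, tensor_ractE) !lractA.
Qed.

Definition tensor_bimodule : bimodule (tensor_algebra A B) :=
  @Bimodule K (tensor_algebra A B) (tensor V W) tensor_lact tensor_ract
    tensor_lact_bilinear tensor_ract_bilinear tensor_lact1 tensor_lactA
    tensor_ract1 tensor_ractA tensor_lractA.

End TensorBimodule.

Record markedAlg (K : fieldType) := MarkedAlg {
  marked_sort :> kalgebra K;
  marking : submodClosed marked_sort;
  marking1 : aone \in marking
}.

Section MarkedTensor.
Variables (K : fieldType) (A B : markedAlg K).

Definition unit_line (C : kalgebra K) : submodClosed C :=
  lspan (fun x : C => x = aone).

Definition tensor_marking : submodClosed (tensor_algebra A B) :=
  addsub (tensor_sub (marking A) (unit_line B))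
         (tensor_sub (unit_line A) (marking B)).

Lemma tensor_marking1 : aone \in tensor_marking.
Proof.
apply/asboolP; exists (tens aone aone), 0; split; rewrite ?rpred0 ?addr0 //.
apply: mem_lspan; exists aone, aone; split=> //; first exact: marking1.
exact: mem_lspan.
Qed.

Definition tensor_marked : markedAlg K := MarkedAlg tensor_marking1.
End MarkedTensor.

(* Complexes are supported in nonnegative degrees. *)
Record chain (K : fieldType) := Chain {
  chain_ob :> nat -> lmodType K;
  bd : forall n, {linear chain_ob n.+1 -> chain_ob n};
  bd_bd : forall n x, bd n (bd n.+1 x) = 0
}.

Definition chain_iso (K : fieldType) (C D : chain K) : Prop :=
  exists2 f : forall n, {linear C n -> D n},
    (forall n, bijective (f n)) &
    (forall n x, f n (bd C n x) = bd D n (f n.+1 x)).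

Section Subchain.
Variables (K : fieldType) (C : chain K) (S : forall n, submodClosed (C n)).
Hypothesis bdS : forall n x, x \in S n.+1 -> bd C n x \in S n.

Definition sub_bd n (x : subspace_of (S n.+1)) : subspace_of (S n) :=
  exist _ (bd C n (val x)) (bdS (valP x)).

Lemma sub_bd_linear n : linear (@sub_bd n).
Proof. by move=> a x y; apply: val_inj; rewrite /= linearP. Qed.

Lemma sub_bd_bd n x : sub_bd (@sub_bd n.+1 x) = 0.
Proof. by apply: val_inj; rewrite /= bd_bd. Qed.

Definition subchain : chain K :=
  @Chain K (fun n => subspace_of (S n)) (fun n => linmap (@sub_bd_linear n))
    sub_bd_bd.
End Subchain.

Section Homology.
Variables (K : fieldType) (C : chain K).

Definition cycles (n : nat) : {pred C n} :=
  match n with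
  | 0 => fun=> true
  | m.+1 => fun x => bd C m x == 0
  end.

Lemma cycles_submod n : subsemimod_closed (@cycles n).
Proof.
case: n => [|n]; first by [].
split; first split; first by rewrite unfold_in /= raddf0.
  move=> x y; rewrite !unfold_in /= => /eqP h1 /eqP h2.
  by rewrite raddfD /= h1 h2 addr0.
by move=> a x; rewrite !unfold_in /= => /eqP h; rewrite linearZ /= h scaler0.
Qed.
HB.instance Definition _ n :=
  GRing.isSubmodClosed.Build K (C n) (@cycles n) (@cycles_submod n).

Definition boundaries (n : nat) : {pred subspace_of (@cycles n)} := fun z =>
  `[< exists y : C n.+1, val z = bd C n y >].

Lemma boundaries_submod n : subsemimod_closed (@boundaries n).
Proof.
split; first split; first by apply/asboolP; exists 0; rewrite !raddf0.
  move=> x y /asboolP[x' hx] /asboolP[y' hy]; apply/asboolP.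
  by exists (x' + y'); rewrite !raddfD /= hx hy.
move=> a x /asboolP[x' hx]; apply/asboolP.
by exists (a *: x'); rewrite !linearZ /= hx.
Qed.
HB.instance Definition _ n :=
  GRing.isSubmodClosed.Build K _ (@boundaries n) (@boundaries_submod n).

Definition homology (n : nat) : lmodType K := quotspace (@boundaries n).
End Homology.

Section DirectSum.
Variables (K : fieldType) (I : Type) (W : I -> lmodType K).

Definition dprod : Type := forall i, W i.
HB.instance Definition _ := gen_eqMixin dprod.
HB.instance Definition _ := gen_choiceMixin dprod.

Definition dprod_zero : dprod := fun=> 0.
Definition dprod_opp (x : dprod) : dprod := fun i => - x i.
Definition dprod_add (x y : dprod) : dprod := fun i => x i + y i.
Definition dprod_scale (a : K) (x : dprod) : dprod := fun i => a *: x i.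

Lemma dprod_addA : associative dprod_add.
Proof. by move=> x y z; apply: functional_extensionality_dep => i; exact: addrA. Qed.
Lemma dprod_addC : commutative dprod_add.
Proof. by move=> x y; apply: functional_extensionality_dep => i; exact: addrC. Qed.
Lemma dprod_add0 : left_id dprod_zero dprod_add.
Proof. by move=> x; apply: functional_extensionality_dep => i; exact: add0r. Qed.
Lemma dprod_addN : left_inverse dprod_zero dprod_opp dprod_add.
Proof. by move=> x; apply: functional_extensionality_dep => i; exact: addNr. Qed.
HB.instance Definition _ :=
  GRing.isZmodule.Build dprod dprod_addA dprod_addC dprod_add0 dprod_addN.

Lemma dprod_scaleA a b x :
  dprod_scale a (dprod_scale b x) = dprod_scale (a * b) x.
Proof. by apply: functional_extensionality_dep => i; exact: scalerA. Qed.
Lemma dprod_scale1 : left_id 1 dprod_scale.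
Proof. by move=> x; apply: functional_extensionality_dep => i; exact: scale1r. Qed.
Lemma dprod_scaleDr : right_distributive dprod_scale +%R.
Proof.
by move=> a x y; apply: functional_extensionality_dep => i; exact: scalerDr.
Qed.
Lemma dprod_scaleDl x : {morph dprod_scale^~ x : a b / a + b}.
Proof.
by move=> a b; apply: functional_extensionality_dep => i; exact: scalerDl.
Qed.
HB.instance Definition _ := GRing.Zmodule_isLmodule.Build K dprod
  dprod_scaleA dprod_scale1 dprod_scaleDr dprod_scaleDl.

End DirectSum.

Record bidegree (n : nat) := Bidegree {
  bdl : nat;
  bdr : nat;
  bidegreeP : (bdl + bdr)%N = n
}.

Lemma bidegree_Sl n (i : bidegree n) : ((bdl i).+1 + bdr i)%N = n.+1.
Proof. by rewrite addSn bidegreeP. Qed.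
Lemma bidegree_Sr n (i : bidegree n) : (bdl i + (bdr i).+1)%N = n.+1.
Proof. by rewrite addnS bidegreeP. Qed.

Definition incl n (i : bidegree n) : bidegree n.+1 := Bidegree (bidegree_Sl i).
Definition incr n (i : bidegree n) : bidegree n.+1 := Bidegree (bidegree_Sr i).

(* (C (x) D)_n is the direct sum of the C_p (x) D_q over the finitely many
   pairs (p, q) with p + q = n. *)
Definition graded_tensor (K : fieldType) (C D : nat -> lmodType K) (n : nat) :
    lmodType K :=
  dprod (fun i : bidegree n => tensor (C (bdl i)) (D (bdr i))).

Section ChainTensor.
Variables (K : fieldType) (C D : chain K).

(* The differential c (x) d |-> dc (x) d + (-1)^p c (x) dd, for c in C_p; below
   is its component of bidegree i, which comes from those of bidegrees
   i + (1, 0) and i + (0, 1). *)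
Definition tensor_bd n (x : graded_tensor C D n.+1) : graded_tensor C D n :=
  fun i => tensor_map (bd C (bdl i)) id (x (incl i))
           + (-1) ^+ bdl i *: tensor_map id (bd D (bdr i)) (x (incr i)).

Let lL p q : linear (@tensor_map K _ _ _ _ (bd C p) (@id (D q))).
Proof. by apply: tensor_map_linear => //; exact: linearP. Qed.
Let rL p q : linear (@tensor_map K _ _ _ _ (@id (C p)) (bd D q)).
Proof. by apply: tensor_map_linear => //; exact: linearP. Qed.

Lemma tensor_bd_linear n : linear (@tensor_bd n).
Proof.
move=> a x y; apply: functional_extensionality_dep => i.
rewrite /tensor_bd; change ((a *: x + y) (incl i)) with (a *: x (incl i) + y (incl i)).
rewrite lL.
change ((a *: x + y) (incr i)) with (a *: x (incr i) + y (incr i)).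
rewrite rL /= scalerDr scalerA mulrC -scalerA addrACA -scalerDr.
by [].
Qed.

Lemma tensor_map_ll p q (z : tensor (C p.+2) (D q)) :
  tensor_map (bd C p) id (tensor_map (bd C p.+1) (@id (D q)) z) = 0.
Proof.
move: z; apply: tensor_ext => [||c d].
- exact: linear_comp (@lL p q) (@lL p.+1 q).
- by move=> a x y; rewrite scaler0 addr0.
- rewrite !tensor_map_tens; try exact: linearP; try exact: linear_id.
  by rewrite bd_bd (linear0f ((tens_bilinear _ _).2 _)).
Qed.

Lemma tensor_map_rr p q (z : tensor (C p) (D q.+2)) :
  tensor_map id (bd D q) (tensor_map (@id (C p)) (bd D q.+1) z) = 0.
Proof.
move: z; apply: tensor_ext => [||c d].
- exact: linear_comp (@rL p q) (@rL p q.+1).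
- by move=> a x y; rewrite scaler0 addr0.
- rewrite !tensor_map_tens; try exact: linearP; try exact: linear_id.
  by rewrite bd_bd (linear0f ((tens_bilinear _ _).1 _)).
Qed.

Lemma tensor_map_lr p q (z : tensor (C p.+1) (D q.+1)) :
  tensor_map (bd C p) id (tensor_map id (bd D q) z) =
  tensor_map id (bd D q) (tensor_map (bd C p) id z).
Proof.
move: z; apply: tensor_ext => [||c d].
- exact: linear_comp (@lL p q) (@rL p.+1 q).
- exact: linear_comp (@rL p q) (@lL p q.+1).
- by rewrite !tensor_map_tens; try exact: linearP; try exact: linear_id.
Qed.

Lemma tensor_bd_bd n x : tensor_bd (@tensor_bd n.+1 x) = 0.
Proof.
apply: functional_extensionality_dep => i; rewrite /tensor_bd /=.
rewrite (addrC (tensor_map _ _ (x (incl (incl i))))) lL.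
rewrite (addrC (tensor_map _ _ (x (incl (incr i))))) rL.
rewrite tensor_map_ll tensor_map_rr scaler0 add0r addr0 -tensor_map_lr.
rewrite /incr /incl /=.
rewrite (eq_irrelevance (bidegree_Sr (incl i)) (bidegree_Sl (incr i))).
by rewrite exprS mulN1r scaleNr addNr.
Qed.

Definition chain_tensor : chain K :=
  @Chain K (graded_tensor C D) (fun n => linmap (@tensor_bd_linear n))
    tensor_bd_bd.
End ChainTensor.

(* face n i is d_i : A_{n+1} -> A_n, meaningful for i <= n + 1, and degen n i
   is s_i : A_n -> A_{n+1}, meaningful for i <= n. *)
Record simplicial (K : fieldType) := Simplicial {
  simp_ob :> nat -> lmodType K;
  face : forall n (i : nat), {linear simp_ob n.+1 -> simp_ob n};
  degen : forall n (i : nat), {linear simp_ob n -> simp_ob n.+1};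
  face_face : forall n i j x, (i < j <= n.+2)%N ->
    face n i (face n.+1 j x) = face n j.-1 (face n.+1 i x);
  degen_degen : forall n i j x, (i <= j <= n)%N ->
    degen n.+1 i (degen n j x) = degen n.+1 j.+1 (degen n i x);
  face_degen_lt : forall n i j x, (i < j <= n.+1)%N ->
    face n.+1 i (degen n.+1 j x) = degen n j.-1 (face n i x);
  face_degen_eq : forall n i x, (i <= n)%N ->
    face n i (degen n i x) = x;
  face_degen_succ : forall n i x, (i <= n)%N ->
    face n i.+1 (degen n i x) = x;
  face_degen_gt : forall n i j x, (j.+1 < i <= n.+2)%N ->
    face n.+1 i (degen n.+1 j x) = degen n j (face n i.-1 x)
}.

Section Simplicial.
Variables (K : fieldType) (A : simplicial K).

Definition altface n (x : A n.+1) : A n :=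
  \sum_(i < n.+2) (-1) ^+ i *: face A n i x.

Lemma altface_linear n : linear (@altface n).
Proof.
move=> a x y; rewrite /altface scaler_sumr -big_split /=.
apply: eq_bigr => i _; rewrite linearP scalerDr.
by rewrite !scalerA [a * _]mulrC.
Qed.

Lemma altface_altface n x : altface (@altface n.+1 x) = 0.
Proof.
pose F i j := (-1) ^+ (i + j) *: face A n i (face A n.+1 j x).
have -> : altface (altface x) = \sum_(i < n.+2) \sum_(j < n.+3) F i j.
  apply: eq_bigr => i _; rewrite /altface raddf_sum scaler_sumr /=.
  by apply: eq_bigr => j _; rewrite linearZ /= scalerA -exprD.
rewrite (eq_bigr (fun i : 'I_n.+2 => \sum_(j < n.+2 | (i <= j)%N) F i j.+1
    + \sum_(j < n.+2 | (j <= i)%N) F i j)) => [|i _]; last first.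
  rewrite (bigID (fun j : 'I_n.+3 => (i < j)%N)) /=; congr (_ + _).
    by rewrite big_mkcond big_ord_recl /= add0r -big_mkcond.
  rewrite big_mkcond big_ord_recr /= ltn_ord addr0 -big_mkcond.
  by apply: eq_bigl => j /=; rewrite -leqNgt.
rewrite big_split /= (exchange_big_dep xpredT) //= -big_split big1 // => k _.
rewrite -big_split big1 // => i ik.
rewrite /F face_face; last by rewrite ltnS ik; exact: ltn_ord.
rewrite [(k + i)%N]addnC addnS exprS mulN1r scaleNr; exact: addNr.
Qed.

Definition unnormalized : chain K :=
  @Chain K A (fun n => linmap (@altface_linear n)) altface_altface.

Definition moore (n : nat) : {pred A n} :=
  match n with
  | 0 => fun=> true
  | m.+1 => fun x => [forall i : 'I_m.+2, (0 < i)%N ==> (face A m i x == 0)]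
  end.

Lemma mooreP n (x : A n.+1) :
  reflect (forall i, (0 < i <= n.+1)%N -> face A n i x = 0)
          (x \in @moore n.+1).
Proof.
apply: (iffP forallP) => [h i /andP[i0 ile]|h i].
  have := h (Ordinal (ile : (i < n.+2)%N)) => /=.
  by rewrite i0 => /eqP.
apply/implyP => i0; apply/eqP; apply: h; rewrite i0 /=.
by have := ltn_ord i.
Qed.

Lemma moore_submod n : subsemimod_closed (@moore n).
Proof.
case: n => [|n]; first by [].
split; first split.
- by apply/mooreP => i _; rewrite raddf0.
- move=> x y /mooreP hx /mooreP hy; apply/mooreP => i hi.
  by rewrite raddfD /= hx // hy // addr0.
- move=> a x /mooreP hx; apply/mooreP => i hi.
  by rewrite linearZ /= hx // scaler0.
Qed.
HB.instance Definition _ n :=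
  GRing.isSubmodClosed.Build K (A n) (@moore n) (@moore_submod n).

(* The sum of the images of s_0, ..., s_{n-1} in A_n. *)
Definition degenerate (n : nat) : {pred A n} :=
  match n with
  | 0 => fun x => x == 0
  | m.+1 => fun x =>
      `[< exists a : nat -> A m, x = \sum_(i < m.+1) degen A m i (a i) >]
  end.

Lemma degenerate_submod n : subsemimod_closed (@degenerate n).
Proof.
case: n => [|n].
  split; first split; first by rewrite unfold_in /=.
    by move=> x y; rewrite !unfold_in => /eqP-> /eqP->; rewrite addr0.
  by move=> a x; rewrite !unfold_in => /eqP->; rewrite scaler0.
split; first split.
- by apply/asboolP; exists (fun=> 0); rewrite big1 // => i _; rewrite raddf0.
- move=> x y /asboolP[a ->] /asboolP[b ->]; apply/asboolP.
  exists (fun i => a i + b i); rewrite -big_split.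
  by apply: eq_bigr => i _; rewrite raddfD.
- move=> c x /asboolP[a ->]; apply/asboolP.
  exists (fun i => c *: a i); rewrite scaler_sumr.
  by apply: eq_bigr => i _; rewrite linearZ.
Qed.
HB.instance Definition _ n :=
  GRing.isSubmodClosed.Build K (A n) (@degenerate n) (@degenerate_submod n).

Lemma mem_degen n i (x : A n) : (i <= n)%N -> degen A n i x \in @degenerate n.+1.
Proof.
move=> hi; apply/asboolP.
exists (fun j => if j == i then x else 0).
rewrite (bigD1 (Ordinal (hi : (i < n.+1)%N))) //= eqxx big1 ?addr0 // => j.
by rewrite -val_eqE /= => /negPf->; rewrite raddf0.
Qed.

Lemma moore_degenerate n (x : A n) :
  x \in @moore n -> x \in @degenerate n -> x = 0.
Proof.
case: n x => [x _|n x /mooreP hx /asboolP[a]].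
  by rewrite unfold_in => /eqP.
suff h m : (m <= n.+1)%N -> forall a : nat -> A n,
    x = \sum_(i < m) degen A n i (a i) -> x = 0 by exact: (h n.+1).
elim: m => [_ b|m IH hm {}a]; first by rewrite big_ord0.
rewrite big_ord_recr /= => xE.
have h0 : face A n m.+1 x = 0 by apply: hx.
case: m => [|m] in IH hm xE h0 *.
  move: h0; rewrite xE big_ord0 add0r face_degen_succ // => ->.
  by rewrite raddf0.
case: n => [//|n] in x hx a IH hm xE h0 *.
have aE : a m.+1 = - \sum_(i < m.+1) degen A n i (face A n m.+1 (a i)).
  apply/eqP; rewrite -addr_eq0 addrC; apply/eqP; rewrite -[RHS]h0 xE.
  rewrite raddfD /= face_degen_succ; last by rewrite -ltnS.
  rewrite raddf_sum; congr (_ + _); apply: eq_bigr => i _.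
  by rewrite /= face_degen_gt //=; have := ltn_ord i; lia.
apply: (IH (ltnW hm) (fun i => a i - degen A n m (face A n m.+1 (a i)))).
rewrite xE aE raddfN raddf_sum -sumrN -big_split; apply: eq_bigr => i _ /=.
rewrite raddfB; congr (_ - _); rewrite -degen_degen //.
have := ltn_ord i; lia.
Qed.

Lemma moore_degenerate_ex n (x : A n) :
  exists2 y, y \in @moore n & x - y \in @degenerate n.
Proof.
case: n x => [x|n x]; first by exists x; rewrite // subrr rpred0.
suff [y hy xy] : exists2 y, (forall i, (0 < i <= n.+1)%N -> face A n i y = 0) &
    x - y \in @degenerate n.+1 by exists y => //; apply/mooreP.
have h k : (k <= n.+1)%N ->
  exists2 y, (forall i, (n.+1 - k < i <= n.+1)%N -> face A n i y = 0) &
    x - y \in @degenerate n.+1.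
  elim: k => [_|k IH hk].
    exists x; last by rewrite subrr rpred0.
    by move=> i; rewrite subn0 ltnNge => /andP[/negP].
  have [y hy xy] := IH (ltnW hk).
  have [p pE] : {p | (n.+1 - k)%N = p.+1} by exists (n - k)%N; lia.
  have pn : (p <= n)%N by lia.
  exists (y - degen A n p (face A n p.+1 y)); last first.
    by rewrite opprB addrCA rpredD // mem_degen.
  move=> i hi; rewrite raddfB /=.
  have [->|ip] := eqVneq i p.+1; first by rewrite face_degen_succ // subrr.
  have ilt : (p.+1 < i <= n.+1)%N by lia.
  rewrite (hy i); last by lia.
  case: n => [|n] in x y hy xy pE pn hi ilt hk IH *; first by lia.
  rewrite face_degen_gt // -face_face; last by lia.
  by rewrite hy ?pE // raddf0 raddf0 subrr.
have [y hy xy] := h n.+1 (leqnn _); exists y => //.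
by move=> i hi; apply: hy; lia.
Qed.

Definition rho n (x : A n) : A n := s2val (cid2 (moore_degenerate_ex x)).

Lemma rho_moore n (x : A n) : rho x \in @moore n.
Proof. by rewrite /rho; case: cid2. Qed.

Lemma rho_degenerate n (x : A n) : x - rho x \in @degenerate n.
Proof. by rewrite /rho; case: cid2. Qed.

Lemma rho_unique n (x y : A n) :
  y \in @moore n -> x - y \in @degenerate n -> rho x = y.
Proof.
move=> ym xy; apply/eqP; rewrite -subr_eq0; apply/eqP/moore_degenerate.
  by rewrite rpredB // rho_moore.
rewrite (_ : rho x - y = (x - y) - (x - rho x)).
  by rewrite rpredB // rho_degenerate.
by rewrite opprB [RHS]addrC addrA subrK.
Qed.

Lemma rho_linear n : linear (@rho n).
Proof.
move=> a x y; apply: rho_unique.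
  by rewrite rpredD ?rpredZ ?rho_moore.
rewrite opprD addrACA -scalerBr.
by rewrite rpredD ?rpredZ ?rho_degenerate.
Qed.

End Simplicial.

Section Words.
Variables (K : fieldType) (A : kalgebra K).

(* Letters are numbered from 0: word l k is lambda_{k+1}. *)
Definition word n (l : n.-tuple A) (k : nat) : A := nth 0 l k.

Definition of_word n (f : nat -> A) : n.-tuple A := [tuple f i | i < n].

Definition set_word n (l : n.-tuple A) (k : nat) (x : A) : n.-tuple A :=
  of_word n (fun j => if j == k then x else word l j).

Lemma word_of n f k : word (of_word n f) k = if (k < n)%N then f k else 0.
Proof.
rewrite /word; case: ifP => kn.
  by have := nth_mktuple (fun i : 'I_n => f i) 0 (Ordinal kn).
by rewrite nth_default // size_tuple leqNgt kn.
Qed.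

Lemma word_ge n (l : n.-tuple A) k : (n <= k)%N -> word l k = 0.
Proof. by move=> nk; rewrite /word nth_default // size_tuple. Qed.

Lemma word_ext n (l m : n.-tuple A) :
  (forall k, (k < n)%N -> word l k = word m k) -> l = m.
Proof.
move=> h; apply: eq_from_tnth => i.
by rewrite !(tnth_nth 0); exact: h.
Qed.

Definition face_fun (i : nat) (f : nat -> A) (j : nat) : A :=
  if (j.+1 < i)%N then f j
  else if j.+1 == i then amul (f j) (f j.+1) else f j.+1.

Definition degen_fun (i : nat) (f : nat -> A) (j : nat) : A :=
  if (j < i)%N then f j else if j == i then aone else f j.-1.

End Words.

Section Bar.
Variables (K : fieldType) (A : kalgebra K) (V : bimodule A).

Definition multilinear_on n (W : lmodType K) (f : V * n.-tuple A -> W) : Prop :=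
  (forall l, linear (fun v => f (v, l))) /\
  (forall v l (k : 'I_n), linear (fun x => f (v, set_word l k x))).

Definition bar_ob (n : nat) : lmodType K := universal (@multilinear_on n).

(* v (x) lambda_1 (x) ... (x) lambda_n *)
Definition pure n (v : V) (l : n.-tuple A) : bar_ob n :=
  ugen (@multilinear_on n) (v, l).

(* The word underlying d_i is given by the same formula for all i; it drops
   the first letter when i = 0 and the last one when i = n + 1. *)
Definition face_word n (i : nat) (l : n.+1.-tuple A) : n.-tuple A :=
  of_word n (face_fun i (word l)).
(* Only i <= n + 1 matters, so that n < i means i = n + 1. *)
Definition face_coef n (i : nat) (v : V) (l : n.+1.-tuple A) : V :=
  if i == 0%N then ract v (word l 0)
  else if (n < i)%N then lact (word l n) v else v.
Definition degen_word n (i : nat) (l : n.-tuple A) : n.+1.-tuple A :=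
  of_word n.+1 (degen_fun i (word l)).

Definition bar_face n (i : nat) : bar_ob n.+1 -> bar_ob n :=
  ulift (fun p => pure (face_coef i p.1 p.2) (face_word i p.2)).
Definition bar_degen n (i : nat) : bar_ob n -> bar_ob n.+1 :=
  ulift (fun p => pure p.1 (degen_word i p.2)).

Lemma pure_linearl n (l : n.-tuple A) : linear (fun v => pure v l).
Proof. by move=> a u v; apply: ugen_rel => W f [f1 f2]; exact: f1. Qed.

Lemma pure_linearr n v (l : n.-tuple A) (k : 'I_n) :
  linear (fun x => pure v (set_word l k x)).
Proof. by move=> a x y; apply: ugen_rel => W f [f1 f2]; exact: f2. Qed.

Lemma pure_linearr_comp n (F : A -> bar_ob n) v (l : n.-tuple A) (k : nat)
    (g : A -> A) :
  (k < n)%N -> linear g -> (forall x, F x = pure v (set_word l k (g x))) ->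
  linear F.
Proof.
move=> kn gL FE a x y; rewrite !FE gL.
exact: (pure_linearr v l (Ordinal kn)).
Qed.

Lemma pure_linearl_comp n (F : A -> bar_ob n) (l : n.-tuple A) (g : A -> V) :
  linear g -> (forall x, F x = pure (g x) l) -> linear F.
Proof. by move=> gL FE a x y; rewrite !FE gL pure_linearl. Qed.

Lemma bar_ext n (W : lmodType K) (f g : bar_ob n -> W) :
  linear f -> linear g -> (forall v l, f (pure v l) = g (pure v l)) -> f =1 g.
Proof. by move=> fL gL fg; apply: ulift_unique => // -[v l]; exact: fg. Qed.

Ltac word_cases :=
  repeat (case: ifP => ?);
  first [ lia | done | by rewrite ?amulA ?amul1 ?a1mul; repeat first [lia | f_equal]
        | by rewrite word_ge //; lia ].

Ltac word_tac :=
  apply: word_ext => ? ?;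
  rewrite /face_word /degen_word /set_word !word_of /face_fun /degen_fun
    ?word_of /face_fun /degen_fun ?word_of; word_cases.

Ltac coef_tac :=
  rewrite /face_coef /face_word /degen_word /set_word ?word_of /face_fun /degen_fun;
  repeat (case: ifP => ?);
  first [ lia | done
        | by rewrite ?ractA ?lactA ?lractA ?lact1 ?ract1 ?amul1 ?a1mul; repeat first [lia | f_equal] ].

Lemma face_multilinear n i :
  multilinear_on (fun p => pure (face_coef (n := n) i p.1 p.2) (face_word i p.2)).
Proof.
split=> [l|v l k] /=.
  have h : linear (fun v => face_coef i v l).
    rewrite /face_coef; case: (i == 0%N); first exact: (ract_bilinear V).2.
    by case: (n < i)%N; [exact: (lact_bilinear V).1|exact: linear_id].
  by move=> a u v; rewrite h pure_linearl.
have hk := ltn_ord k.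
have [/andP[ni kn]|hn] := boolP ((n < i) && (nat_of_ord k == n))%N.
  apply: (pure_linearl_comp (l := face_word i l) (g := fun x => lact x v)).
    exact: (lact_bilinear V).2.
  move=> x; congr pure; last by word_tac.
  coef_tac.
have [/andP[i0 k0]|h0] := boolP ((i == 0) && (nat_of_ord k == 0))%N.
  apply: (pure_linearl_comp (l := face_word i l) (g := fun x => ract v x)).
    exact: (ract_bilinear V).1.
  move=> x; congr pure; last by word_tac.
  coef_tac.
pose p := if (k < i)%N then nat_of_ord k else k.-1.
pose g x := if k.+1 == i then amul x (word l k.+1) else
  if k == i :> nat then amul (word l k.-1) x else x.
have gL : linear g.
  rewrite /g; case: (k.+1 == i); first exact: (amul_bilinear A).2.
  by case: (_ == _); [exact: (amul_bilinear A).1|exact: linear_id].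
have pn : (p < n)%N by rewrite /p; case: ifP => ?; lia.
apply: (pure_linearr_comp (v := face_coef i v l) (l := face_word i l) pn gL).
move=> x; congr pure.
  coef_tac.
rewrite /p /g {pn}; case: (ltnP k i) => ?; word_tac.
Qed.

Lemma degen_multilinear n i :
  multilinear_on (fun p : V * n.-tuple A => pure p.1 (degen_word i p.2)).
Proof.
split=> [l|v l k] /=; first exact: pure_linearl.
have hk := ltn_ord k.
pose p := if (k < i)%N then nat_of_ord k else k.+1.
have pn : (p < n.+1)%N by rewrite /p; case: ifP => ?; lia.
apply: (pure_linearr_comp (v := v) (l := degen_word i l) pn (@linear_id _ _)).
move=> x; congr pure; rewrite /p {pn}; case: (ltnP k i) => ?; word_tac.
Qed.

Lemma bar_face_linear n i : linear (@bar_face n i).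
Proof. exact/ulift_linear/face_multilinear. Qed.
Lemma bar_degen_linear n i : linear (@bar_degen n i).
Proof. exact/ulift_linear/degen_multilinear. Qed.

Lemma bar_face_pure n i v (l : n.+1.-tuple A) :
  bar_face i (pure v l) = pure (face_coef i v l) (face_word i l).
Proof. by rewrite /bar_face ulift_gen //; exact: face_multilinear. Qed.
Lemma bar_degen_pure n i v (l : n.-tuple A) :
  bar_degen i (pure v l) = pure v (degen_word i l).
Proof. by rewrite /bar_degen ulift_gen //; exact: degen_multilinear. Qed.

Lemma bar_face_face n i j x : (i < j <= n.+2)%N ->
  bar_face (n := n) i (bar_face (n := n.+1) j x) = bar_face j.-1 (bar_face i x).
Proof.
move=> hij; move: x; apply: bar_ext => [||v l].
- by apply: linear_comp; exact: bar_face_linear.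
- by apply: linear_comp; exact: bar_face_linear.
rewrite !bar_face_pure; congr pure; [coef_tac|word_tac].
Qed.

Lemma bar_degen_degen n i j x : (i <= j <= n)%N ->
  bar_degen (n := n.+1) i (bar_degen (n := n) j x) =
  bar_degen j.+1 (bar_degen i x).
Proof.
move=> hij; move: x; apply: bar_ext => [||v l].
- by apply: linear_comp; exact: bar_degen_linear.
- by apply: linear_comp; exact: bar_degen_linear.
rewrite !bar_degen_pure; congr pure; word_tac.
Qed.

Lemma bar_face_degen_lt n i j x : (i < j <= n.+1)%N ->
  bar_face (n := n.+1) i (bar_degen (n := n.+1) j x) =
  bar_degen j.-1 (bar_face i x).
Proof.
move=> hij; move: x; apply: bar_ext => [||v l].
- by apply: linear_comp; [exact: bar_face_linear|exact: bar_degen_linear].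
- by apply: linear_comp; [exact: bar_degen_linear|exact: bar_face_linear].
rewrite !(bar_face_pure, bar_degen_pure); congr pure; [coef_tac|word_tac].
Qed.

Lemma bar_face_degen_eq n i x : (i <= n)%N ->
  bar_face i (bar_degen (n := n) i x) = x.
Proof.
move=> hij; move: x; apply: bar_ext => [||v l].
- by apply: linear_comp; [exact: bar_face_linear|exact: bar_degen_linear].
- exact: linear_id.
rewrite !(bar_face_pure, bar_degen_pure); congr pure; [coef_tac|word_tac].
Qed.

Lemma bar_face_degen_succ n i x : (i <= n)%N ->
  bar_face i.+1 (bar_degen (n := n) i x) = x.
Proof.
move=> hij; move: x; apply: bar_ext => [||v l].
- by apply: linear_comp; [exact: bar_face_linear|exact: bar_degen_linear].
- exact: linear_id.
rewrite !(bar_face_pure, bar_degen_pure); congr pure; [coef_tac|word_tac].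
Qed.

Lemma bar_face_degen_gt n i j x : (j.+1 < i <= n.+2)%N ->
  bar_face (n := n.+1) i (bar_degen (n := n.+1) j x) =
  bar_degen j (bar_face i.-1 x).
Proof.
move=> hij; move: x; apply: bar_ext => [||v l].
- by apply: linear_comp; [exact: bar_face_linear|exact: bar_degen_linear].
- by apply: linear_comp; [exact: bar_degen_linear|exact: bar_face_linear].
rewrite !(bar_face_pure, bar_degen_pure); congr pure; [coef_tac|word_tac].
Qed.

Definition bar : simplicial K :=
  @Simplicial K bar_ob
    (fun n i => linmap (@bar_face_linear n i))
    (fun n i => linmap (@bar_degen_linear n i))
    bar_face_face bar_degen_degen bar_face_degen_lt
    bar_face_degen_eq bar_face_degen_succ bar_face_degen_gt.

End Bar.

Section Omega.
Variables (K : fieldType) (A : markedAlg K) (V : bimodule A).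

(* B_n = V (x) M^{(x) n} *)
Definition Bsub n : submodClosed (bar V n) :=
  lspan (fun x : bar V n => exists v (l : n.-tuple A),
    (forall i, tnth l i \in marking A) /\ x = pure v l).

Definition Bbar n : {pred bar V n} := fun x =>
  `[< exists2 b, b \in Bsub n & x = rho b >].

Lemma Bbar_submod n : subsemimod_closed (@Bbar n).
Proof.
have h a x y : x \in @Bbar n -> y \in @Bbar n -> a *: x + y \in @Bbar n.
  move=> /asboolP[b bB ->] /asboolP[c cB ->]; apply/asboolP.
  by exists (a *: b + c); rewrite ?rpredD ?rpredZ ?rho_linear.
have h0 : 0 \in @Bbar n.
  apply/asboolP; exists 0; first exact: rpred0.
  by rewrite (linear0f (@rho_linear _ _ _)).
split; first by split=> // x y hx hy; rewrite -[x]scale1r h.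
by move=> a x hx; rewrite -[a *: x]addr0 h.
Qed.
HB.instance Definition _ n :=
  GRing.isSubmodClosed.Build K (bar V n) (@Bbar n) (@Bbar_submod n).

Definition omega (n : nat) : {pred bar V n} :=
  match n with
  | 0 => fun x => x \in @Bbar 0
  | m.+1 => fun x =>
      (x \in @Bbar m.+1) && (bd (unnormalized (bar V)) m x \in @Bbar m)
  end.

Lemma omega_moore n x : x \in @omega n -> x \in @moore _ (bar V) n.
Proof.
have h m (y : bar V m) : y \in @Bbar m -> y \in @moore _ (bar V) m.
  by move=> /asboolP[b _ ->]; exact: rho_moore.
by case: n x => [//|n] x /andP[/h].
Qed.

Lemma omega_submod n : subsemimod_closed (@omega n).
Proof.
case: n => [|n].
  split; first by split=> [|x y hx hy]; [exact: rpred0|exact: rpredD].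
  by move=> a x hx; exact: rpredZ.
split; first split.
- by apply/andP; split; rewrite ?raddf0 rpred0.
- move=> x y /andP[x1 x2] /andP[y1 y2].
  by apply/andP; split; rewrite ?raddfD rpredD.
- move=> a x /andP[x1 x2].
  by apply/andP; split; rewrite ?linearZ rpredZ.
Qed.
HB.instance Definition _ n :=
  GRing.isSubmodClosed.Build K (bar V n) (@omega n) (@omega_submod n).

Lemma bd_omega n x :
  x \in @omega n.+1 -> bd (unnormalized (bar V)) n x \in @omega n.
Proof.
move=> /andP[_ xB]; case: n x xB => [//|n] x xB.
by apply/andP; split; rewrite ?bd_bd ?rpred0.
Qed.

Definition Omega : chain K :=
  subchain (C := unnormalized (bar V)) (S := fun n => @omega n) bd_omega.

End Omega.

Definition PHH (K : fieldType) (A : markedAlg K) (n : nat) : lmodType K :=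
  homology (Omega (regular_bimodule A)) n.

(* Main.v *)
(* For bimodules V, V' the bar object of the tensor product is, in degree n,
   the tensor product of the two bar objects, so the Eilenberg-Zilber shuffle
   map sends N(V)_p (x) N(V')_q to N(V (x) V')_(p+q): an element of V (x) V'
   followed by a word in which the letters of the left word (as a (x) 1) and of
   the right word (as 1 (x) b) are shuffled, summed with signs.  On Moore chains
   every face except d_0 kills this sum, because merging two letters of the same
   side gives a face d_j with j > 0 of a Moore chain and merging a (x) 1 with
   1 (x) b gives the same result in both orders, with opposite signs.  Hence it
   is a chain map, and it maps Bbar (x) Bbar' into Bbar of the tensor marking.
   Conversely let x be in Omega of the tensor marking.  Modulo degenerate chains
   its words have letters in M (x) 1 or in 1 (x) M', so x is the sum over all
   patterns of its components; the letters a (x) b with a, b not in the unit line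
   produced by merging unequal neighbours cannot occur in d x, which forces the
   components of two patterns differing by a transposition to be opposite.  So x
   is the shuffle of its component of pattern left...left right...right.  That
   this component lies in Omega (x) Omega' is linear algebra over a field, and
   the statement on homology is the Kunneth formula over a field. *)
Require Import Defs.
From HB Require Import structures.
From mathcomp Require Import all_boot all_order all_algebra.
From mathcomp Require Import boolp classical_sets.
From mathcomp Require Import zify.

Set Implicit Arguments.
Unset Strict Implicit.
Unset Printing Implicit Defensive.

Import GRing.Theory.
Local Open Scope ring_scope.

(** * Linear algebra over a field *)

(** The component of a given pattern is only meaningful modulo degenerate chains, that is for
    letters modulo the unit line. To turn it into an honest linear map ([unshuffle]), functionals
    [chi], [chi'] with value 1 on the units are chosen: each algebra is the unit line plus the
    kernel of its functional. They exist only when the algebras are nonzero, which forces a separate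
    zero case.

    The second obstacle is to compare tensor products of subspaces in arbitrary dimension.
    Membership in S (x) S' is always expressed as invariance under r (x) r' for linear projections
    r, r' onto S, S': [rho] for Moore chains, [Bbar_proj] for Bbar. The passage from Bbar (x) Bbar'
    to Omega (x) Omega' can then be made one variable at a time, because 1 - r applied to a single
    factor of the boundary separates the two summands of the tensor differential. *)

Section LinearAlgebra.
Variable K : fieldType.

Lemma submodB (U : lmodType K) (S : submodClosed U) x y :
  x \in S -> y \in S -> x - y \in S.
Proof. by move=> xS yS; rewrite -scaleN1r rpredD ?rpredZ. Qed.

(** Zorn's lemma yields a maximal subset [C] closed under [a *: x + y] and meeting [S] only in 0. A
    vector [u] outside S + C could be added to [C], since a vector a u + c of S with a nonzero would
    put [u] in S + C. So S and C are complements, and [r] projects along [C]. *)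
Lemma linear_projection (U : lmodType K) (S : submodClosed U) :
  exists r : {linear U -> U},
    (forall u, r u \in S) /\ (forall s, s \in S -> r s = s).
Proof.
pose P (C : set U) := (forall a x y, C x -> C y -> C (a *: x + y)) /\
  (forall x, C x -> x \in S -> x = 0).
have [F FP Ftot|C [[Cl C0] Cmax]] := @Zorn_bigcup U P.
  split=> [a x y [X FX Xx] [Y FY Yy]|x [X FX Xx]]; last exact: (FP _ FX).2.
  have [XY|YX] := Ftot _ _ FX FY.
    by exists Y => //; apply: (FP _ FY).1 => //; exact: XY.
  by exists X => //; apply: (FP _ FX).1 => //; exact: YX.
(* [P] holds for the empty set, as the union of the empty chain requires; that [C] contains 0 has to
   come from maximality. *)
have C00 : C 0.
  apply: contrapT => nC0; apply: (Cmax [set 0]%classic).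
    split=> [x Cx|/(_ 0 erefl)//]; case: nC0.
    by have := Cl (-1) _ _ Cx Cx; rewrite scaleN1r addNr.
  by split=> [a x y -> ->|x ->//]; rewrite /= scaler0 addr0.
have dec u : exists2 s, s \in S & C (u - s).
  apply: contrapT => nu.
  pose D : set U := fun x => exists a c, C c /\ x = a *: u + c.
  have DC : (C `<=` D)%classic.
    by move=> c Cc; exists 0, c; rewrite scale0r add0r.
  apply: (Cmax D).
    split=> // DsubC; case: nu; exists 0; first exact: rpred0.
    by rewrite subr0; apply: DsubC; exists 1, 0; rewrite scale1r addr0.
  split=> [a _ _ [b [c [Cc ->]]] [b' [c' [Cc' ->]]]|].
    exists (a * b + b'), (a *: c + c'); split; first exact: Cl.
    by rewrite scalerDr scalerA addrACA -scalerDl.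
  move=> _ [a [c [Cc ->]]] acS; have [a0|a0] := eqVneq a 0.
    by move: acS; rewrite a0 scale0r add0r => /(C0 _ Cc).
  case: nu; exists (a^-1 *: (a *: u + c)); first exact: rpredZ.
  rewrite scalerDr scalerA mulVf // scale1r opprD addNKr.
  by have := Cl (- a^-1) _ _ Cc C00; rewrite addr0 scaleNr.
pose f u := s2val (cid2 (dec u)).
have fS u : f u \in S by rewrite /f; case: cid2.
have fC u : C (u - f u) by rewrite /f; case: cid2.
have fu u s : s \in S -> C (u - s) -> f u = s.
  move=> sS Cs; apply/eqP; rewrite -subr_eq0; apply/eqP/C0.
    have := Cl (-1) _ _ (fC u) Cs.
    by rewrite scaleN1r opprB addrA subrK.
  exact: submodB.
have fL : linear f.
  move=> a x y; apply: fu; first by rewrite rpredD ?rpredZ.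
  by rewrite opprD addrACA -scalerBr; exact: Cl.
exists (linmap fL); split=> // s sS; apply: fu => //.
by rewrite subrr.
Qed.

Lemma linear_inverse (U W : lmodType K) (f : {linear U -> W}) :
  injective f -> (forall w, exists u, f u = w) ->
  exists2 g : {linear W -> U}, cancel f g & cancel g f.
Proof.
move=> fI fS; pose g w := projT1 (cid (fS w)).
have gK : cancel g f by move=> w; rewrite /g; case: cid.
have gL : linear g by move=> a x y; apply: fI; rewrite linearP !gK.
by exists (linmap gL) => // u; apply: fI; rewrite /= gK.
Qed.

(** A generalized inverse: [g] projects onto the image of [f], then takes the preimage lying in a
    fixed complement of the kernel. *)
Lemma linear_ginv (U W : lmodType K) (f : {linear U -> W}) :
  exists g : {linear W -> U}, forall u, f (g (f u)) = f u.
Proof.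
pose kr : {pred U} := fun u => f u == 0.
have krP : subsemimod_closed kr.
  split; first split; rewrite /= ?unfold_in /kr ?raddf0 //.
    by move=> x y; rewrite !unfold_in /kr raddfD /= => /eqP-> /eqP->; rewrite addr0.
  by move=> a x; rewrite !unfold_in /kr linearZ /= => /eqP->; rewrite /= scaler0.
pose im : {pred W} := fun w => `[< exists u, f u = w >].
have imP : subsemimod_closed im.
  split; first split; first by apply/asboolP; exists 0; rewrite raddf0.
    move=> _ _ /asboolP[x <-] /asboolP[y <-]; apply/asboolP.
    by exists (x + y); rewrite raddfD.
  by move=> a _ /asboolP[x <-]; apply/asboolP; exists (a *: x); rewrite linearZ.
pose krC : submodClosed U :=
  HB.pack_for (submodClosed U) kr (GRing.isSubmodClosed.Build K U kr krP).
pose imC : submodClosed W :=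
  HB.pack_for (submodClosed W) im (GRing.isSubmodClosed.Build K W im imP).
have [k [kK kE]] := linear_projection krC.
have [j [jI jE]] := linear_projection imC.
have ex w : exists u, f u = j w by have /asboolP := jI w.
pose g w := let u := projT1 (cid (ex w)) in u - k u.
have fk u : f (k u) = 0 by apply/eqP; exact: kK.
have fg w : f (g w) = j w.
  by rewrite /g; case: cid => u /= <-; rewrite raddfB /= fk subr0.
have kg w : k (g w) = 0 by rewrite /g raddfB /= (kE (k _)) ?kK // subrr.
have gL : linear g.
  (* The difference [d] is in the kernel of [f], hence fixed by [k], while [k] kills all values of
     [g]; so it is 0. *)
  move=> a x y; apply/eqP; rewrite -subr_eq0; set d := _ - _.
  have <- : k d = d.
    apply: kE; rewrite unfold_in /= /kr /d; apply/eqP.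
    by rewrite raddfB /= linearP /= !fg linearP subrr.
  by rewrite /d raddfB /= linearP /= !kg scaler0 addr0 subr0.
exists (linmap gL) => u; rewrite /= fg jE //.
by apply/asboolP; exists u.
Qed.

End LinearAlgebra.

(** * Linear maps out of tensor products *)

Section Lifts.
Variable K : fieldType.

(* Zero unless f satisfies P, so that it is linear without side condition. *)
Definition universal_lift (X : choiceType) (P : forall W : lmodType K, (X ->
  W) -> Prop)
    (W : lmodType K) (f : X -> W) : {linear universal P -> W} :=
  match pselect (P W f) with
  | left h => linmap (ulift_linear h)
  | right _ => \0
  end.

Lemma universal_lift_gen (X : choiceType) (P : forall W : lmodType K, (X ->
  W) -> Prop)
    (W : lmodType K) (f : X -> W) x : P W f -> universal_lift P f (ugen P x) = f x.
Proof. by move=> Pf; rewrite /universal_lift; case: pselect => //= h;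
  exact: ulift_gen. Qed.

Definition tens_lift (U V W : lmodType K) (f : U -> V -> W) :
    {linear tensor U V -> W} := universal_lift (@bilinear_on K U V) (fun p =>
      f p.1 p.2).

Lemma tens_lift_tens (U V W : lmodType K) (f : U -> V -> W) u v :
  bilinear_map f -> tens_lift f (tens u v) = f u v.
Proof. by move=> fB; rewrite /tens_lift universal_lift_gen. Qed.

Lemma tens0l (U V : lmodType K) (v : V) : tens (0 : U) v = 0.
Proof. exact: (linear0f ((tens_bilinear U V).2 v)). Qed.

Lemma tens0r (U V : lmodType K) (u : U) : tens u (0 : V) = 0.
Proof. exact: (linear0f ((tens_bilinear U V).1 u)). Qed.

Lemma tensDl (U V : lmodType K) (u u' : U) (v : V) :
  tens (u + u') v = tens u v + tens u' v.
Proof. by have := (tens_bilinear U V).2 v 1 u u'; rewrite !scale1r. Qed.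

Lemma tensDr (U V : lmodType K) (u : U) (v v' : V) :
  tens u (v + v') = tens u v + tens u v'.
Proof. by have := (tens_bilinear U V).1 u 1 v v'; rewrite !scale1r. Qed.

Lemma tensZl (U V : lmodType K) a (u : U) (v : V) :
  tens (a *: u) v = a *: tens u v.
Proof. by have := (tens_bilinear U V).2 v a u 0; rewrite !addr0 tens0l addr0. Qed.

Lemma tensZr (U V : lmodType K) a (u : U) (v : V) :
  tens u (a *: v) = a *: tens u v.
Proof. by have := (tens_bilinear U V).1 u a v 0; rewrite !addr0 tens0r addr0. Qed.

Lemma tensNl (U V : lmodType K) (u : U) (v : V) : tens (- u) v = - tens u v.
Proof. by rewrite -scaleN1r tensZl scaleN1r. Qed.

Lemma tensNr (U V : lmodType K) (u : U) (v : V) : tens u (- v) = - tens u v.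
Proof. by rewrite -scaleN1r tensZr scaleN1r. Qed.

Lemma tens_lift_ext (U V W : lmodType K) (f g : {linear tensor U V -> W}) :
  (forall u v, f (tens u v) = g (tens u v)) -> f =1 g.
Proof. by apply: tensor_ext; exact: linearP. Qed.

Lemma tensor_mem (U V W : lmodType K) (S : submodClosed W)
    (f : {linear tensor U V -> W}) :
  (forall u v, f (tens u v) \in S) -> forall z, f z \in S.
Proof.
move=> h; apply: universal_ind => [a p q hp hq||[u v]]; last exact: h.
  by rewrite linearP rpredD ?rpredZ.
by rewrite raddf0 rpred0.
Qed.

End Lifts.

Section TensorFunctor.
Variable K : fieldType.

(* Opaque, so that simplification does not unfold the bundled maps. *)
Lemma tmap_subproof (U U' V V' : lmodType K) (f : {linear U -> V})
    (g : {linear U' -> V'}) :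
  {h : {linear tensor U U' -> tensor V V'} | h =1 tensor_map f g}.
Proof. by exists (linmap (tensor_map_linear (linearP f) (linearP g))). Qed.

Definition tmap (U U' V V' : lmodType K) (f : {linear U -> V})
    (g : {linear U' -> V'}) := sval (tmap_subproof f g).

Lemma tmapE (U U' V V' : lmodType K) (f : {linear U -> V})
    (g : {linear U' -> V'}) : tmap f g =1 tensor_map f g.
Proof. exact: (svalP (tmap_subproof f g)). Qed.

Lemma tmap_tens (U U' V V' : lmodType K) (f : {linear U -> V})
    (g : {linear U' -> V'}) u u' : tmap f g (tens u u') = tens (f u) (g u').
Proof. by rewrite tmapE tensor_map_tens //; exact: linearP. Qed.

Lemma eq_tmap (U U' V V' : lmodType K) (f f2 : {linear U -> V})
    (g g2 : {linear U' -> V'}) : f =1 f2 -> g =1 g2 -> tmap f g =1 tmap f2 g2.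
Proof. by move=> ff gg; apply: tens_lift_ext => u v; rewrite !tmap_tens ff gg. Qed.

Lemma tmap_comp (U U' V V' W W' : lmodType K) (f : {linear V -> W})
    (g : {linear V' -> W'}) (f2 : {linear U -> V}) (g2 : {linear U' -> V'}) z :
  tmap f g (tmap f2 g2 z) = tmap (f \o f2) (g \o g2) z.
Proof.
apply: (@tens_lift_ext _ _ _ _ (tmap f g \o tmap f2 g2)) => u v.
by rewrite /= !tmap_tens.
Qed.

Lemma tmap_id (U U' : lmodType K) (z : tensor U U') : tmap idfun idfun z = z.
Proof.
by apply: (@tens_lift_ext _ _ _ _ _ idfun) => u v; rewrite tmap_tens.
Qed.

Lemma tmapDl (U U' V V' : lmodType K) (f f2 : {linear U -> V})
    (g : {linear U' -> V'}) z : tmap (f \+ f2) g z = tmap f g z + tmap f2 g z.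
Proof.
apply: (@tens_lift_ext _ _ _ _ _ (tmap f g \+ tmap f2 g)) => u v.
by rewrite /= !tmap_tens tensDl.
Qed.

Lemma tmapDr (U U' V V' : lmodType K) (f : {linear U -> V})
    (g g2 : {linear U' -> V'}) z : tmap f (g \+ g2) z = tmap f g z + tmap f g2 z.
Proof.
apply: (@tens_lift_ext _ _ _ _ _ (tmap f g \+ tmap f g2)) => u v.
by rewrite /= !tmap_tens tensDr.
Qed.

Lemma tmap0l (U U' V V' : lmodType K) (f : {linear U -> V})
    (g : {linear U' -> V'}) z : f =1 (fun=> 0) -> tmap f g z = 0.
Proof.
by move=> f0; apply: (@tens_lift_ext _ _ _ _ _ \0) => u v;
  rewrite tmap_tens f0 tens0l.
Qed.

Lemma tmap0r (U U' V V' : lmodType K) (f : {linear U -> V})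
    (g : {linear U' -> V'}) z : g =1 (fun=> 0) -> tmap f g z = 0.
Proof.
by move=> f0; apply: (@tens_lift_ext _ _ _ _ _ \0) => u v;
  rewrite tmap_tens f0 tens0r.
Qed.

End TensorFunctor.

(** * The Kunneth formula *)

Section Isomorphisms.
Variable K : fieldType.

Lemma lin_iso_bij (U W : lmodType K) (f : {linear U -> W}) :
  injective f -> (forall w, exists u, f u = w) -> lin_iso U W.
Proof.
by move=> fI fS; have [g fg gf] := linear_inverse fI fS; exists f, g.
Qed.

Lemma lin_iso_trans (U W X : lmodType K) : lin_iso U W -> lin_iso W X -> lin_iso U X.
Proof. by move=> [f fB] [g gB]; exists (g \o f); exact: bij_comp. Qed.

(** The given map goes from [D] to [C], because the shuffle map starts at the tensor product of
    complexes, which is the target in the theorem. *)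
Lemma chain_iso_bij (C D : chain K) (f : forall n, {linear D n -> C n}) :
  (forall n, injective (f n)) -> (forall n x, exists y, f n y = x) ->
  (forall n y, f n (bd D n y) = bd C n (f n.+1 y)) -> chain_iso C D.
Proof.
move=> fI fS fbd.
have ex n : exists g : {linear C n -> D n}, cancel (f n) g /\ cancel g (f n).
  by have [g fg gf] := linear_inverse (fI n) (fS n); exists g.
exists (fun n => projT1 (cid (ex n))) => [n|n x]; case: cid => g [fg gf] /=.
  by exists (f n).
by case: cid => h [fh hf] /=; apply: (fI n); rewrite gf fbd hf.
Qed.

Lemma quot_class0 (U : lmodType K) (S : submodClosed U) : quot_class S 0 = 0.
Proof. by apply: (addrI (quot_class S 0)); rewrite -quot_classD !addr0. Qed.

Lemma quot_classZ (U : lmodType K) (S : submodClosed U) a u :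
  quot_class S (a *: u) = a *: quot_class S u.
Proof. by rewrite -[LHS]quot_scale_class. Qed.

Lemma quot_lift (U W : lmodType K) (S : submodClosed U) (f : {linear U -> W}) :
  (forall u, u \in S -> f u = 0) ->
  exists g : {linear quotspace S -> W}, forall u, g (quot_class S u) = f u.
Proof.
move=> f0; pose g (q : quotspace S) := f (repr q).
have gE u : g (quot_class S u) = f u.
  apply/eqP; rewrite -subr_eq0 -raddfB; apply/eqP/f0/quot_classP.
  by rewrite /quot_class reprK.
have gL : linear g.
  move=> a p q; have [x ->] := quot_class_surj p.
  have [y ->] := quot_class_surj q.
  by rewrite -quot_classZ -quot_classD !gE linearP.
by exists (linmap gL).
Qed.

Lemma lin_iso_homology (C D : chain K) n :
  chain_iso C D -> lin_iso (homology C n) (homology D n).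
Proof.
move=> [f fB fbd].
have fcyc m x : x \in @cycles _ C m -> f m x \in @cycles _ D m.
  case: m x => [//|m] x; rewrite !unfold_in /= => /eqP h.
  by rewrite -fbd h raddf0.
have fcycV m x : f m x \in @cycles _ D m -> x \in @cycles _ C m.
  case: m x => [//|m] x; rewrite !unfold_in /= => /eqP h.
  have [g fg gf] := fB m.
  by rewrite -(fg (bd C m x)) fbd h -(raddf0 (f m)) fg.
pose F (z : subspace_of (@cycles _ C n)) : homology D n :=
  quot_class (@boundaries _ D n) (exist _ (f n (val z)) (fcyc n _ (valP z))).
have FL : linear F.
  move=> a x y; rewrite /F.
  rewrite -quot_classZ -quot_classD; congr quot_class; apply: val_inj.
  by rewrite /= linearP.
have F0 u : u \in @boundaries _ C n -> linmap FL u = 0.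
  move=> /asboolP[w wE]; rewrite /= /F.
  rewrite -[RHS](quot_class0 (@boundaries _ D n)).
  apply/quot_classP/asboolP; exists (f n.+1 w).
  by rewrite subr0 /= wE fbd.
have [g gE] := quot_lift F0.
apply: (@lin_iso_bij _ _ g).
  move=> p q; have [x ->] := quot_class_surj p.
  have [y ->] := quot_class_surj q.
  rewrite !gE /= => /quot_classP/asboolP[w /= wE].
  apply/quot_classP/asboolP.
  have [h fh hf] := fB n.+1; have [h0 fh0 hf0] := fB n.
  exists (h w); rewrite -(fh0 (bd C n _)) fbd hf -wE -raddfB fh0 raddfB.
  by [].
move=> p; have [[y ycyc] ->] := quot_class_surj p.
have [h fh hf] := fB n.
have hycyc : h y \in @cycles _ C n by apply: fcycV; rewrite hf.
exists (quot_class (@boundaries _ C n) (exist _ (h y) hycyc)); rewrite gE /= /F.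
by congr quot_class; apply: val_inj; rewrite /= hf.
Qed.

End Isomorphisms.

(** * Splitting a complex over a field *)

Section Contraction.
Variables (K : fieldType) (C : chain K).

(** A deformation of the complex onto its homology: [ctr_h] is a homotopy from the identity to the
    idempotent [ctr_e], whose image contains exactly one cycle of each homology class. Degree 0 is
    separate because no differential leaves it. *)
Record contraction := Contraction {
  ctr_e : forall n, {linear C n -> C n};
  ctr_h : forall n, {linear C n -> C n.+1};
  ctr_de : forall n x, bd C n (ctr_e n.+1 x) = 0;
  ctr_ed : forall n x, ctr_e n (bd C n x) = 0;
  ctr_ee : forall n x, ctr_e n (ctr_e n x) = ctr_e n x;
  ctr_dh0 : forall x, bd C 0 (ctr_h 0 x) = x - ctr_e 0 x;
  ctr_dh : forall n x, bd C n.+1 (ctr_h n.+1 x) + ctr_h n (bd C n x) =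
    x - ctr_e n.+1 x
}.

(* With d g d = d, take h = g (1 - g d), so that e = (1 - d g) (1 - g d). *)
Lemma contraction_exists : exists _ : contraction, True.
Proof.
have ex n := linear_ginv (bd C n).
pose g n := projT1 (cid (ex n)).
have dgd n x : bd C n (g n (bd C n x)) = bd C n x by rewrite /g; case: cid.
pose cl n x := x - bd C n (g n x).
have clL n : linear (cl n).
  by move=> a x y; rewrite /cl !linearP /= addrACA -scalerDr.
pose cr n x := x - g n (bd C n x).
have crL n : linear (cr n).
  by move=> a x y; rewrite /cr !linearP /= addrACA -scalerDr.
have dcr n x : bd C n (cr n x) = 0 by rewrite /cr raddfB /= dgd subrr.
have cld n x : cl n (bd C n x) = 0 by rewrite /cl dgd subrr.
have crd n x : cr n (bd C n.+1 x) = bd C n.+1 x.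
  by rewrite /cr bd_bd raddf0 subr0.
have dcl n x : bd C n (cl n.+1 x) = bd C n x.
  by rewrite /cl raddfB /= bd_bd subr0.
have clcl n x : cl n (cl n x) = cl n x.
  have h : bd C n (g n (cl n x)) = 0 by rewrite /cl !raddfB /= dgd subrr.
  by rewrite {1}/cl h subr0.
pose e n : {linear C n -> C n} :=
  match n with 0 => linmap (clL 0)
  | m.+1 => linmap (clL m.+1) \o linmap (crL m) end.
pose h n : {linear C n -> C n.+1} :=
  match n with 0 => g 0 | m.+1 => g m.+1 \o linmap (crL m) end.
have hd n x : h n (bd C n x) = g n (bd C n x) by case: n x => //= n x; rewrite crd.
unshelve eexists; last by [].
apply: (@Contraction e h).
- by move=> n x; rewrite /= dcl dcr.
- by case=> [|n] x /=; rewrite ?crd cld.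
- case=> [|n] x /=; first exact: clcl.
  have -> : cr n (cl n.+1 (cr n x)) = cl n.+1 (cr n x).
    by rewrite {1}/cr dcl dcr raddf0 subr0.
  exact: clcl.
- by move=> x; rewrite /= /cl opprB addrC subrK.
- move=> n x; rewrite hd /= /cl opprB [RHS]addrC -addrA; congr (_ + _).
  by rewrite /cr opprB subrK.
Qed.

Variable c : contraction.

Lemma ctr_cycle n x : ctr_e c n x \in @cycles _ C n.
Proof. by case: n x => [//|n] x; rewrite unfold_in /= ctr_de. Qed.

Definition to_cycle n (x : C n) : subspace_of (@cycles _ C n) :=
  exist _ (ctr_e c n x) (ctr_cycle x).

(** Defined on all chains through [ctr_e], not only on cycles, so that tensor products of such maps
    apply to any element of [graded_tensor C D]. *)
Definition to_homology_fun n (x : C n) : homology C n :=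
  quot_class (@boundaries _ C n) (to_cycle x).

Lemma to_homology_linear n : linear (@to_homology_fun n).
Proof.
move=> a x y; rewrite /to_homology_fun -quot_classZ -quot_classD.
by congr quot_class; apply: val_inj; rewrite /= linearP.
Qed.
Definition to_homology n := linmap (@to_homology_linear n).

Lemma to_homology_bd n x : to_homology n (bd C n x) = 0.
Proof.
rewrite /= /to_homology_fun -[RHS](quot_class0 (@boundaries _ C n)).
by congr quot_class; apply: val_inj; rewrite /= ctr_ed.
Qed.

(** The section [j] picks the representative [ctr_e c n z] of a cycle [z]. It is well defined since
    [ctr_e] kills boundaries, and it stays in the class since [z - ctr_e c n z] is the boundary of
    [ctr_h c n z]. *)
Lemma of_homology_exists n : exists j : {linear homology C n -> C n},
  (forall q, to_homology n (j q) = q) /\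
  (forall x, j (to_homology n x) = ctr_e c n x).
Proof.
have e0 u : u \in @boundaries _ C n -> (ctr_e c n \o val) u = 0.
  by move=> /asboolP[y /= ->]; exact: ctr_ed.
have [j jE] := quot_lift e0.
exists j; split=> [q|x]; last by rewrite /= /to_homology_fun jE /= ctr_ee.
have [z ->] := quot_class_surj q; rewrite jE /= /to_homology_fun.
apply/quot_classP/asboolP; exists (- ctr_h c n (val z)).
rewrite raddfN /= ctr_ee; case: n z {q j jE e0} => [|n] z.
  by rewrite ctr_dh0 opprB.
have := ctr_dh c (val z); have := valP z; rewrite unfold_in /= => /eqP->.
by rewrite raddf0 addr0 => ->; rewrite opprB.
Qed.

End Contraction.

Lemma bidegree_eq n (i j : bidegree n) : bdl i = bdl j -> bdr i = bdr j -> i = j.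
Proof.
case: i j => [p q P] [p' q' P'] /= pp qq; subst p' q'.
by rewrite (eq_irrelevance P P').
Qed.

Section Kunneth.
Variables (K : fieldType) (C D : chain K).
Variables (c : contraction C) (d : contraction D).

Local Notation "f \ox g" := (tmap f g) (at level 40).

Section Homotopy.
Variable n : nat.

Lemma pred_l p q : (p.+1 + q)%N = n.+1 -> (p + q)%N = n.
Proof. lia. Qed.
Lemma pred_r p q : (p + q.+1)%N = n.+1 -> (p + q)%N = n.
Proof. lia. Qed.

(** With [homotopy_r], the standard homotopy h (x) 1 + (-1)^p e (x) h from the identity to e (x) e.
    The component of bidegree (p, q) comes from that of (p - 1, q), hence 0 when p = 0. *)
Definition homotopy_l (z : graded_tensor C D n) : graded_tensor C D n.+1 :=
  fun i => match i with Bidegree p q P =>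
    match p return (p + q)%N = n.+1 -> tensor (C p) (D q) with
    | 0 => fun=> 0
    | p'.+1 => fun P => (ctr_h c p' \ox idfun) (z (Bidegree (pred_l P)))
    end P end.

Definition homotopy_r (z : graded_tensor C D n) : graded_tensor C D n.+1 :=
  fun i => match i with Bidegree p q P =>
    match q return (p + q)%N = n.+1 -> tensor (C p) (D q) with
    | 0 => fun=> 0
    | q'.+1 => fun P =>
        (-1) ^+ p *: (ctr_e c p \ox ctr_h d q') (z (Bidegree (pred_r P)))
    end P end.

Lemma homotopy_l_incl z (i : bidegree n) :
  homotopy_l z (incl i) = (ctr_h c (bdl i) \ox idfun) (z i).
Proof.
rewrite /=; congr (tmap _ _ _).
by case: i => p q P /=; rewrite (eq_irrelevance (pred_l _) P).
Qed.

Lemma homotopy_r_incr z (i : bidegree n) :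
  homotopy_r z (incr i) = (-1) ^+ bdl i *: (ctr_e c (bdl i) \ox ctr_h d (bdr i))
    (z i).
Proof.
rewrite /=; congr (_ *: tmap _ _ _).
by case: i => p q P /=; rewrite (eq_irrelevance (pred_r _) P).
Qed.

End Homotopy.

Lemma tensor_bdE n (x : graded_tensor C D n.+1) (i : bidegree n) :
  tensor_bd x i = (bd C (bdl i) \ox idfun) (x (incl i)) +
    (-1) ^+ bdl i *: (idfun \ox bd D (bdr i)) (x (incr i)).
Proof. by rewrite !tmapE. Qed.

Lemma tensor_cycle n (z : graded_tensor C D n.+1) p q
    (Pl : (p.+1 + q)%N = n.+1) (Pr : (p + q.+1)%N = n.+1) :
  z \in @cycles _ (chain_tensor C D) n.+1 ->
  (bd C p \ox idfun) (z (Bidegree Pl)) =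
  - ((-1) ^+ p *: (idfun \ox bd D q) (z (Bidegree Pr))).
Proof.
pose i := Bidegree (pred_l Pl).
rewrite (eq_irrelevance Pl (bidegree_Sl i)) (eq_irrelevance Pr (bidegree_Sr i)).
rewrite unfold_in /= => /eqP/(congr1 (fun f : graded_tensor C D n => f i)).
by rewrite /= tensor_bdE => h; apply/eqP; rewrite -addr_eq0; apply/eqP; exact: h.
Qed.

(** The usual computation of d H + H d = 1 - e (x) e, done on a cycle [z] only: [tensor_cycle] moves
    a differential applied to [z] from one factor to the other. The result telescopes through e (x)
    1. *)
Lemma homotopyP n (z : graded_tensor C D n) :
  z \in @cycles _ (chain_tensor C D) n ->
  (forall i, (ctr_e c (bdl i) \ox ctr_e d (bdr i)) (z i) = 0) ->
  z = tensor_bd (homotopy_l z + homotopy_r z).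
Proof.
move=> zcyc ze; apply: functional_extensionality_dep => i.
rewrite tensor_bdE.
have wE j : (homotopy_l z + homotopy_r z) j = homotopy_l z j + homotopy_r z j by [].
rewrite !wE !linearD homotopy_l_incl homotopy_r_incr /= linearZ /= !scalerA.
rewrite -expr2 sqrr_sign scale1r !tmap_comp.
have -> : (bd C (bdl i) \ox idfun) (homotopy_r z (incl i)) = 0.
  case: i => p [|q] P; first by rewrite raddf0.
  rewrite /= linearZ /= tmap_comp tmap0l ?scaler0 // => x /=.
  exact: ctr_de.
rewrite addr0 addrA.
(* In the right factor d h = 1 - e - h d, without h d in degree 0. The e part vanishes by [ze]; on a
   cycle the h d part becomes, up to sign, e d (x) h, which is 0. *)
have -> : ((idfun \o ctr_e c (bdl i)) \ox (bd D (bdr i) \o ctr_h d (bdr i))) (z i) =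
    (ctr_e c (bdl i) \ox idfun) (z i).
  transitivity ((ctr_e c (bdl i) \ox (bd D (bdr i) \o ctr_h d (bdr i))) (z i)).
    exact: eq_tmap.
  rewrite -[LHS]addr0 -(ze i); case: i => p [|q] P /=.
    rewrite -tmapDr; apply: eq_tmap => // x /=.
    by rewrite ctr_dh0 subrK.
  have hd0 : (ctr_e c p \ox (ctr_h d q \o bd D q)) (z (Bidegree P)) = 0.
    case: n z zcyc P {ze wE} => [|m] z zcyc P; first by lia.
    have Pl : (p.+1 + q)%N = m.+1 by rewrite addSnnS.
    have := tensor_cycle Pl P zcyc => /(congr1 (ctr_e c p \ox ctr_h d q));
      rewrite tmap_comp.
    rewrite tmap0l => [/esym/eqP|x]; last exact: ctr_ed.
    rewrite raddfN /= linearZ /= tmap_comp oppr_eq0.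
    by rewrite scaler_eq0 signr_eq0 => /eqP h0; rewrite -[RHS]h0; exact: eq_tmap.
  rewrite -{1}(addr0 ((_ \ox _) _)) -hd0 -!tmapDr; apply: eq_tmap => // x /=.
  by rewrite ctr_dh subrK.
(* The term h d that must join d h in the left factor comes from the right differential of h (x) 1,
   again by the cycle condition. *)
have -> : ((bd C (bdl i) \o ctr_h c (bdl i)) \ox (idfun \o idfun)) (z i) +
    (-1) ^+ bdl i *: (idfun \ox bd D (bdr i)) (homotopy_l z (incr i)) =
    z i - (ctr_e c (bdl i) \ox idfun) (z i).
  apply/eqP; rewrite eq_sym subr_eq eq_sym; apply/eqP.
  case: i => -[|p] q P /=.
    rewrite raddf0 scaler0 addr0 -[RHS]tmap_id.
    transitivity (((bd C 0 \o ctr_h c 0) \ox idfun) (z (Bidegree P)) +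
      (ctr_e c 0 \ox idfun) (z (Bidegree P))).
      by congr (_ + _); exact: eq_tmap.
    rewrite -tmapDl; apply: eq_tmap => // x /=.
    by rewrite ctr_dh0 subrK.
  have -> : (-1) ^+ p.+1 *: (idfun \ox bd D q) ((ctr_h c p \ox idfun)
      (z (Bidegree (pred_l (bidegree_Sr (Bidegree P)))))) =
      ((ctr_h c p \o bd C p) \ox idfun) (z (Bidegree P)).
    case: n z zcyc P {ze wE} => [|m] z zcyc P; first by lia.
    transitivity ((ctr_h c p \ox idfun) ((bd C p \ox idfun) (z (Bidegree P)))).
      rewrite (tensor_cycle P (pred_l (bidegree_Sr (Bidegree P))) zcyc).
      rewrite raddfN /= linearZ /= !tmap_comp exprS mulN1r scaleNr.
      by congr (- (_ *: _)); exact: eq_tmap.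
    by rewrite tmap_comp; exact: eq_tmap.
  transitivity (((bd C p.+1 \o ctr_h c p.+1) \ox idfun) (z (Bidegree P)) +
    ((ctr_h c p \o bd C p) \ox idfun) (z (Bidegree P)) +
    (ctr_e c p.+1 \ox idfun) (z (Bidegree P))).
    by congr (_ + _ + _); exact: eq_tmap.
  rewrite -!tmapDl -[RHS]tmap_id; apply: eq_tmap => // x /=.
  by rewrite ctr_dh subrK.
by rewrite subrK.
Qed.

End Kunneth.

(** The map is induced by the tensor product of the projections to homology, with j (x) j' as
    section. Its kernel on cycles consists of boundaries: f z = 0 gives (e (x) e) z = (j (x) j') (f
    z) = 0, and [homotopyP] applies. *)
Lemma kunneth (K : fieldType) (C D : chain K) n :
  lin_iso (homology (chain_tensor C D) n) (graded_tensor (homology C) (homology D) n).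
Proof.
have [c _] := contraction_exists C; have [d _] := contraction_exists D.
pose f (z : graded_tensor C D n) : graded_tensor (homology C) (homology D) n :=
  fun i => tmap (to_homology c (bdl i)) (to_homology d (bdr i)) (z i).
have fL : linear f.
  move=> a x y; apply: functional_extensionality_dep => i.
  have -> : f (a *: x + y) i = tmap (to_homology c (bdl i))
    (to_homology d (bdr i)) (a *: x i + y i) by [].
  by rewrite linearP.
pose j m := projT1 (cid (of_homology_exists c m)).
have pj m q : to_homology c m (j m q) = q by rewrite /j; case: cid => ? [].
have jp m x : j m (to_homology c m x) = ctr_e c m x by rewrite /j; case: cid => ? [].
pose j' m := projT1 (cid (of_homology_exists d m)).
have pj' m q : to_homology d m (j' m q) = q by rewrite /j'; case: cid => ? [].
have jp' m x : j' m (to_homology d m x) = ctr_e d m x.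
  by rewrite /j'; case: cid => ? [].
have dj m q : bd C m (j m.+1 q) = 0.
  by rewrite -[q]pj jp ctr_de.
have dj' m q : bd D m (j' m.+1 q) = 0.
  by rewrite -[q]pj' jp' ctr_de.
have f0 (z : subspace_of (@cycles _ (chain_tensor C D) n)) :
    z \in @boundaries _ (chain_tensor C D) n -> (linmap fL \o val) z = 0.
  move=> /asboolP[w wE]; apply: functional_extensionality_dep => i.
  rewrite /= wE /= /f tensor_bdE linearD linearZ /= !tmap_comp.
  rewrite tmap0l => [|x]; last exact: to_homology_bd.
  by rewrite tmap0r => [|x]; [rewrite scaler0 addr0|exact: to_homology_bd].
have [g gE] := quot_lift f0.
apply: (@lin_iso_bij _ _ _ g).
  move=> p q; have [x ->] := quot_class_surj p; have [y ->] := quot_class_surj q.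
  rewrite !gE => /eqP; rewrite -subr_eq0 -raddfB /= => /eqP fz.
  apply/quot_classP/asboolP.
  exists (homotopy_l c (val (x - y)) + homotopy_r c d (val (x - y))).
  apply: homotopyP => [|i]; first exact: valP.
  have := congr1 (fun h : graded_tensor _ _ n => tmap (j _) (j' _) (h i)) fz.
  rewrite /= /f tmap_comp -[X in _ = X -> _]/(tmap _ _ 0) raddf0 => <-.
  by apply: eq_tmap => u /=; rewrite ?jp ?jp'.
move=> y; pose z : graded_tensor C D n :=
  fun i => tmap (j (bdl i)) (j' (bdr i)) (y i).
have zcyc : z \in @cycles _ (chain_tensor C D) n.
  rewrite /z; case: n y {f fL f0 g gE z} => [//|n] y.
  rewrite unfold_in; apply/eqP.
  apply: functional_extensionality_dep => i.
  rewrite /= tensor_bdE /= !tmap_comp tmap0l => [|x]; last exact: dj.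
  by rewrite tmap0r => [|x]; [rewrite scaler0 addr0|exact: dj'].
exists (quot_class (@boundaries _ (chain_tensor C D) n) (exist _ z zcyc)).
rewrite gE /=; apply: functional_extensionality_dep => i.
rewrite /f /z tmap_comp -[RHS]tmap_id.
by apply: eq_tmap => x; [exact: pj|exact: pj'].
Qed.

(** * Bar objects and words *)

Lemma tuple_sum0 (W : nmodType) (F : 0.-tuple bool -> W) : \sum_s F s = F [tuple].
Proof.
rewrite (bigD1 [tuple]) //= big1 ?addr0 // => s /negP[].
by apply/eqP; exact: tuple0.
Qed.

Lemma tuple_sum_cons (W : nmodType) n (F : n.+1.-tuple bool -> W) :
  \sum_s F s = \sum_(s : n.-tuple bool) (F [tuple of true :: s] +
    F [tuple of false :: s]).
Proof.
pose c (p : bool * n.-tuple bool) := [tuple of p.1 :: p.2].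
pose c' (s : n.+1.-tuple bool) := (thead s, [tuple of behead s]).
have cK : cancel c c'.
  by move=> [b s]; rewrite /c' theadE; congr pair; apply: val_inj.
have c'K : cancel c' c by move=> s; rewrite /c /= [RHS]tuple_eta.
rewrite (reindex c) /=; last by exists c' => x _; [exact: cK|exact: c'K].
rewrite -(pair_bigA _ (fun b s => F (c (b, s)))) /=.
by rewrite big_bool -big_split.
Qed.

Section SimplicialFacts.
Variables (K : fieldType) (X : simplicial K).

(** On s_i a the faces d_i and d_(i+1) both give a and cancel; every other face of s_i a is again
    degenerate. *)
Lemma altface_degenerate n (x : X n.+1) :
  x \in @degenerate _ X n.+1 -> altface x \in @degenerate _ X n.
Proof.
move=> /asboolP[a ->]; rewrite -[altface _]/((bd (unnormalized X) n) _) raddf_sum.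
apply: rpred_sum => -[i /= hi] _; rewrite /altface; move: (a i) => {}a.
have dd j : (j < i)%N || (i.+1 < j <= n.+1)%N ->
    face X n j (degen X n i a) \in @degenerate _ X n.
  case: n {x} a hi => [|n] a hi; first by lia.
  case/orP=> hj.
    by rewrite face_degen_lt ?mem_degen; lia.
  by rewrite face_degen_gt ?mem_degen; lia.
have i0 : (i < n.+2)%N by lia.
have i1 : (i.+1 < n.+2)%N by lia.
rewrite (bigD1 (Ordinal i0)) //= (bigD1 (Ordinal i1)) /=; last first.
  by rewrite -val_eqE /= neq_ltn ltnSn orbT.
rewrite face_degen_eq // face_degen_succ // exprS mulN1r scaleNr addrA subrr add0r.
apply: rpred_sum => -[j /= jn] /andP[]; rewrite -!val_eqE /= => ji ji1.
by apply: rpredZ; apply: dd; lia.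
Qed.

End SimplicialFacts.

Section BarFacts.
Variables (K : fieldType) (A : kalgebra K) (V : bimodule A).

(** Words as functions on all of [nat], of which only the first n letters count ([eq_pure_word]):
    faces, degeneracies and shuffles become index arithmetic. *)
Definition pure_word n (v : V) (f : nat -> A) : bar_ob V n := pure v (of_word n f).

Lemma pureE n v (l : n.-tuple A) : pure v l = pure_word n v (word l).
Proof. by congr pure; apply: word_ext => k kn; rewrite word_of kn. Qed.

Lemma eq_pure_word n v f g : (forall k, (k < n)%N -> f k = g k) ->
  pure_word n v f = pure_word n v g.
Proof. by move=> fg; congr pure; apply: word_ext => k kn; rewrite !word_of kn fg. Qed.

Definition update (f : nat -> A) k x : nat -> A := fun j => if j == k then x else f j.

Lemma word_update n (l : n.-tuple A) k x j :
  (j < n)%N -> word (set_word l k x) j = update (word l) k x j.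
Proof. by move=> jn; rewrite word_of jn. Qed.

Lemma pure_word_linearr n v f k : (k < n)%N -> linear (fun x =>
  pure_word n v (update f k x)).
Proof.
move=> kn; apply: (pure_linearr_comp (v := v) (l := of_word n f) kn (@linear_id _ _)).
move=> x; congr pure; apply: word_ext => j jn.
by rewrite word_update // /update !word_of jn.
Qed.

Lemma pure_word_linearl n f : linear (fun v => pure_word n v f).
Proof. exact: pure_linearl. Qed.

Lemma pure_word0l n f : pure_word n 0 f = 0.
Proof. exact: (linear0f (@pure_word_linearl n f)). Qed.

Lemma pure_word0r n v f k : (k < n)%N -> f k = 0 -> pure_word n v f = 0.
Proof.
move=> kn fk; rewrite -(linear0f (pure_word_linearr v f kn));
  apply: eq_pure_word => j jn.
by rewrite /update; case: eqP => // ->.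
Qed.

Definition multilinear_fun n (W : lmodType K) (F : V -> (nat -> A) -> W) : Prop :=
  [/\ forall f, linear (F^~ f),
      forall v f k, (k < n)%N -> linear (fun x => F v (update f k x))
    & forall v f g, (forall k, (k < n)%N -> f k = g k) -> F v f = F v g].

Definition bar_lift n (W : lmodType K) (F : V -> (nat -> A) -> W) :
    {linear bar_ob V n -> W} :=
  universal_lift (@multilinear_on K A V n) (fun p => F p.1 (word p.2)).

Lemma bar_lift_word n (W : lmodType K) (F : V -> (nat -> A) -> W) v f :
  multilinear_fun n F -> bar_lift n F (pure_word n v f) = F v f.
Proof.
move=> [F1 F2 F3]; rewrite /bar_lift universal_lift_gen; first last.
  split=> [l|v0 l k] /=; first exact: F1.
  move=> a x y; have h z : F v0 (word (set_word l k z)) = F v0 (update (word l) k z).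
    by apply: F3 => j; exact: word_update.
  by rewrite !h; exact: F2.
by apply: F3 => k kn; rewrite word_of kn.
Qed.

Lemma bar_word_ext n (W : lmodType K) (F G : {linear bar_ob V n -> W}) :
  (forall v f, F (pure_word n v f) = G (pure_word n v f)) -> F =1 G.
Proof.
move=> FG; apply: bar_ext => [||v l]; try exact: linearP.
by rewrite pureE.
Qed.

Lemma bar_mem n (W : lmodType K) (S : submodClosed W) (F : {linear bar_ob V n -> W}) :
  (forall v f, F (pure_word n v f) \in S) -> forall x, F x \in S.
Proof.
move=> h; apply: universal_ind => [a p q hp hq||[v l]].
- by rewrite linearP rpredD ?rpredZ.
- by rewrite raddf0 rpred0.
- by have := h v (word l); rewrite -pureE.
Qed.

(* As in face_coef, n < i stands for the last face i = n + 1. *)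
Definition fcoef n (i : nat) (v : V) (f : nat -> A) : V :=
  if i == 0%N then ract v (f 0%N) else if (n < i)%N then lact (f n) v else v.

Lemma face_word_fun n i v f :
  face (bar V) n i (pure_word n.+1 v f) = pure_word n (fcoef n i v f) (face_fun i f).
Proof.
rewrite /= bar_face_pure /face_coef /fcoef !word_of ltnSn ltn0Sn.
congr pure; apply: word_ext => k kn; rewrite !word_of kn /face_fun !word_of.
by rewrite !ltnS kn (ltnW kn).
Qed.

Lemma degen_word_fun n i v f : (i <= n)%N ->
  degen (bar V) n i (pure_word n v f) = pure_word n.+1 v (degen_fun i f).
Proof.
move=> hi; rewrite /= bar_degen_pure; congr pure; apply: word_ext => k kn.
rewrite !word_of kn /degen_fun !word_of.
case: ifP => ki; first by rewrite (leq_trans ki).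
case: eqP => // /eqP kni; rewrite (_ : (k.-1 < n)%N = true) //; lia.
Qed.

Lemma pure_word_degenerate n v f k :
  (k < n)%N -> f k = aone -> pure_word n v f \in @degenerate _ (bar V) n.
Proof.
case: n => // n kn fk.
rewrite (_ : pure_word n.+1 v f = degen (bar V) n k (pure_word n v (fun j =>
  if (j < k)%N then f j else f j.+1))).
  exact: mem_degen.
rewrite degen_word_fun //; apply: eq_pure_word => j jn; rewrite /degen_fun.
case: ifP => jk; first by rewrite jk.
case: eqP => [->//|/eqP jnk].
by rewrite (_ : (j.-1 < k)%N = false) ?prednK //; lia.
Qed.

Lemma degenerate_mem n (W : lmodType K) (S : submodClosed W)
    (F : {linear bar_ob V n -> W}) :
  (forall v f k, (k < n)%N -> f k = aone -> F (pure_word n v f) \in S) ->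
  forall x, x \in @degenerate _ (bar V) n -> F x \in S.
Proof.
case: n F => [|n] F h x.
  by rewrite unfold_in => /eqP->; rewrite raddf0 rpred0.
move=> /asboolP[a ->]; rewrite raddf_sum; apply: rpred_sum => i _.
apply: (@bar_mem n _ S (F \o degen (bar V) n i)) => v f.
have hi : (i <= n)%N by rewrite -ltnS.
change (F (degen (bar V) n i (pure_word n v f)) \in S); rewrite degen_word_fun //.
by apply: (h _ _ i) => //; rewrite /degen_fun ltnn eqxx.
Qed.

Lemma degenerate_zero n (W : lmodType K) (F : {linear bar_ob V n -> W}) :
  (forall v f k, (k < n)%N -> f k = aone -> F (pure_word n v f) = 0) ->
  forall x, x \in @degenerate _ (bar V) n -> F x = 0.
Proof.
case: n F => [|n] F h x.
  by rewrite unfold_in => /eqP->; rewrite raddf0.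
move=> /asboolP[a ->]; rewrite raddf_sum big1 // => i _.
apply: (@bar_word_ext n _ (F \o degen (bar V) n i) \0) => v f.
have hi : (i <= n)%N by rewrite -ltnS.
change (F (degen (bar V) n i (pure_word n v f)) = 0); rewrite degen_word_fun //.
by apply: (h _ _ i) => //; rewrite /degen_fun ltnn eqxx.
Qed.

(** Multilinear expansion, where every term that takes the unit summand at some place is
    degenerate. *)
Lemma pure_word_expand n v (f u u' : nat -> A) (c : nat -> K) :
  (forall k, (k < n)%N -> f k = u k + u' k + c k *: aone) ->
  pure_word n v f - \sum_(s : n.-tuple bool)
      pure_word n v (fun k => if nth false s k then u k else u' k)
    \in @degenerate _ (bar V) n.
Proof.
move=> fE.
pose g m (s : seq bool) k := if (k < n - m)%N then f k
  else if nth false s (k - (n - m)) then u k else u' k.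
(* Letters are expanded from the last one backwards: in [g m s] the last m letters are already
   chosen, and the next choice becomes the head of the pattern. *)
suff h m : (m <= n)%N -> pure_word n v f - \sum_(s : m.-tuple bool) pure_word n v
  (g m s)
    \in @degenerate _ (bar V) n.
  rewrite (eq_bigr (fun s : n.-tuple bool => pure_word n v (g n s))); first exact: h.
  by move=> s _; apply: eq_pure_word => k kn; rewrite /g subnn ltn0 subn0.
elim: m => [_|m IH mn].
  rewrite tuple_sum0.
  rewrite (@eq_pure_word n v _ f) => [|k kn]; first by rewrite subrr; exact: rpred0.
  by rewrite /g subn0 kn.
rewrite tuple_sum_cons (_ : _ - _ = pure_word n v f -
  \sum_(s : m.-tuple bool) pure_word n v (g m s)
  + \sum_(s : m.-tuple bool) (pure_word n v (g m s) - 
   (pure_word n v (g m.+1 [tuple of true :: s]) + pure_word n v (g m.+1 [tuple of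
     false :: s])))).
  apply: rpredD; first by apply: IH; exact: ltnW.
  apply: rpred_sum => s _.
  set p := (n - m.+1)%N; have pn : (p < n)%N by rewrite /p; lia.
  have gE b : pure_word n v (g m.+1 [tuple of b :: s]) =
      pure_word n v (update (g m s) p (if b then u p else u' p)).
    apply: eq_pure_word => k kn; rewrite /g /update -/p; have [->|kp] := eqVneq k p.
      by rewrite ltnn subnn /=; case: b.
    have -> : (k < n - m)%N = (k < p)%N by rewrite /p; lia.
    case: ifP => // kp'; have -> : (k - p = (k - (n - m)).+1)%N by rewrite /p; lia.
    by [].
  rewrite !gE.
  have -> : pure_word n v (g m s) = pure_word n v (update (g m s) p (f p)).
    apply: eq_pure_word => k kn; rewrite /update; case: eqP => // ->.
    by rewrite /g ifT //; rewrite /p; lia.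
  have L := pure_word_linearr v (g m s) pn.
  have LD x y : pure_word n v (update (g m s) p (x + y)) =
      pure_word n v (update (g m s) p x) + pure_word n v (update (g m s) p y).
    by have := L 1 x y; rewrite !scale1r.
  rewrite fE // (addrC (_ + _)) L LD addrK.
  by apply/rpredZ/(pure_word_degenerate v pn); rewrite /update eqxx.
by rewrite sumrB addrA subrK.
Qed.

End BarFacts.

(** * Shuffle patterns *)

Section Patterns.
Local Open Scope nat_scope.
Implicit Types s : seq bool.

(** A pattern has true at the places of left letters and false at those of right letters. When place
    j holds a left letter, [rank s j] is its index in the left word. *)
Definition rank s j := count id (take j s).

(* select s k is the position of the k-th true of s, and rank s is its inverse. *)
Fixpoint select s k := match s with
  | [::] => 0
  | b :: s' => match b, k with
    | true, 0 => 0
    | true, k'.+1 => (select s' k').+1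
    | false, _ => (select s' k).+1
    end
  end.

Fixpoint swap i s := match i, s with
  | 0, a :: b :: t => b :: a :: t
  | i'.+1, a :: t => a :: swap i' t
  | _, _ => s
  end.

(** Pairs with a false before a true: the crossings of the shuffle, whose parity is its sign. *)
Fixpoint inversions s := match s with
  | [::] => 0
  | b :: s' => (if b then 0 else count id s') + inversions s'
  end.

Definition remove i s := take i s ++ drop i.+1 s.

Lemma rank0 s : rank s 0 = 0. Proof. by rewrite /rank take0. Qed.

Lemma rankS s j : rank s j.+1 = rank s j + nth false s j.
Proof.
rewrite /rank; elim: s j => [|b s IH] j; first by case: j.
by case: j => [|j] /=; rewrite ?take0 ?addn0 // IH addnA.
Qed.

Lemma rank_size s : rank s (size s) = count id s.
Proof. by rewrite /rank take_size. Qed.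

Lemma rank_mono s j k : j <= k -> rank s j <= rank s k.
Proof.
move=> /subnK <-; elim: (k - j) => [|d IH]; first by rewrite add0n.
by rewrite addSn rankS (leq_trans IH) // leq_addr.
Qed.

Lemma rank_lt s j : nth false s j -> rank s j < count id s.
Proof.
move=> sj; have js : j < size s by case: ltnP => // h; rewrite nth_default in sj.
by rewrite -rank_size; apply: (leq_trans _ (rank_mono s js)); rewrite rankS sj addn1.
Qed.

Lemma selectP s k : k < count id s ->
  [/\ select s k < size s, nth false s (select s k) & rank s (select s k) = k].
Proof.
elim: s k => [|[] s IH] //= k kc.
  case: k kc => [|k] //= kc; have [h1 h2 h3] := IH k kc.
  by split=> //; rewrite /rank /= -[in RHS]h3.
Qed.

Lemma select_rank s j : nth false s j -> select s (rank s j) = j.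
Proof.
elim: s j => [|b s IH] [|j] //=.
  by case: b => // _; rewrite rank0.
by move=> /IH; case: b; rewrite /rank /= => h; rewrite h.
Qed.

Lemma nth_negs s j : nth false (map negb s) j = (j < size s) && ~~ nth false s j.
Proof.
case: ltnP => js; first by rewrite (nth_map false).
by rewrite nth_default // size_map.
Qed.

Lemma count_negs s : count id (map negb s) = count negb s.
Proof. by rewrite count_map; apply: eq_count. Qed.

Lemma count_bool s : count id s + count negb s = size s.
Proof. by rewrite -(count_predC id s). Qed.

Lemma nth_remove i s t : i < size s ->
  nth false (remove i s) t = nth false s (if t < i then t else t.+1).
Proof.
move=> si; rewrite nth_cat size_take si; case: ltnP => ti; first by rewrite nth_take.
by rewrite nth_drop; congr nth; lia.
Qed.

Lemma size_remove i s : i < size s -> (size (remove i s)).+1 = size s.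
Proof. by move=> si; rewrite size_cat size_take si size_drop; lia. Qed.

Lemma rank_remove_le i s t : i < size s -> t <= i -> rank (remove i s) t = rank s t.
Proof.
move=> si; elim: t => [|t IH] ti; first by rewrite !rank0.
by rewrite !rankS nth_remove // ti IH // ltnW.
Qed.

Lemma rank_remove_ge i s t : i < size s -> nth false s i -> i <= t ->
  (rank (remove i s) t).+1 = rank s t.+1.
Proof.
move=> si sit /subnK <-; elim: (t - i) => [|d IH].
  by rewrite add0n rank_remove_le // rankS sit addn1.
rewrite addSn rankS nth_remove // ifF; last by lia.
by rewrite [RHS]rankS -IH.
Qed.

Lemma count_remove i s : nth false s i -> (count id (remove i s)).+1 = count id s.
Proof.
move=> sit; have si : i < size s by case: ltnP => // h; rewrite nth_default in sit.
have h := size_remove si.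
by rewrite -!rank_size -h; apply: rank_remove_ge => //; lia.
Qed.

Lemma size_swap i s : size (swap i s) = size s.
Proof. by elim: i s => [|i IH] [|a s] //=; [case: s|rewrite IH]. Qed.

Lemma swapK i : involutive (swap i).
Proof. by elim: i => [|i IH] [|a s] //=; [case: s|rewrite IH]. Qed.

Lemma map_swap i s : map negb (swap i s) = swap i (map negb s).
Proof. by elim: i s => [|i IH] [|a s] //=; [case: s|rewrite IH]. Qed.

Lemma count_swap a i s : count a (swap i s) = count a s.
Proof.
elim: i s => [|i IH] [|b s] //=; last by rewrite IH.
by case: s => //= c s; rewrite addnCA.
Qed.

Lemma nth_swap i s j : i.+1 < size s -> nth false (swap i s) j =
  nth false s (if j == i then i.+1 else if j == i.+1 then i else j).
Proof.
elim: i s j => [|i IH] [|a s] j //=.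
  by case: s => [|b s] //= _; case: j => [|[|j]].
by case: j => [|j] //= h; rewrite IH // !eqSS; case: eqP => //; case: eqP.
Qed.

Lemma rank_swap i s j : i.+1 < size s -> j != i.+1 -> rank (swap i s) j = rank s j.
Proof.
elim: i s j => [|i IH] [|a s] j //=.
  by case: s => [|b s] //= _; case: j => [|[|j]] //= _; rewrite /rank /= addnCA.
by case: j => [|j] //= h ji; have := IH s j h ji; rewrite /rank /= => ->.
Qed.

Lemma inversions_swap i s : i.+1 < size s -> nth false s i -> ~~ nth false s i.+1 ->
  inversions (swap i s) = (inversions s).+1.
Proof.
elim: i s => [|i IH] [|a s] //=.
  by case: s => [|b s] //=; case: a => //; case: b => //= _ _ _; rewrite add1n.
by move=> h1 h2 h3; rewrite IH // count_swap addnS.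
Qed.

Lemma select_swap i s k : i.+1 < size s -> nth false s i != nth false s i.+1 ->
  k < count id s -> select (swap i s) k =
  (if select s k == i then i.+1 else if select s k == i.+1 then i else select s k).
Proof.
move=> si ne kc; have [h1 h2 h3] := selectP kc; set j := select s k in h1 h2 h3 *.
set j' := (X in _ = X).
have sj' : nth false (swap i s) j'.
  rewrite nth_swap // /j'; case: (eqVneq j i) h2 => [->|ji] h2.
    by rewrite ifF ?eqxx ?h2 //; apply/eqP; lia.
  case: (eqVneq j i.+1) h2 => [->|ji1] h2; first by rewrite eqxx h2.
  by rewrite (negPf ji) (negPf ji1).
rewrite -(select_rank sj'); congr select; rewrite -h3.
rewrite /j'; case: (eqVneq j i) => [ji|ji].
  rewrite rankS rank_swap ?ji //; last by apply/eqP; lia.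
  rewrite nth_swap // eqxx; move: ne; rewrite -ji h2.
  by case: nth => // _; rewrite addn0.
case: (eqVneq j i.+1) => [ji1|ji1]; last by rewrite rank_swap.
rewrite rank_swap //; last by apply/eqP; lia.
rewrite ji1 rankS; move: ne; rewrite -ji1 h2.
by case: nth => // _; rewrite addn0.
Qed.

Definition sorted_pattern p q := nseq p true ++ nseq q false.

Lemma inversions0_sorted s : inversions s = 0 -> s =
  sorted_pattern (count id s) (count negb s).
Proof.
elim: s => [|[] s IH] //=; first by rewrite !add0n => /IH {1}->.
move=> /eqP; rewrite addn_eq0 => /andP[/eqP c0 /eqP i0].
by rewrite c0 {1}(IH i0) c0.
Qed.

Lemma inversions_descent s : 0 < inversions s ->
  exists i, [/\ i.+1 < size s, nth false s i = false & nth false s i.+1].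
Proof.
have shift b (t : seq bool) : (exists i, [/\ i.+1 < size t, nth false t i =
  false & nth false t i.+1]) ->
    exists i, [/\ i.+1 < size (b :: t), nth false (b :: t) i = false &
      nth false (b :: t) i.+1].
  by case=> i [h1 h2 h3]; exists i.+1.
elim: s => [|[] s IH] //=; first by move=> /IH; exact: shift.
have [s0 sc|/IH h _] := posnP (inversions s); last exact: shift.
exists 0; have := inversions0_sorted s0; case: (count id s) sc => [|c _ ->//].
by rewrite s0.
Qed.

End Patterns.

Lemma bar_ext_word (K : fieldType) (A : kalgebra K) (V : bimodule A) n
    (W : lmodType K) (f g : bar_ob V n -> W) :
  linear f -> linear g -> (forall v l, f (pure_word n v l) =
    g (pure_word n v l)) -> f =1 g.
Proof. by move=> fL gL fg; apply: bar_ext => // v l; rewrite pureE. Qed.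

(** * The shuffle map *)

Section BarBilinear.
Variables (K : fieldType) (A A' : kalgebra K) (V : bimodule A) (V' : bimodule A').

Definition bar_lift2 m n (W : lmodType K) (F : V -> (nat -> A) -> V' -> (nat ->
  A') -> W) :
    bar_ob V m -> bar_ob V' n -> W :=
  fun x x' => bar_lift m (fun v f => bar_lift n (F v f) x') x.

Variables (m n : nat) (W : lmodType K) (F : V -> (nat -> A) -> V' -> (nat ->
  A') -> W).
Hypotheses (F1 : forall v f, multilinear_fun n (F v f))
  (F2 : forall v' f', multilinear_fun m (fun v f => F v f v' f')).

Let blinE v f v' f' : bar_lift n (F v f) (pure_word n v' f') = F v f v' f'.
Proof. by rewrite bar_lift_word. Qed.

Lemma bar_lift2_multilinear x' : multilinear_fun m (fun v f => bar_lift n (F v f) x').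
Proof.
split=> [f a u w|v f k km a u w|v f g fg]; move: x'; apply: bar_ext_word.
- exact: linearP.
- exact: linear_add (linear_scale a (linearP _)) (linearP _).
- by move=> v' f'; rewrite !blinE; have [h _ _] := F2 v' f'; exact: h.
- exact: linearP.
- exact: linear_add (linear_scale a (linearP _)) (linearP _).
- by move=> v' f'; rewrite !blinE; have [_ h _] := F2 v' f'; exact: h.
- exact: linearP.
- exact: linearP.
- by move=> v' f'; rewrite !blinE; have [_ _ h] := F2 v' f'; exact: h.
Qed.

Lemma bar_lift2_bilinear : bilinear_map (bar_lift2 (m := m) (n := n) F).
Proof.
split=> [x a y z|y]; last by move=> a x z; rewrite /bar_lift2 linearP.
move: x; apply: bar_ext_word; rewrite /bar_lift2.
- exact: linearP.
- exact: linear_add (linear_scale a (linearP _)) (linearP _).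
- by move=> v f; rewrite !(bar_lift_word _ _ (bar_lift2_multilinear _)) linearP.
Qed.

Lemma bar_lift2_word v f v' f' : bar_lift2 F (pure_word m v f) (pure_word n v' f')
  = F v f v' f'.
Proof. by rewrite /bar_lift2 (bar_lift_word _ _ (bar_lift2_multilinear _)) blinE. Qed.

End BarBilinear.

(** * Iterated degeneracies and their faces *)

Section Degeneracy.
Variables (K : fieldType) (A : kalgebra K) (V : bimodule A).
Implicit Types s : seq bool.

(* The iterated degeneracy that inserts a unit at every false of s. *)
Definition spread_word s (f : nat -> A) j : A := if nth false s j then f (rank s
  j) else aone.

Lemma spread_word_update s f k x j : (k < count id s)%N ->
  spread_word s (update f k x) j = update (spread_word s f) (select s k) x j.
Proof.
move=> kc; have [h1 h2 h3] := selectP kc; rewrite /spread_word /update.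
case: ifP => sj; last by case: eqP => // jE; rewrite jE h2 in sj.
have -> // : (rank s j == k) = (j == select s k).
by apply/eqP/eqP => [<-|->//]; rewrite select_rank.
Qed.

Definition spread s p n : {linear bar_ob V p -> bar_ob V n} :=
  bar_lift p (fun v f => pure_word n v (spread_word s f)).

Lemma spread_pure s p n v f : size s = n -> count id s = p ->
  spread s p n (pure_word p v f) = pure_word n v (spread_word s f).
Proof.
move=> sn sp; rewrite /spread bar_lift_word //; split=> [g|u g k kp|u g h gh].
- exact: pure_word_linearl.
- rewrite -sp in kp; have [h1 _ _] := selectP kp; rewrite sn in h1.
  move=> a x y; have E z : pure_word n u (spread_word s (update g k z)) =
      pure_word n u (update (spread_word s g) (select s k) z).
    by apply: eq_pure_word => j _; exact: spread_word_update.
  by rewrite !E pure_word_linearr.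
- apply: eq_pure_word => j _; rewrite /spread_word; case: ifP => // sj.
  by apply: gh; rewrite -sp rank_lt.
Qed.

(** Either places i - 1 and i hold consecutive letters of the original word, or i is the last face
    and the letter acting on the coefficient is the last one of that word. In both cases the face
    can be taken before spreading, at index [rank s i]. *)
Lemma face_spread_eq s p n i x : size s = n.+1 -> count id s = p.+1 ->
  (0 < i <= n.+1)%N -> nth false s i.-1 -> (i == n.+1) || nth false s i ->
  face (bar V) n i (spread s p.+1 n.+1 x) =
  spread (remove i.-1 s) p n (face (bar V) p (rank s i) x).
Proof.
move=> sn sp; case: i => //= i iN si0 si1.
have isz : (i < size s)%N by rewrite sn.
have sd : size (remove i s) = n by have := size_remove isz; rewrite sn => -[].
have cd : count id (remove i s) = p by have := count_remove si0; rewrite sp => -[].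
move: x; apply: (@bar_word_ext _ _ _ _ _ (face (bar V) n i.+1 \o spread s p.+1 n.+1)
  (spread (remove i s) p n \o face (bar V) p (rank s i.+1))) => v f.
change (face (bar V) n i.+1 (spread s p.+1 n.+1 (pure_word p.+1 v f)) =
  spread (remove i s) p n (face (bar V) p (rank s i.+1) (pure_word p.+1 v f))).
rewrite face_word_fun !spread_pure // face_word_fun.
have rki : rank s i.+1 = (rank s i).+1 by rewrite rankS si0 addn1.
have cE : fcoef n i.+1 v (spread_word s f) = fcoef p (rank s i.+1) v f.
  rewrite /fcoef rki /= !ltnS.
  case/orP: si1 => [/eqP[iE]|si1].
    have : rank s (size s) = count id s by exact: rank_size.
    rewrite sn sp -iE rki => -[rkp]; rewrite leqnn rkp leqnn.
    by rewrite /spread_word si0 rkp.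
  have := rank_lt si1; have : (i.+1 < size s)%N.
    by case: ltnP => // h; rewrite nth_default in si1.
  rewrite sn sp rki => h1 h2.
  by rewrite ifF ?ifF //; lia.
rewrite cE; apply: eq_pure_word => t tn.
rewrite /face_fun /spread_word nth_remove //.
have [ti|ti|ti] := ltngtP t i.
- rewrite ltnS ti rank_remove_le //; last exact: ltnW.
  case: ifP => // st; rewrite rki ltnS.
  have := rank_mono s ti; rewrite rankS st addn1 => h.
  by rewrite ifT.
- have h : (t.+1 < i.+1)%N = false by lia.
  have h' : (t.+1 == i.+1) = false by lia.
  rewrite h h'; case: ifP => // st.
  have si : nth false s i.+1 by move: si1; case/orP => [/eqP|//]; lia.
  have := rank_remove_ge isz si0 (ltnW ti).
  have := rank_mono s (_ : i.+2 <= t.+1)%N; rewrite rankS si addn1 rki =>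
    /(_ ti) h2 h3.
  rewrite -h3 in h2 *.
  by rewrite ifF ?ifF //; lia.
- subst t; rewrite ltnn eqxx si0 rank_remove_le // rki ltnn eqxx.
  have -> : nth false s i.+1 by move: si1; case/orP => [/eqP|//]; lia.
  by [].
Qed.

Lemma face_spread_moore s p n i x : size s = n.+1 -> count id s = p ->
  (0 < i <= n.+1)%N -> nth false s i.-1 -> (i == n.+1) || nth false s i ->
  x \in @moore _ (bar V) p -> face (bar V) n i (spread s p n.+1 x) = 0.
Proof.
case: p x => [|p] x sn sp hi si0 si1.
  by have := rank_lt si0; rewrite sp.
move=> /mooreP xM; rewrite face_spread_eq // xM ?raddf0 //.
case: i hi si0 si1 => //= i hi si0 _.
have isz : (i.+1 <= size s)%N by rewrite sn; lia.
by have := rank_mono s isz; rewrite rank_size sp rankS si0 addn1.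
Qed.

(** One of the two merged letters is an inserted unit, so the product is the other letter in both
    orders. *)
Lemma face_spread_swap s p n i x : size s = n.+1 -> count id s = p -> (i < n)%N ->
  nth false s i != nth false s i.+1 ->
  face (bar V) n i.+1 (spread s p n.+1 x) =
  face (bar V) n i.+1 (spread (swap i s) p n.+1 x).
Proof.
move=> sn sp ni ne.
have isz : (i.+1 < size s)%N by rewrite sn ltnS.
move: x; apply: (@bar_word_ext _ _ _ _ _ (face (bar V) n i.+1 \o spread s p n.+1)
  (face (bar V) n i.+1 \o spread (swap i s) p n.+1)) => v f.
change (face (bar V) n i.+1 (spread s p n.+1 (pure_word p v f)) =
  face (bar V) n i.+1 (spread (swap i s) p n.+1 (pure_word p v f))).
rewrite !spread_pure ?size_swap ?count_swap // !face_word_fun.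
have cE g : fcoef n i.+1 v g = v by rewrite /fcoef /= ifF //; lia.
rewrite !cE.
apply: eq_pure_word => t tn; rewrite /face_fun.
have rkE : rank (swap i s) i = rank s i by rewrite rank_swap //; lia.
have [ti|ti|ti] := ltngtP t i.
- have e1 : (t == i) = false by lia.
  have e2 : (t == i.+1) = false by lia.
  by rewrite ltnS ti /spread_word nth_swap // rank_swap ?e2 // e1.
- have h : (t.+1 < i.+1)%N = false by lia.
  have h' : (t.+1 == i.+1) = false by lia.
  have e1 : (t.+1 == i) = false by lia.
  by rewrite h h' /spread_word nth_swap // rank_swap ?h' // e1.
- subst t; rewrite ltnn eqxx /spread_word !rankS !nth_swap // rkE eqxx.
  have -> : (i.+1 == i) = false by lia.
  rewrite eqxx; move: ne; case: (nth _ s i); case: (nth _ s i.+1) => //= _.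
    by rewrite addn0 amul1 a1mul.
  by rewrite addn0 amul1 a1mul.
Qed.

Lemma face0_spread_true s p n x : size s = n -> count id s = p ->
  face (bar V) n 0 (spread (true :: s) p.+1 n.+1 x) =
  spread s p n (face (bar V) p 0 x).
Proof.
move=> sn sp.
move: x; apply: (@bar_word_ext _ _ _ _ _ (face (bar V) n 0 \o spread (true :: s)
  p.+1 n.+1)
  (spread s p n \o face (bar V) p 0)) => v f.
change (face (bar V) n 0 (spread (true :: s) p.+1 n.+1 (pure_word p.+1 v f)) =
  spread s p n (face (bar V) p 0 (pure_word p.+1 v f))).
have sn' : size (true :: s) = n.+1 by rewrite /= sn.
have sp' : count id (true :: s) = p.+1 by rewrite /= sp.
rewrite (spread_pure _ _ sn' sp') !face_word_fun spread_pure //.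
Qed.

Lemma face0_spread_false s p n x : size s = n -> count id s = p ->
  face (bar V) n 0 (spread (false :: s) p n.+1 x) = spread s p n x.
Proof.
move=> sn sp.
move: x; apply: (@bar_word_ext _ _ _ _ _ (face (bar V) n 0 \o spread (false :: s)
  p n.+1)
  (spread s p n)) => v f.
change (face (bar V) n 0 (spread (false :: s) p n.+1 (pure_word p v f)) =
  spread s p n (pure_word p v f)).
have sn' : size (false :: s) = n.+1 by rewrite /= sn.
rewrite (spread_pure (s := false :: s) _ _ sn' sp) face_word_fun spread_pure //.
by rewrite /fcoef /= /spread_word /= ract1; apply: eq_pure_word.
Qed.

End Degeneracy.

(** * Letterwise pairing of two bar objects *)

Section Mix.
Variables (K : fieldType) (A A' : kalgebra K) (V : bimodule A) (V' : bimodule A').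
Local Notation T := (tensor_algebra A A').
Local Notation VT := (tensor_bimodule V V').

Definition mix_fun n v (f : nat -> A) v' (f' : nat -> A') : bar_ob VT n :=
  pure_word (V := VT) n (tens v v' : VT) (fun k => tens (f k) (f' k) : T).

Lemma mix_fun1 n v f : multilinear_fun n (mix_fun n v f).
Proof.
split=> [g|u g k kn|u g h gh]; rewrite /mix_fun.
- by move=> a x y; rewrite (tens_bilinear _ _).1; exact: pure_word_linearl.
- move=> a x y; pose w k := tens (f k) (g k) : T.
  have E z : pure_word (V := VT) n (tens v u : VT) (fun j =>
    tens (f j) (update g k z j) : T) =
      pure_word (V := VT) n (tens v u : VT) (update w k (tens (f k) z : T)).
    by apply: eq_pure_word => j _; rewrite /update; case: eqP => [->|].
  by rewrite !E (tens_bilinear _ _).1; exact: pure_word_linearr.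
- by apply: eq_pure_word => k /gh ->.
Qed.

Lemma mix_fun2 n v' f' : multilinear_fun n (fun v f => mix_fun n v f v' f').
Proof.
split=> [g|u g k kn|u g h gh]; rewrite /mix_fun.
- by move=> a x y; rewrite (tens_bilinear _ _).2; exact: pure_word_linearl.
- move=> a x y; pose w k := tens (g k) (f' k) : T.
  have E z : pure_word (V := VT) n (tens u v' : VT) (fun j =>
    tens (update g k z j) (f' j) : T) =
      pure_word (V := VT) n (tens u v' : VT) (update w k (tens z (f' k) : T)).
    by apply: eq_pure_word => j _; rewrite /update; case: eqP => [->|].
  by rewrite !E (tens_bilinear _ _).2; exact: pure_word_linearr.
- by apply: eq_pure_word => k /gh ->.
Qed.

(** The comparison map into the bar object of the tensor product. It commutes with all faces
    ([face_mix]), so a face of a shuffle is computed in each factor separately. *)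
Definition mix n : {linear tensor (bar_ob V n) (bar_ob V' n) -> bar_ob VT n} :=
  tens_lift (bar_lift2 (mix_fun n)).

Lemma mix_pure n v f v' f' : mix n (tens (pure_word n v f) (pure_word n v' f')) =
  mix_fun n v f v' f'.
Proof.
rewrite /mix tens_lift_tens ?bar_lift2_word //; first exact: mix_fun1;
  first exact: mix_fun2.
by apply: bar_lift2_bilinear; [exact: mix_fun1|exact: mix_fun2].
Qed.

Lemma tensor_bar_ext m n (W : lmodType K)
    (F G : {linear tensor (bar_ob V m) (bar_ob V' n) -> W}) :
  (forall v f v' f', F (tens (pure_word m v f) (pure_word n v' f')) =
    G (tens (pure_word m v f) (pure_word n v' f'))) ->
  F =1 G.
Proof.
move=> FG; apply: tens_lift_ext => x x'.
have [B1 B2] := tens_bilinear (bar_ob V m) (bar_ob V' n).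
move: x; apply: bar_ext_word => [||v f].
- exact: linear_comp (linearP F) (B2 x').
- exact: linear_comp (linearP G) (B2 x').
move: x'; apply: bar_ext_word => [||v' f'] //.
- exact: linear_comp (linearP F) (B1 _).
- exact: linear_comp (linearP G) (B1 _).
Qed.

Lemma face_mix n i z :
  face (bar VT) n i (mix n.+1 z) = mix n (tmap (face (bar V) n i) (face (bar V') n
    i) z).
Proof.
move: z; apply: (@tensor_bar_ext _ _ _ (face (bar VT) n i \o mix n.+1)
  (mix n \o tmap (face (bar V) n i) (face (bar V') n i))) => v f v' f'.
change (face (bar VT) n i (mix n.+1 (tens (pure_word n.+1 v f) (pure_word n.+1 v'
  f'))) =
  mix n (tmap (face (bar V) n i) (face (bar V') n i) (tens (pure_word n.+1 v f)
    (pure_word n.+1 v' f')))).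
rewrite tmap_tens !face_word_fun !mix_pure face_word_fun /mix_fun.
have -> : fcoef n i (tens v v' : VT) (fun k => tens (f k) (f' k) : T) =
    tens (fcoef n i v f) (fcoef n i v' f').
  rewrite /fcoef; case: eqP => _; first exact: tensor_ractE.
  by case: ifP => _ //; exact: tensor_lactE.
apply: eq_pure_word => k kn; rewrite /face_fun; case: ifP => // _.
by case: ifP => // _; exact: tensor_mulE.
Qed.

End Mix.

Section Moore.
Variables (K : fieldType) (X : simplicial K).

Definition rhoL n : {linear X n -> X n} := linmap (@rho_linear K X n).

Lemma rhoLE n x : rhoL n x = rho x. Proof. by []. Qed.

Lemma rho_id n (x : X n) : x \in @moore _ X n -> rho x = x.
Proof. by move=> xM; apply: rho_unique; rewrite // subrr rpred0. Qed.

Lemma rho_degen0 n (x : X n) : x \in @degenerate _ X n -> rho x = 0.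
Proof. by move=> xD; apply: rho_unique; rewrite ?rpred0 // subr0. Qed.

Lemma altface_moore n (x : X n.+1) :
  x \in @moore _ X n.+1 -> altface x = face X n 0 x.
Proof.
move=> /mooreP xM; rewrite /altface big_ord_recl /= expr0 scale1r big1 ?addr0 //.
by move=> i _; rewrite xM ?scaler0 //; have := ltn_ord i; rewrite /bump; lia.
Qed.

End Moore.

Lemma bideg_subproof n (s : n.-tuple bool) : (count id s + count negb s)%N = n.
Proof. by rewrite count_bool size_tuple. Qed.

Definition bideg n (s : n.-tuple bool) : bidegree n := Bidegree (bideg_subproof s).

Lemma swap_tuple_subproof n i (s : n.-tuple bool) : size (swap i s) == n.
Proof. by rewrite size_swap size_tuple. Qed.

Definition swap_tuple n i (s : n.-tuple bool) : n.-tuple bool := Tuple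
  (swap_tuple_subproof i s).

Lemma bideg_swap n i (s : n.-tuple bool) : bideg (swap_tuple i s) = bideg s.
Proof. by apply: bidegree_eq; rewrite /= count_swap. Qed.

Section Shuffle.
Variables (K : fieldType) (A A' : kalgebra K) (V : bimodule A) (V' : bimodule A').
Local Notation T := (tensor_algebra A A').
Local Notation VT := (tensor_bimodule V V').

(** One term of the Eilenberg-Zilber map: units are inserted at the falses of [s] in the left chain
    and at the trues in the right one, then letters are paired. Opaque for the same reason as
    [tmap]. *)
Lemma shuffle_subproof (s : seq bool) p q n :
  {h : {linear tensor (bar V p) (bar V' q) -> bar VT n} |
    h =1 mix V V' n \o tmap (spread V s p n) (spread V' (map negb s) q n)}.
Proof. by exists (mix V V' n \o tmap (spread V s p n) (spread V' (map negb s) q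
  n)). Qed.

Definition shuffle s p q n := sval (shuffle_subproof s p q n).

Lemma shuffleE s p q n z : shuffle s p q n z =
  mix V V' n (tmap (spread V s p n) (spread V' (map negb s) q n) z).
Proof. exact: (svalP (shuffle_subproof s p q n)). Qed.

Definition shuffle_word (s : seq bool) (f : nat -> A) (f' : nat -> A') k : T :=
  if nth false s k then tens (f (rank s k)) aone
  else tens aone (f' (rank (map negb s) k)).

Lemma shuffle_pure s p q n v f v' f' : size s = n -> count id s = p ->
  count negb s = q ->
  shuffle s p q n (tens (pure_word p v f) (pure_word q v' f')) =
  pure_word (V := VT) n (tens v v' : VT) (shuffle_word s f f').
Proof.
move=> sn sp sq; rewrite shuffleE tmap_tens !spread_pure ?size_map ?count_negs //.
rewrite mix_pure /mix_fun; apply: (@eq_pure_word _ _ VT) => k kn;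
  rewrite /spread_word /shuffle_word nth_negs sn kn /=.
by case: nth.
Qed.

Lemma face_shuffle s p q n i z : face (bar VT) n i (shuffle s p q n.+1 z) =
  mix V V' n (tmap (face (bar V) n i \o spread V s p n.+1)
    (face (bar V') n i \o spread V' (map negb s) q n.+1) z).
Proof. by rewrite shuffleE [LHS]face_mix tmap_comp. Qed.

Lemma face_shuffle_swap s p q n i z : size s = n.+1 -> count id s = p ->
  count negb s = q -> (i < n)%N -> nth false s i != nth false s i.+1 ->
  face (bar VT) n i.+1 (shuffle s p q n.+1 z) =
  face (bar VT) n i.+1 (shuffle (swap i s) p q n.+1 z).
Proof.
move=> sn sp sq ni ne; rewrite !face_shuffle; congr (mix _ _ _ _).
apply: eq_tmap => x; first exact: face_spread_swap.
rewrite map_swap; apply: face_spread_swap; rewrite ?size_map ?count_negs //.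
rewrite !nth_negs sn !ltnS ni (ltnW ni) /=.
by move: ne; do 2!case: nth.
Qed.

(** The side that owns the letter at i - 1 sees a positive face of a Moore chain, so one tensor
    factor vanishes. For i = n + 1 this is the side of the last letter. *)
Lemma face_shuffle_moore s p q n i z : size s = n.+1 -> count id s = p ->
  count negb s = q -> (0 < i <= n.+1)%N ->
  (i == n.+1) || (nth false s i.-1 == nth false s i) ->
  face (bar VT) n i (shuffle s p q n.+1 (tmap (rhoL (bar V) p) (rhoL (bar V') q)
    z)) = 0.
Proof.
move=> sn sp sq hi si; rewrite face_shuffle tmap_comp.
case si0: (nth false s i.-1).
  rewrite tmap0l ?raddf0 // => x /=; apply: face_spread_moore => //.
    by case/orP: si => [->//|]; rewrite si0 => /eqP <-; rewrite orbT.
  exact: rho_moore.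
rewrite tmap0r ?raddf0 // => x /=.
apply: face_spread_moore; rewrite ?size_map ?count_negs ?nth_negs ?si0 ?sn //.
- by lia.
- case/orP: si => [->//|]; rewrite si0 => /eqP <-; rewrite andbT -ltnS.
  by case: (ltngtP i n.+1) hi => //; lia.
- exact: rho_moore.
Qed.

Lemma face0_shuffle_true s p q n z : size s = n -> count id s = p ->
  count negb s = q ->
  face (bar VT) n 0 (shuffle (true :: s) p.+1 q n.+1 z) =
  shuffle s p q n (tmap (face (bar V) p 0) idfun z).
Proof.
move=> sn sp sq; rewrite face_shuffle shuffleE tmap_comp; congr (mix _ _ _ _).
apply: eq_tmap => x; first exact: face0_spread_true.
by apply: face0_spread_false; rewrite ?size_map ?count_negs.
Qed.

Lemma face0_shuffle_false s p q n z : size s = n -> count id s = p ->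
  count negb s = q ->
  face (bar VT) n 0 (shuffle (false :: s) p q.+1 n.+1 z) =
  shuffle s p q n (tmap idfun (face (bar V') q 0) z).
Proof.
move=> sn sp sq; rewrite face_shuffle shuffleE tmap_comp; congr (mix _ _ _ _).
apply: eq_tmap => x; first exact: face0_spread_false.
by apply: face0_spread_true; rewrite ?size_map ?count_negs.
Qed.

Definition shuffle_sum n (y : graded_tensor (bar V) (bar V') n) : bar VT n :=
  \sum_(s : n.-tuple bool)
    (-1) ^+ inversions s *: shuffle s (bdl (bideg s)) (bdr (bideg s)) n (y (bideg s)).

Lemma shuffle_sum_linear n : linear (@shuffle_sum n).
Proof.
move=> a x y; rewrite /shuffle_sum scaler_sumr -big_split; apply: eq_bigr => s _ /=.
have -> : (a *: x + y) (bideg s) = a *: x (bideg s) + y (bideg s) by [].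
by rewrite linearP scalerDr !scalerA [a * _]mulrC.
Qed.

Definition graded_moore n (y : graded_tensor (bar V) (bar V') n) : Prop :=
  forall i, tmap (rhoL (bar V) (bdl i)) (rhoL (bar V') (bdr i)) (y i) = y i.

Lemma shuffle_sum_moore n (y : graded_tensor (bar V) (bar V') n) :
  graded_moore y -> shuffle_sum y \in @moore _ (bar VT) n.
Proof.
case: n y => // n y ym; apply/mooreP => i hi.
pose G s (j : bidegree n.+1) :=
  (-1) ^+ inversions s *: face (bar VT) n i (shuffle s (bdl j) (bdr j) n.+1 (y j)).
rewrite /shuffle_sum linear_sum (eq_bigr (fun s : n.+1.-tuple bool =>
  G s (bideg s))); last first.
  by move=> s _; rewrite /G linearZ.
have G0 (s : n.+1.-tuple bool) : (i == n.+1) || (nth false s i.-1 == nth false s i) ->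
    G s (bideg s) = 0.
  move=> si; rewrite /G -ym face_shuffle_moore ?scaler0 //; exact: size_tuple.
case: (eqVneq i n.+1) => [iE|iN].
  by rewrite big1 // => s _; apply: G0; rewrite iE eqxx.
case: i hi @G G0 iN => // i hi G G0 iN.
have {hi iN}ni : (i < n)%N by lia.
rewrite (bigID (fun s : n.+1.-tuple bool => nth false s i == nth false s i.+1)) /=.
rewrite big1 ?add0r => [|s si]; last by apply: G0; rewrite si orbT.
rewrite (bigID (fun s : n.+1.-tuple bool => nth false s i)) /=.
have isz (s : n.+1.-tuple bool) : (i.+1 < size s)%N by rewrite size_tuple ltnS.
(* The swap carries the patterns with true, false at i, i + 1 onto those with false, true. It adds
   one inversion and does not change the face d_(i+1), so the two halves cancel. *)
rewrite addrC (reindex (swap_tuple i)) /=; last first.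
  by exists (swap_tuple i) => s _; apply: val_inj; exact: swapK.
rewrite (eq_bigl (fun s : n.+1.-tuple bool =>
  (nth false s i != nth false s i.+1) && nth false s i)); last first.
  move=> s; rewrite !nth_swap // eqxx ifF ?eqxx; last by lia.
  by do 2!case: nth.
rewrite -big_split big1 // => s /andP[ne si] /=.
rewrite bideg_swap /G -face_shuffle_swap ?size_tuple // inversions_swap //;
  last first.
  by move: ne; rewrite si; case: nth.
by rewrite exprS mulN1r scaleNr addNr.
Qed.

(** On Moore chains only d_0 remains. It removes the head of the pattern and acts as d_0 on the left
    factor for a true, on the right one for a false. A false put before [s] adds [count id s]
    inversions, that is p: this is the sign (-1)^p of the tensor differential. *)
Lemma shuffle_sum_bd n (y : graded_tensor (bar V) (bar V') n.+1) : graded_moore y ->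
  bd (unnormalized (bar VT)) n (shuffle_sum y) =
  shuffle_sum (tensor_bd (C := unnormalized (bar V)) (D := unnormalized (bar V')) y).
Proof.
move=> ym; rewrite [LHS]altface_moore ?shuffle_sum_moore // /shuffle_sum.
pose G s (j : bidegree n.+1) :=
  (-1) ^+ inversions s *: face (bar VT) n 0 (shuffle s (bdl j) (bdr j) n.+1 (y j)).
rewrite linear_sum (eq_bigr (fun s : n.+1.-tuple bool => G s (bideg s))); last first.
  by move=> s _; rewrite /G linearZ.
rewrite tuple_sum_cons; apply: eq_bigr => s _.
have -> : bideg [tuple of true :: s] = incl (bideg s) by exact: bidegree_eq.
have -> : bideg [tuple of false :: s] = incr (bideg s) by exact: bidegree_eq.
have e1 i : tmap (face (bar V) (bdl i) 0) idfun (y (incl i)) =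
    tmap (bd (unnormalized (bar V)) (bdl i)) idfun (y (incl i)).
  rewrite -(ym (incl i)) !tmap_comp; apply: eq_tmap => // x.
  by rewrite /= altface_moore // rho_moore.
have e2 i : tmap idfun (face (bar V') (bdr i) 0) (y (incr i)) =
    tmap idfun (bd (unnormalized (bar V')) (bdr i)) (y (incr i)).
  rewrite -(ym (incr i)) !tmap_comp; apply: eq_tmap => // x.
  by rewrite /= altface_moore // rho_moore.
rewrite /G face0_shuffle_true ?size_tuple // face0_shuffle_false ?size_tuple //.
rewrite tensor_bdE linearD scalerDr linearZ /= scalerA -exprD (addnC (inversions
  s)) add0n.
congr (_ *: _ + _ *: _).
  exact: (congr1 (shuffle s _ _ n) (e1 (bideg s))).
exact: (congr1 (shuffle s _ _ n) (e2 (bideg s))).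
Qed.

End Shuffle.

(** * Shuffles and markings *)

Section Membership.
Variable K : fieldType.

Lemma lspan_ind (U : lmodType K) (P PQ : U -> Prop) :
  PQ 0 -> (forall a x y, PQ x -> PQ y -> PQ (a *: x + y)) ->
  (forall x, P x -> PQ x) -> forall x, x \in lspan P -> PQ x.
Proof.
move=> Q0 Ql Qg x /asboolP[s sP ->]; rewrite /lcomb.
elim: s sP => [|c s IH] sP; first by rewrite big_nil.
rewrite big_cons; apply: Ql; first by apply/Qg/sP; rewrite inE eqxx.
by apply: IH => d ds; apply: sP; rewrite inE ds orbT.
Qed.

Lemma mem_addsub (U : lmodType K) (S T : submodClosed U) x y :
  x \in S -> y \in T -> x + y \in addsub S T.
Proof. by move=> xS yT; apply/asboolP; exists x, y. Qed.

Lemma mem_addsubl (U : lmodType K) (S T : submodClosed U) x :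
  x \in S -> x \in addsub S T.
Proof. by move=> xS; rewrite -[x]addr0; apply: mem_addsub; rewrite ?rpred0. Qed.

Lemma mem_addsubr (U : lmodType K) (S T : submodClosed U) x :
  x \in T -> x \in addsub S T.
Proof. by move=> xS; rewrite -[x]add0r; apply: mem_addsub; rewrite ?rpred0. Qed.

Section Marked.
Variables (A : markedAlg K) (V : bimodule A).

Lemma Bsub_ind n (PQ : bar V n -> Prop) :
  PQ 0 -> (forall a x y, PQ x -> PQ y -> PQ (a *: x + y)) ->
  (forall v f, (forall k, (k < n)%N -> f k \in marking A) -> PQ (pure_word n v f)) ->
  forall x, x \in @Bsub K A V n -> PQ x.
Proof.
move=> Q0 Ql Qg; apply: lspan_ind => // x [v [l [lM ->]]].
rewrite pureE; apply: Qg => k kn.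
by have := lM (Ordinal kn); rewrite (tnth_nth 0).
Qed.

Lemma pure_word_Bsub n v f : (forall k, (k < n)%N -> f k \in marking A) ->
  pure_word n v f \in @Bsub K A V n.
Proof.
move=> fM; apply: mem_lspan; exists v, (of_word n f); split=> // i.
by rewrite (tnth_nth 0) -/(word _ _) word_of ltn_ord fM.
Qed.

(* Bbar consists of the Moore elements of Bdeg. *)
Definition Bdeg n : submodClosed (bar V n) :=
  addsub (@Bsub K A V n) (@degenerate K (bar V) n).

Lemma Bbar_moore n x : x \in @Bbar K A V n -> x \in @moore K (bar V) n.
Proof. by move=> /asboolP[b _ ->]; exact: rho_moore. Qed.

Lemma Bbar_Bdeg n x : x \in @Bbar K A V n -> x \in Bdeg n.
Proof.
move=> /asboolP[b bB ->]; rewrite (_ : rho b = b + - (b - rho b)).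
  by apply: mem_addsub => //; rewrite rpredN rho_degenerate.
by rewrite opprB addrCA subrr addr0.
Qed.

Lemma Bdeg_Bbar n x : x \in Bdeg n -> x \in @moore K (bar V) n -> x \in @Bbar K A V n.
Proof.
move=> /asboolP[b [d [bB dD ->]]] xM; apply/asboolP; exists b => //.
apply/esym/rho_unique => //.
by rewrite opprD addNKr rpredN.
Qed.

Definition Bbar_proj n : {linear bar V n -> bar V n} :=
  projT1 (cid (linear_projection (@Bbar K A V n))).

Lemma Bbar_proj_Bbar n x : Bbar_proj n x \in @Bbar K A V n.
Proof. by rewrite /Bbar_proj; case: cid => r [/= h _]; exact: h. Qed.

Lemma Bbar_proj_id n x : x \in @Bbar K A V n -> Bbar_proj n x = x.
Proof. by rewrite /Bbar_proj; case: cid => r [/= _ h]; exact: h. Qed.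

End Marked.

Variables (A A' : markedAlg K) (V : bimodule A) (V' : bimodule A').
Local Notation T := (tensor_marked A A').
Local Notation VT := (tensor_bimodule V V' : bimodule (tensor_marked A A')).

Lemma tensor_markingP (t : T) : t \in marking T ->
  exists m m', [/\ m \in marking A, m' \in marking A' &
    t = tens m aone + tens aone m'].
Proof.
have uP (C : kalgebra K) (v : C) : v \in unit_line C -> exists c, v = c *: aone.
  move: v; apply: lspan_ind => [|a x y [c ->] [d ->]|x ->].
  - by exists 0; rewrite scale0r.
  - by exists (a * c + d); rewrite scalerDl scalerA.
  - by exists 1; rewrite scale1r.
move=> /asboolP[x [y [xl yr ->]]].
have [m mM ->] : exists2 m, m \in marking A & x = tens m aone.
  move: x xl; apply: lspan_ind => [|a x z [m mM ->] [u uM ->]|x [u [v [uM /uP[c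
    ->] ->]]]].
  - by exists 0; rewrite ?rpred0 ?tens0l.
  - by exists (a *: m + u); rewrite ?rpredD ?rpredZ // tensDl tensZl.
  - by exists (c *: u); rewrite ?rpredZ // tensZr tensZl.
have [m' mM' ->] : exists2 m', m' \in marking A' & y = tens aone m'.
  move: y yr; apply: lspan_ind => [|a y z [m' mM' ->] [u uM ->]|y [u [v [/uP[c ->]
    vM ->]]]].
  - by exists 0; rewrite ?rpred0 ?tens0r.
  - by exists (a *: m' + u); rewrite ?rpredD ?rpredZ // tensDr tensZr.
  - by exists (c *: v); rewrite ?rpredZ // tensZr tensZl.
by exists m, m'.
Qed.

Lemma mem_tensor_marking m m' : m \in marking A -> m' \in marking A' ->
  (tens m aone + tens aone m' : T) \in marking T.
Proof.
move=> mM mM'; apply: mem_addsub; apply: mem_lspan.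
  by exists m, aone; split=> //; exact: mem_lspan.
by exists aone, m'; split=> //; exact: mem_lspan.
Qed.

Section ShMem.
Variables (s : seq bool) (p q n : nat).
Hypotheses (sn : size s = n) (sp : count id s = p) (sq : count negb s = q).

Lemma shuffle_Bsub b b' : b \in @Bsub K A V p -> b' \in @Bsub K A' V' q ->
  shuffle V V' s p q n (tens b b') \in @Bsub K T VT n.
Proof.
move=> bB b'B; move: b bB; apply: Bsub_ind => [|a x y hx hy|v f fM].
- by rewrite tens0l linear0 rpred0.
- by rewrite tensDl tensZl linearP rpredD ?rpredZ.
move: b' b'B; apply: Bsub_ind => [|a x y hx hy|v' f' fM'].
- by rewrite tens0r linear0 rpred0.
- by rewrite tensDr tensZr linearP rpredD ?rpredZ.
rewrite shuffle_pure //; apply: pure_word_Bsub => k kn; rewrite /shuffle_word;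
  case: ifP => sk.
  rewrite -[X in X \in _]addr0 -(tens0r _ (aone : A)).
  by apply: mem_tensor_marking; rewrite ?rpred0 //; apply: fM; rewrite -sp rank_lt.
rewrite -[X in X \in _]add0r -(tens0l _ (aone : A')).
apply: mem_tensor_marking; rewrite ?rpred0 //; apply: fM'.
by rewrite -sq -count_negs rank_lt // nth_negs sn kn sk.
Qed.

Lemma shuffle_degenl d x : d \in @degenerate K (bar V) p ->
  shuffle V V' s p q n (tens d x) \in @degenerate K (bar VT) n.
Proof.
have L1 : linear (fun d : bar V p => shuffle V V' s p q n (tens d x)).
  by move=> a u w; rewrite tensDl tensZl linearP.
apply: (@degenerate_mem _ _ _ _ _ _ (linmap L1)) => v f k kp fk /=.
have L2 : linear (fun x : bar V' q => shuffle V V' s p q n (tens (pure_word p v f)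
  x)).
  by move=> a u w; rewrite tensDr tensZr linearP.
move: x {L1}; apply: (@bar_mem _ _ _ _ _ _ (linmap L2)) => v' f' /=.
rewrite shuffle_pure //; rewrite -sp in kp; have [h1 h2 h3] := selectP kp.
by apply: (@pure_word_degenerate _ _ _ _ _ _ (select s k));
  rewrite -?sn // /shuffle_word h2 h3 fk.
Qed.

Lemma shuffle_degenr d x : d \in @degenerate K (bar V') q ->
  shuffle V V' s p q n (tens x d) \in @degenerate K (bar VT) n.
Proof.
have L1 : linear (fun d : bar V' q => shuffle V V' s p q n (tens x d)).
  by move=> a u w; rewrite tensDr tensZr linearP.
apply: (@degenerate_mem _ _ _ _ _ _ (linmap L1)) => v' f' k kq fk /=.
have L2 : linear (fun x : bar V p => shuffle V V' s p q n (tens x (pure_word q v'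
  f'))).
  by move=> a u w; rewrite tensDl tensZl linearP.
move: x {L1}; apply: (@bar_mem _ _ _ _ _ _ (linmap L2)) => v f /=.
rewrite shuffle_pure //; rewrite -sq -count_negs in kq; have [h1 h2 h3] := selectP kq.
apply: (@pure_word_degenerate _ _ _ _ _ _ (select (map negb s) k));
  rewrite -?sn -?(size_map negb s) //.
by rewrite /shuffle_word; move: h2; rewrite nth_negs h3 fk => /andP[_ /negPf->].
Qed.

Lemma shuffle_Bdeg x x' : x \in Bdeg V p -> x' \in Bdeg V' q ->
  shuffle V V' s p q n (tens x x') \in Bdeg VT n.
Proof.
move=> /asboolP[b [d [bB dD ->]]] /asboolP[b' [d' [bB' dD' ->]]].
rewrite tensDr linearD rpredD //; last exact/mem_addsubr/shuffle_degenr.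
rewrite tensDl linearD rpredD //; last exact/mem_addsubr/shuffle_degenl.
exact/mem_addsubl/shuffle_Bsub.
Qed.

(** Modulo degenerate chains a shuffle sees only normalized parts, as x (x) x' - rho x (x) rho x' =
    (x - rho x) (x) x' + rho x (x) (x' - rho x'). *)
Lemma shuffle_rho z :
  shuffle V V' s p q n (z - tmap (rhoL (bar V) p) (rhoL (bar V') q) z)
    \in @degenerate K (bar VT) n.
Proof.
pose F := tmap (rhoL (bar V) p) (rhoL (bar V') q).
have FL : linear (fun z => shuffle V V' s p q n (z - F z)).
  move=> a x y; rewrite -linearP; congr (shuffle _ _ _ _ _ _ _).
  by rewrite linearP opprD scalerBr addrACA.
move: z; apply: (@tensor_mem _ _ _ _ _ (linmap FL)) => x x' /=.
rewrite /F tmap_tens !rhoLE.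
have -> : tens x x' - tens (rho x) (rho x') =
    tens (x - rho x) x' + tens (rho x) (x' - rho x').
  by rewrite tensDl tensDr tensNl tensNr addrA subrK.
by rewrite linearD; apply: rpredD; [apply: shuffle_degenl|apply: shuffle_degenr];
  exact: rho_degenerate.
Qed.

End ShMem.

Definition graded_Bbar n (y : graded_tensor (bar V) (bar V') n) : Prop :=
  forall i, tmap (Bbar_proj V (bdl i)) (Bbar_proj V' (bdr i)) (y i) = y i.

Lemma graded_Bbar_moore n (y : graded_tensor (bar V) (bar V') n) : graded_Bbar y
  -> graded_moore y.
Proof.
move=> yb i; rewrite -yb tmap_comp.
by apply: eq_tmap => x; apply: rho_id; apply: Bbar_moore; exact: Bbar_proj_Bbar.
Qed.

Lemma shuffle_sum_Bbar n (y : graded_tensor (bar V) (bar V') n) : graded_Bbar y ->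
  shuffle_sum y \in @Bbar K T VT n.
Proof.
move=> yb; apply: Bdeg_Bbar; last by apply: shuffle_sum_moore;
  exact: graded_Bbar_moore.
apply: rpred_sum => s _; apply: rpredZ; rewrite -yb.
apply: (@tensor_mem _ _ _ _ _ (shuffle V V' s _ _ n \o tmap (Bbar_proj V _)
  (Bbar_proj V' _))).
move=> x x'.
rewrite [X in X \in _]/= tmap_tens; apply: shuffle_Bdeg; rewrite ?size_tuple //.
  exact/Bbar_Bdeg/Bbar_proj_Bbar.
exact/Bbar_Bdeg/Bbar_proj_Bbar.
Qed.

End Membership.

(** * Components of given pattern *)

Section Unshuffle.
Variables (K : fieldType) (A A' : kalgebra K) (V : bimodule A) (V' : bimodule A').
Local Notation T := (tensor_algebra A A').
Local Notation VT := (tensor_bimodule V V').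
Variables (chi : {linear A -> K^o}) (chi' : {linear A' -> K^o}).
Hypotheses (chi1 : chi aone = 1) (chi1' : chi' aone = 1).

(** For [c aone = 1], the projection onto the kernel of [c] along the unit line; that kernel stands
    in for the quotient by the unit. *)
Definition compl_unit (B : kalgebra K) (c : {linear B -> K^o}) (x : B) : B :=
  x - (c x : K) *: aone.

Lemma compl_unit_linear (B : kalgebra K) (c : {linear B ->
  K^o}) : linear (compl_unit c).
Proof.
move=> a x y; rewrite /compl_unit linearP scalerDl -scalerA opprD addrACA.
by rewrite scalerBr.
Qed.

Lemma compl_unit1 (B : kalgebra K) (c : {linear B -> K^o}) : c aone = 1 ->
  compl_unit c aone = 0.
Proof. by move=> c1; rewrite /compl_unit c1 scale1r subrr. Qed.

(* The projection of T onto A (x) 1, killing 1 (x) A' as well as the unit. *)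
Definition left_letter_fun (a : A) (b : A') : A := (chi' b : K) *: compl_unit chi a.
Definition right_letter_fun (a : A) (b : A') : A' := (chi a : K) *: compl_unit chi' b.

Lemma left_letter_bilinear : bilinear_map left_letter_fun.
Proof.
split=> [u a x y|u a x y]; rewrite /left_letter_fun;
  first by rewrite linearP scalerDl scalerA.
by rewrite compl_unit_linear scalerDr !scalerA mulrC.
Qed.

Lemma right_letter_bilinear : bilinear_map right_letter_fun.
Proof.
split=> [u a x y|u a x y]; rewrite /right_letter_fun;
  last by rewrite linearP scalerDl scalerA.
by rewrite compl_unit_linear scalerDr !scalerA mulrC.
Qed.

Definition left_letter : {linear T -> A} := tens_lift left_letter_fun.
Definition right_letter : {linear T -> A'} := tens_lift right_letter_fun.

Lemma left_letterE a b : left_letter (tens a b) = (chi' b : K) *: compl_unit chi a.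
Proof. by rewrite /left_letter tens_lift_tens //; exact: left_letter_bilinear. Qed.

Lemma right_letterE a b : right_letter (tens a b) = (chi a : K) *: compl_unit chi' b.
Proof. by rewrite /right_letter tens_lift_tens //; exact: right_letter_bilinear. Qed.

Lemma left_letterl a : left_letter (tens a aone) = compl_unit chi a.
Proof. by rewrite left_letterE chi1' scale1r. Qed.
Lemma left_letterr b : left_letter (tens aone b) = 0.
Proof. by rewrite left_letterE compl_unit1 // scaler0. Qed.
Lemma right_letterl a : right_letter (tens a aone) = 0.
Proof. by rewrite right_letterE compl_unit1 // scaler0. Qed.
Lemma right_letterr b : right_letter (tens aone b) = compl_unit chi' b.
Proof. by rewrite right_letterE chi1 scale1r. Qed.

Definition pure_word_map (B : kalgebra K) (W : bimodule B) n (f : nat -> B) :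
  {linear W -> bar W n} := linmap (@pure_word_linearl K B W n f).

Section Pattern.
Variables (s : seq bool) (p q n : nat).

(* The component of pattern s: a word survives modulo degenerates only if its
   letters are in A (x) 1 at the trues and in 1 (x) A' at the falses of s. *)
Definition unshuffle_fun (w : tensor V V') (f : nat ->
  T) : tensor (bar V p) (bar V' q) :=
  tmap (pure_word_map V p (fun k => left_letter (f (select s k))))
       (pure_word_map V' q (fun k => right_letter (f (select (map negb s) k)))) w.

Definition unshuffle : {linear bar VT n -> tensor (bar V p) (bar V' q)} :=
  bar_lift (V := VT) n unshuffle_fun.

Hypotheses (sn : size s = n) (sp : count id s = p) (sq : count negb s = q).

Let sn' : size (map negb s) = n. Proof. by rewrite size_map. Qed.
Let sq' : count id (map negb s) = q. Proof. by rewrite count_negs. Qed.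

Lemma eq_unshuffle_fun w f g :
  (forall k, (k < n)%N -> if nth false s k then left_letter (f k) = left_letter (g k)
    else right_letter (f k) = right_letter (g k)) -> unshuffle_fun w f =
      unshuffle_fun w g.
Proof.
move=> fg; apply: eq_tmap => v /=; apply: eq_pure_word => k.
  rewrite -sp => /selectP[h1 h2 _]; have := fg (select s k).
  by rewrite -sn h1 h2; exact.
rewrite -sq' => /selectP[h1 h2 _]; have := fg (select (map negb s) k).
by rewrite -sn' h1; move: h2; rewrite nth_negs => /andP[_ /negPf->]; exact.
Qed.

Lemma unshuffle_fun0 w f k : (k < n)%N ->
  (if nth false s k then left_letter (f k) = 0 else right_letter (f k) = 0) ->
    unshuffle_fun w f = 0.
Proof.
move=> kn; case: ifP => sk fk.
  apply: tmap0l => v /=; apply: (@pure_word0r _ _ _ _ _ _ (rank s k));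
    first by rewrite -sp rank_lt.
  by rewrite select_rank.
have sk' : nth false (map negb s) k by rewrite nth_negs sn kn sk.
apply: tmap0r => v /=; apply: (@pure_word0r _ _ _ _ _ _ (rank (map negb s) k)).
  by rewrite -sq' rank_lt.
by rewrite select_rank.
Qed.

Lemma unshuffle_multilinear : multilinear_fun (V := VT) n unshuffle_fun.
Proof.
split=> [f|w f k kn|w f g fg]; first exact: linearP.
  (* The letter at k enters only one tensor factor: [posE] treats the side whose pattern has true at
     k, where it sits at index [rank t k], and [posN] the other side. *)
  have posE r (t : seq bool) j (c : nat) (D : kalgebra K) (h : {linear T -> D}) x :
      count id t = c -> (j < c)%N -> nth false t k -> r = rank t k ->
      h (update f k x (select t j)) = update (fun j => h (f (select t j))) r (h x) j.
    move=> <- /selectP[h1 h2 h3] tk ->; rewrite /update.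
    have -> : (j == rank t k) = (select t j == k).
      by apply/eqP/eqP => [->|<-//]; rewrite select_rank.
    by case: eqP.
  have posN (t : seq bool) j (c : nat) (D : kalgebra K) (h : {linear T -> D}) x :
      count id t = c -> (j < c)%N -> nth false t k = false ->
      h (update f k x (select t j)) = h (f (select t j)).
    move=> <- /selectP[h1 h2 h3] tk; rewrite /update; case: eqP => // e.
    by rewrite e tk in h2.
  case sk : (nth false s k).
    have sk' : nth false (map negb s) k = false by rewrite nth_negs sk andbF.
    have kp : (rank s k < p)%N by rewrite -sp rank_lt.
    move=> a x y; rewrite /unshuffle_fun.
    move: w; apply: tensor_ext => [||v v']; first exact: linearP.
      exact: linear_add (linear_scale a (linearP _)) (linearP _).
    rewrite !tmap_tens /=.
    have E z : pure_word p v (fun k0 => left_letter (update f k z (select s k0))) =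
        pure_word p v (update (fun j => left_letter (f (select s j))) (rank s k)
          (left_letter z)).
      by apply: eq_pure_word => j jp; apply: posE (sp) _ _ _.
    have E' z : pure_word q v' (fun k0 => right_letter (update f k z (select (map
      negb s) k0))) =
        pure_word q v' (fun j => right_letter (f (select (map negb s) j))).
      by apply: eq_pure_word => j jp; apply: posN sq' _ _.
    by rewrite !E !E' linearP pure_word_linearr // tensDl tensZl.
  have sk' : nth false (map negb s) k by rewrite nth_negs sk sn kn.
  have kq : (rank (map negb s) k < q)%N by rewrite -sq' rank_lt.
  move=> a x y; rewrite /unshuffle_fun.
  move: w; apply: tensor_ext => [||v v']; first exact: linearP.
    exact: linear_add (linear_scale a (linearP _)) (linearP _).
  rewrite !tmap_tens /=.
  have E z : pure_word p v (fun k0 => left_letter (update f k z (select s k0))) =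
      pure_word p v (fun j => left_letter (f (select s j))).
    by apply: eq_pure_word => j jp; apply: posN sp _ _.
  have E' z : pure_word q v' (fun k0 => right_letter (update f k z (select (map
    negb s) k0))) =
      pure_word q v' (update (fun j => right_letter (f (select (map negb s) j)))
        (rank (map negb s) k) (right_letter z)).
    by apply: eq_pure_word => j jp; apply: posE sq' _ _ _.
  by rewrite !E !E' linearP pure_word_linearr // tensDr tensZr.
by apply: eq_unshuffle_fun => k kn; rewrite fg //; case: ifP.
Qed.

Lemma unshuffle_pure w f : unshuffle (pure_word (V := VT) n w f) = unshuffle_fun w f.
Proof. by rewrite /unshuffle bar_lift_word //; exact: unshuffle_multilinear. Qed.

Lemma unshuffle_degenerate x : x \in @degenerate K (bar VT) n -> unshuffle x = 0.
Proof.
apply: degenerate_zero => w f k kn fk; rewrite unshuffle_pure;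
  apply: (unshuffle_fun0 _ kn).
by rewrite fk; case: ifP => _; [exact: left_letterr|exact: right_letterl].
Qed.

Lemma shuffle_unshuffle_pure w f : shuffle V V' s p q n (unshuffle (pure_word (V
  := VT) n w f)) =
  pure_word (V := VT) n w (fun k => if nth false s k then tens (left_letter (f k))
    aone
    else tens aone (right_letter (f k)) : T).
Proof.
rewrite unshuffle_pure; move: w; apply: tensor_ext => [||v v'].
- by move=> a x y; rewrite /unshuffle_fun !linearP.
- exact: (@pure_word_linearl _ _ VT).
rewrite /unshuffle_fun tmap_tens /= shuffle_pure //;
  apply: (@eq_pure_word _ _ VT) => k kn; rewrite /shuffle_word.
case: ifP => sk; first by rewrite select_rank.
by rewrite select_rank // nth_negs sn kn sk.
Qed.

End Pattern.

Lemma unshuffle_shuffle_pure s t p q p' q' n v f v' f' : size s = n -> size t = n ->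
  count id s = p -> count negb s = q -> count id t = p' -> count negb t = q' ->
  unshuffle t p' q' n (shuffle V V' s p q n (tens (pure_word p v f) (pure_word q
    v' f'))) =
  unshuffle_fun t p' q' (tens v v') (shuffle_word s f f').
Proof. by move=> sn tn sp sq tp tq; rewrite shuffle_pure // unshuffle_pure. Qed.

(** At a place where the patterns differ, the letter produced by [s] lies on the side that [t]
    projects to 0. *)
Lemma unshuffle_shuffle_ne s t p q p' q' n z : size s = n -> size t = n ->
  count id s = p -> count negb s = q -> count id t = p' -> count negb t = q' ->
  s != t -> unshuffle t p' q' n (shuffle V V' s p q n z) = 0.
Proof.
move=> sn tn sp sq tp tq st.
have [k kn sk] : exists2 k, (k < n)%N & nth false s k != nth false t k.
  apply: contrapT => h; case/eqP: st; apply: (@eq_from_nth _ false).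
    by rewrite sn tn.
  move=> k; rewrite sn => kn; apply: contrapT => sk; apply: h; exists k => //.
  exact/eqP.
move: z; apply: (@tensor_bar_ext _ _ _ _ _ _ _ _ (unshuffle t p' q' n \o shuffle V
  V' s p q n) \0) => v f v' f'.
rewrite [LHS]/= unshuffle_shuffle_pure //; apply: (unshuffle_fun0 tn tp tq _ kn).
rewrite /shuffle_word; move: sk; case: (nth false s k); case: (nth false t k) => // _.
  exact: right_letterl.
exact: left_letterr.
Qed.

End Unshuffle.

Section LetterProjection.
Variables (K : fieldType) (A : kalgebra K) (V : bimodule A).
Variables (chi : {linear A -> K^o}).

Definition compl_units n : {linear bar V n -> bar V n} :=
  bar_lift n (fun v f => pure_word n v (fun k => compl_unit chi (f k))).

Lemma compl_units_pure n v f : compl_units n (pure_word n v f) =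
  pure_word n v (fun k => compl_unit chi (f k)).
Proof.
rewrite /compl_units bar_lift_word //; split=> [g|u g k kn|u g h gh].
- exact: pure_word_linearl.
- move=> a x y; have E z : pure_word n u (fun j => compl_unit chi (update g k z j)) =
      pure_word n u (update (fun j => compl_unit chi (g j)) k (compl_unit chi z)).
    by apply: eq_pure_word => j _; rewrite /update; case: eqP.
  by rewrite !E compl_unit_linear pure_word_linearr.
- by apply: eq_pure_word => k /gh ->.
Qed.

(** Each letter is its part in the kernel of [chi] plus a multiple of the unit; with [u' = 0] only
    the all-true pattern of [pure_word_expand] survives. *)
Lemma compl_units_degenerate n x : x - compl_units n x \in @degenerate K (bar V) n.
Proof.
have L : linear (fun x => x - compl_units n x).
  by move=> a u w; rewrite linearP opprD scalerBr addrACA.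
apply: (@bar_mem _ _ _ _ _ _ (linmap L)) => v f /=; rewrite compl_units_pure.
have := @pure_word_expand _ _ V n v f (fun k => compl_unit chi (f k)) (fun=> 0)
  (fun k => chi (f k) : K) _.
rewrite (bigD1 [tuple of nseq n true]) //= big1 ?addr0 => [|s sN].
  rewrite (@eq_pure_word _ _ _ _ _ (fun k => if nth false (nseq n true) k then _
    else _)
    (fun k => compl_unit chi (f k))); first by apply=> k _;
      rewrite addr0 /compl_unit subrK.
  by move=> k kn; rewrite nth_nseq kn.
have [k kn sk] : exists2 k, (k < n)%N & nth false s k = false.
  apply: contrapT => h; case/eqP: sN; apply/val_inj/(@eq_from_nth _ false).
    by rewrite size_tuple size_nseq.
  move=> k; rewrite size_tuple => kn; rewrite nth_nseq kn.
  by apply: contrapT => sk; apply: h; exists k => //; case: nth sk.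
by apply: (pure_word0r _ kn); rewrite sk.
Qed.

Lemma rho_compl_units n x : rho (compl_units n x) = rho x :> bar V n.
Proof.
apply/eqP; rewrite eq_sym -subr_eq0 -!rhoLE -raddfB; apply/eqP/rho_degen0.
exact: compl_units_degenerate.
Qed.

End LetterProjection.

Section UnshuffleShuffle.
Variables (K : fieldType) (A A' : kalgebra K) (V : bimodule A) (V' : bimodule A').
Variables (chi : {linear A -> K^o}) (chi' : {linear A' -> K^o}).
Hypotheses (chi1 : chi aone = 1) (chi1' : chi' aone = 1).

(** Followed by rho (x) rho this becomes the identity on tensors of Moore chains, by
    [rho_compl_units]. *)
Lemma unshuffle_shuffle s p q n z : size s = n -> count id s = p ->
  count negb s = q ->
  unshuffle V V' chi chi' s p q n (shuffle V V' s p q n z) =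
    tmap (compl_units V chi p) (compl_units V' chi' q) z.
Proof.
move=> sn sp sq; move: z.
apply: (@tensor_bar_ext _ _ _ _ _ _ _ _ (unshuffle V V' chi chi' s p q n \o
  shuffle V V' s p q n)
  (tmap (compl_units V chi p) (compl_units V' chi' q))) => v f v' f'.
rewrite tmap_tens !compl_units_pure [LHS]/= unshuffle_shuffle_pure //
  /unshuffle_fun tmap_tens /=; congr tens.
  apply: eq_pure_word => k; rewrite -sp => /selectP[h1 h2 h3].
  by rewrite /shuffle_word h2 h3 left_letterl.
apply: eq_pure_word => k; rewrite -sq -count_negs => /selectP[h1 h2 h3].
by move: h2; rewrite /shuffle_word nth_negs => /andP[_ /negPf->];
  rewrite h3 right_letterr.
Qed.

End UnshuffleShuffle.

(** * Components of adjacent patterns *)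

Section Split.
Variables (K : fieldType) (A A' : kalgebra K) (V : bimodule A) (V' : bimodule A').
Local Notation T := (tensor_algebra A A').
Local Notation VT := (tensor_bimodule V V').
Variables (n i : nat).
Hypothesis ni : (i < n)%N.

(* Replaces the letter a (x) b of position i by a (x) 1 followed by 1 (x) b: a
   one-sided inverse of merging two letters of opposite sides. *)
Definition split_word (f : nat -> T) a b j : T :=
  if (j < i)%N then f j else if j == i then tens a aone
  else if j == i.+1 then tens aone b else f j.-1.

Definition split_fun w f : {linear T -> bar VT n.+1} :=
  tens_lift (fun a b => pure_word (V := VT) n.+1 w (split_word f a b)).

Definition split : {linear bar VT n -> bar VT n.+1} :=
  bar_lift (V := VT) n (fun w f => split_fun w f (f i)).

Lemma split_bilinear w f :
  bilinear_map (fun a b => pure_word (V := VT) n.+1 w (split_word f a b)).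
Proof.
have i1 : (i < n.+1)%N by exact: ltnW.
split=> [a c x y|b c x y].
  have E z : pure_word (V := VT) n.+1 w (split_word f a z) =
      pure_word (V := VT) n.+1 w (update (split_word f a 0) i.+1 (tens aone z : T)).
    apply: (@eq_pure_word _ _ VT) => j _; rewrite /update /split_word;
      case: (eqVneq j i.+1) => // ->.
    by rewrite ifF ?ifF //; lia.
  by rewrite !E (tens_bilinear _ _).1; exact: (@pure_word_linearr _ _ VT).
have E z : pure_word (V := VT) n.+1 w (split_word f z b) =
    pure_word (V := VT) n.+1 w (update (split_word f 0 b) i (tens z aone : T)).
  apply: (@eq_pure_word _ _ VT) => j _; rewrite /update /split_word;
    case: (eqVneq j i) => // ->.
  by rewrite ltnn.
by rewrite !E (tens_bilinear _ _).2; exact: (@pure_word_linearr _ _ VT).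
Qed.

Lemma split_fun_tens w f a b :
  split_fun w f (tens a b) = pure_word (V := VT) n.+1 w (split_word f a b).
Proof. by rewrite /split_fun tens_lift_tens //; exact: split_bilinear. Qed.

Lemma split_fun_linear w f : linear (split_fun w f).
Proof. exact: linearP. Qed.

Lemma split_multilinear : multilinear_fun (V := VT) n (fun w f =>
  split_fun w f (f i)).
Proof.
split=> [f c x y|w f k kn|w f g fg].
- move: (f i); apply: tensor_ext; first exact: split_fun_linear.
    by apply: linear_add; first apply: linear_scale; exact: split_fun_linear.
  by move=> a b; rewrite !split_fun_tens; exact: (@pure_word_linearl _ _ VT).
- have [->|ki] := eqVneq k i => c x y.
    have E z : split_fun w (update f i z) = split_fun w f.
      congr tens_lift; apply/funext => a; apply/funext => b.
      apply: (@eq_pure_word _ _ VT) => j _; rewrite /split_word /update.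
      case: (ltngtP j i) => // ji.
      by case: eqP => // ji1; rewrite ifF //; lia.
    by rewrite !E /update eqxx; exact: split_fun_linear.
  have E z : update f k z i = f i by rewrite /update eq_sym (negPf ki).
  rewrite !E.
  move: (f i) {E}; apply: tensor_ext; first exact: split_fun_linear.
    by apply: linear_add; first apply: linear_scale; exact: split_fun_linear.
  move=> a b; rewrite !split_fun_tens.
  pose k' := if (k < i)%N then k else k.+1.
  have E z : pure_word (V := VT) n.+1 w (split_word (update f k z) a b) =
      pure_word (V := VT) n.+1 w (update (split_word f a b) k' z).
    apply: (@eq_pure_word _ _ VT) => j _; rewrite /split_word /update /k'.
    case: (ltngtP k i) ki => // ki _.
      case: (ltngtP j i) => // [ji|->]; last by rewrite ifF //; lia.
      have -> : (j == k) = false by lia.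
      by have -> : (j.-1 == k) = false by lia.
    case: (ltngtP j i) => // [ji|ji|->].
    - have -> : (j == k) = false by lia.
      by have -> : (j == k.+1) = false by lia.
    - case: (eqVneq j i.+1) => ji1; first by rewrite ifF //; lia.
      by have -> : (j.-1 == k) = (j == k.+1) by lia.
    - by rewrite ifF //; lia.
  by rewrite !E; apply: (@pure_word_linearr _ _ VT); rewrite /k'; case: ifP; lia.
- rewrite (fg _ ni); congr (tens_lift _ _).
  apply/funext => a; apply/funext => b.
  apply: (@eq_pure_word _ _ VT) => j jn; rewrite /split_word.
  case: ltnP => ji; first by apply: fg; lia.
  case: eqP => // ji'; case: eqP => // ji1.
  by apply: fg; lia.
Qed.

Lemma split_pure w f : split (pure_word (V := VT) n w f) = split_fun w f (f i).
Proof. by rewrite /split bar_lift_word //; exact: split_multilinear. Qed.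

End Split.

(** * Mixed letters in a boundary *)

Section SwapRelation.
Variables (K : fieldType) (A A' : kalgebra K) (V : bimodule A) (V' : bimodule A').
Local Notation T := (tensor_algebra A A').
Local Notation VT := (tensor_bimodule V V').
Variables (chi : {linear A -> K^o}) (chi' : {linear A' -> K^o}).
Hypotheses (chi1 : chi aone = 1) (chi1' : chi' aone = 1).
Variables (s : seq bool) (n i p q : nat).
Hypotheses (ni : (i < n)%N) (sn : size s = n.+1) (sp : count id s = p)
  (sq : count negb s = q) (si : nth false s i) (si1 : nth false s i.+1 = false).

Local Notation unshuffle s := (unshuffle V V' chi chi' s p q n.+1).

Lemma split_unshuffle_subproof : {h : {linear bar VT n ->
  tensor (bar V p) (bar V' q)} |
  h =1 unshuffle s \o split V V' n i}.
Proof. by exists (unshuffle s \o split V V' n i). Qed.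

(** Detects words whose letter at place i is mixed, a (x) b with both factors off the unit line, the
    other letters following [s]. In a boundary of marked words such a letter arises only by merging,
    from the pattern [s] or from its swap. *)
Definition split_unshuffle := sval split_unshuffle_subproof.

Lemma split_unshuffle_pure w f : split_unshuffle (pure_word (V := VT) n w f) =
  unshuffle s (split_fun n i w f (f i)).
Proof. by rewrite /split_unshuffle (svalP split_unshuffle_subproof) [LHS]/=
  split_pure. Qed.

Lemma unshuffle_split_l w f a : unshuffle s (split_fun n i w f (tens a aone)) = 0.
Proof.
rewrite split_fun_tens // unshuffle_pure //; apply: (@unshuffle_fun0 _ _ _ _ _ _ _
  _ _ _ n.+1 _ _ _ _ _ i.+1) => //.
rewrite si1 /split_word ltnNge leqnSn /= eqxx ifF; last by lia.
exact: right_letterl.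
Qed.

Lemma unshuffle_split_r w f b : unshuffle s (split_fun n i w f (tens aone b)) = 0.
Proof.
rewrite split_fun_tens // unshuffle_pure //; apply: (@unshuffle_fun0 _ _ _ _ _ _ _
  _ _ _ n.+1 _ _ _ _ _ i) => //.
  exact: ltnW.
by rewrite si /split_word ltnn eqxx; exact: left_letterr.
Qed.

Lemma split_unshuffle_marked w f a b : f i = tens a aone + tens aone b :> T ->
  split_unshuffle (pure_word (V := VT) n w f) = 0.
Proof. by move=> fi; rewrite split_unshuffle_pure fi !linearD unshuffle_split_l
  unshuffle_split_r addr0. Qed.

Lemma split_unshuffle_degenerate x : x \in @degenerate K (bar VT) n ->
  split_unshuffle x = 0.
Proof.
apply: degenerate_zero => w f k kn fk; rewrite split_unshuffle_pure.
have [ki|ki] := eqVneq k i; first by rewrite ki in fk; rewrite fk;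
  exact: (unshuffle_split_l w f aone).
move: (f i); apply: tensor_ext.
- by move=> c y z; rewrite !linearP.
- by move=> c y z; rewrite scaler0 addr0.
move=> a b; rewrite split_fun_tens // unshuffle_pure //.
(* A unit to the right of the split place has moved one place further. *)
apply: (@unshuffle_fun0 _ _ _ _ _ _ _ _ _ _ n.+1 _ _ _ _ _ (if (k < i)%N then k
  else k.+1)) => //.
  by case: ifP; lia.
have -> : split_word i f a b (if (k < i)%N then k else k.+1) = tens aone aone.
  rewrite /split_word; case: (ltngtP k i) ki => // ki _; first by rewrite ki fk.
  by rewrite ifF ?ifF ?ifF ?fk //; lia.
by case: ifP => _; [exact: left_letterr|exact: right_letterl].
Qed.

(** Any face other than d_(i+1) leaves at place i a letter a (x) 1 + 1 (x) b, which has no mixed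
    part. *)
Lemma split_unshuffle_face_ne w f j : (j <= n.+1)%N -> j != i.+1 ->
  (forall k, (k < n.+1)%N -> exists a b, f k = tens a aone + tens aone b :> T) ->
  split_unshuffle (face (bar VT) n j (pure_word (V := VT) n.+1 w f)) = 0.
Proof.
move=> jn ji fM; rewrite face_word_fun.
have [a [b fE]] : exists a b, face_fun j f i = tens a aone + tens aone b :> T.
  rewrite /face_fun eq_sym (negPf ji); case: ifP => _; apply: fM; lia.
exact: split_unshuffle_marked fE.
Qed.

(** Merging a (x) 1 + 1 (x) a' with c (x) 1 + 1 (x) c' produces the mixed terms a (x) c' and c (x)
    a'. The first takes its left factor from place i and its right one from place i + 1, as [s]
    does; the second does the opposite, as the swapped pattern does. *)
Lemma split_unshuffle_face_eq w f :
  (forall k, (k < n.+1)%N -> exists a b, f k = tens a aone + tens aone b :> T) ->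
  split_unshuffle (face (bar VT) n i.+1 (pure_word (V := VT) n.+1 w f)) =
  unshuffle s (pure_word (V := VT) n.+1 w f) + unshuffle (swap i s) (pure_word (V
    := VT) n.+1 w f).
Proof.
move=> fM; rewrite face_word_fun split_unshuffle_pure.
have -> : fcoef n i.+1 w f = w :> VT by rewrite /fcoef /= ifF //; lia.
have [a [a' fi]] := fM i (ltnW ni : (i < n.+1)%N).
have [c [c' fi1]] := fM i.+1 (ni : (i.+1 < n.+1)%N).
set g := face_fun i.+1 f.
have gi : g i = tens (amul a c) aone + tens a c' + (tens c a' +
  tens aone (amul a' c')).
  rewrite /g /face_fun ltnn eqxx fi fi1.
  have mD (x y z : T) : amul (x + y) z = amul x z + amul y z.
    by have := (amul_bilinear T).2 z 1 x y; rewrite !scale1r.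
  have Dm (x y z : T) : amul x (y + z) = amul x y + amul x z.
    by have := (amul_bilinear T).1 x 1 y z; rewrite !scale1r.
  have mE x x' y y' : amul (tens x x' : T) (tens y y') = tens (amul x y) (amul x' y').
    exact: tensor_mulE.
  by rewrite mD !Dm !mE !amul1 !a1mul.
rewrite gi !linearD unshuffle_split_l unshuffle_split_r add0r addr0
  !split_fun_tens //.
have isz : (i.+1 < size s)%N by rewrite sn.
have gE j : (j < n.+1)%N -> j != i -> j != i.+1 ->
    (if (j < i)%N then g j else g j.-1) = f j.
  move=> jn ji ji1; rewrite /g /face_fun; case: (ltngtP j i) ji => // ji _.
    by rewrite ltnS ji.
  rewrite ifF ?ifF ?prednK //; lia.
have sE x y j : (j < n.+1)%N -> j != i -> j != i.+1 -> split_word i g x y j = f j.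
  move=> jn ji ji1; rewrite -[RHS]gE // /split_word (negPf ji) (negPf ji1).
  by case: ifP.
have sEi x y : split_word i g x y i = tens x aone by rewrite /split_word ltnn eqxx.
have sEi1 x y : split_word i g x y i.+1 = tens aone y.
  by rewrite /split_word ltnNge leqnSn /= eqxx ifF //; lia.
congr (_ + _); rewrite !unshuffle_pure ?size_swap ?count_swap //.
  apply: (@eq_unshuffle_fun _ _ _ _ _ _ _ _ _ _ n.+1) => // k kn.
  have [->|ki] := eqVneq k i; first by rewrite si sEi fi linearD left_letterl //
    left_letterr // addr0.
  have [->|ki1] := eqVneq k i.+1; last by rewrite sE //; case: ifP.
  by rewrite si1 sEi1 fi1 linearD right_letterl // right_letterr // add0r.
have ne : nth false s i != nth false s i.+1 by rewrite si si1.
have ne' : nth false (map negb s) i != nth false (map negb s) i.+1.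
  by rewrite !nth_negs isz ltnW // si si1.
apply: eq_tmap => v /=; apply: eq_pure_word => k.
  rewrite -sp => kp; have [h1 h2 h3] := selectP kp.
  rewrite select_swap //; case: (eqVneq (select s k) i) => [e|ki].
    by rewrite e sEi fi1 linearD left_letterl // left_letterr // addr0.
  have ki1 : select s k != i.+1 by apply/eqP => e; rewrite e si1 in h2.
  by rewrite (negPf ki1) sE // -sn.
rewrite -sq -count_negs => kp; have [h1 h2 h3] := selectP kp.
rewrite map_swap select_swap ?size_map //.
have ki : select (map negb s) k != i.
  by apply/eqP => e; rewrite e nth_negs si andbF in h2.
rewrite (negPf ki); case: (eqVneq (select (map negb s) k) i.+1) => [e|ki1].
  by rewrite e sEi1 fi linearD right_letterl // right_letterr // add0r.
by rewrite sE // -sn -(size_map negb).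
Qed.

End SwapRelation.

Section SwapMarked.
Variables (K : fieldType) (A A' : markedAlg K) (V : bimodule A) (V' : bimodule A').
Local Notation T := (tensor_marked A A').
Local Notation VT := (tensor_bimodule V V' : bimodule (tensor_marked A A')).
Variables (chi : {linear A -> K^o}) (chi' : {linear A' -> K^o}).
Hypotheses (chi1 : chi aone = 1) (chi1' : chi' aone = 1).

(** [Qs] is evaluated on the boundary of [b] in two ways. It is 0, since the boundary is a chain of
    marked words plus a degenerate chain and [Qs] kills both; and it is (-1)^(i+1) times the sum of
    the two components, since only d_(i+1) contributes. *)
Lemma unshuffle_swap s n i p q b : (i < n)%N -> size s = n.+1 -> count id s = p ->
  count negb s = q -> nth false s i -> nth false s i.+1 = false ->
  b \in @Bsub K T VT n.+1 -> altface b \in Bdeg VT n ->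
  unshuffle V V' chi chi' (swap i s) p q n.+1 b = -
    unshuffle V V' chi chi' s p q n.+1 b.
Proof.
move=> ni sn sp sq si si1 bB db.
pose Qs := split_unshuffle V V' chi chi' s n i p q.
have fM (f : nat -> T) : (forall k, (k < n.+1)%N -> f k \in marking T) ->
    forall k, (k < n.+1)%N -> exists a b, f k = tens a aone + tens aone b :> T.
  by move=> h k /h /tensor_markingP[m [m' [_ _ ->]]]; exists m, m'.
have Q0 : Qs (altface b) = 0.
  move: db => /asboolP[x [y [xB yD ->]]].
  rewrite linearD [X in _ + X]split_unshuffle_degenerate // addr0.
  move: x xB; apply: Bsub_ind => [|a u v hu hv|w f fB].
  - by rewrite linear0.
  - by rewrite linearP hu hv scaler0 addr0.
  have := fB i ni => /tensor_markingP[m [m' [_ _ fE]]].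
  exact: split_unshuffle_marked fE.
have QE : Qs (altface b) = (-1) ^+ i.+1 *:
    (unshuffle V V' chi chi' s p q n.+1 b + unshuffle V V' chi chi' (swap i s) p q
      n.+1 b).
  move: b bB {db Q0}; apply: Bsub_ind => [|a u v hu hv|w f fB].
  - by rewrite -[altface 0]/(bd (unnormalized (bar VT)) n 0) !linear0 addr0 scaler0.
  - rewrite altface_linear !linearP hu hv /= addrACA -scalerDr [RHS]scalerDr !scalerA.
    by rewrite mulrC.
  have j0P : (i.+1 < n.+2)%N by exact: ltnW.
  rewrite /altface linear_sum (bigD1 (Ordinal j0P)) // big1 => [|j ji].
    rewrite [LHS]addr0 linearZ_LR; congr (_ *: _).
    by apply: split_unshuffle_face_eq => //; exact: fM.
  rewrite linearZ_LR split_unshuffle_face_ne ?scaler0 //; last exact: fM.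
  by rewrite -ltnS; exact: ltn_ord.
move: Q0; rewrite QE => /eqP; rewrite scaler_eq0 signr_eq0 /= addrC addr_eq0.
by move/eqP.
Qed.

(** Induction on the inversions, undoing one false-true pair at a time. The case split on [n] in the
    hypothesis expresses that degree 0 carries no boundary condition. *)
Lemma unshuffle_inversions s n p q b : size s = n -> count id s = p ->
  count negb s = q ->
  b \in @Bsub K T VT n ->
  (if n is m.+1 then fun b : bar VT m.+1 => altface b \in Bdeg VT m else xpredT) b ->
  unshuffle V V' chi chi' s p q n b = (-1) ^+ inversions s *: unshuffle V V' chi
    chi' (sorted_pattern p q) p q n b.
Proof.
move=> sn sp sq bB db.
have [k] := ubnP (inversions s); elim: k s sn sp sq => // k IH s sn sp sq sk.
have [s0|] := posnP (inversions s); first by rewrite s0 scale1r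
  (inversions0_sorted s0) sp sq.
move=> /inversions_descent[i [isz si si1]].
case: n b bB db sn IH isz => [|n] b bB db sn IH isz; first by rewrite sn in isz.
have ni : (i < n)%N by rewrite sn ltnS in isz.
have tsz : size (swap i s) = n.+1 by rewrite size_swap.
have ti : nth false (swap i s) i by rewrite nth_swap // eqxx.
have ti1 : nth false (swap i s) i.+1 = false.
  by rewrite nth_swap // eqxx ifF ?si //; lia.
have iE : inversions s = (inversions (swap i s)).+1.
  by rewrite -[s in LHS](swapK i) inversions_swap ?tsz ?ti1.
(* [unshuffle_swap] wants true, false at i, i + 1: this is the situation of [swap i s], not of
   [s]. *)
rewrite -[s in LHS](swapK i) (@unshuffle_swap (swap i s) n i) ?count_swap //.
rewrite IH ?count_swap //; last by rewrite iE ltnS in sk.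
by rewrite iE exprS mulN1r scaleNr.
Qed.

Lemma compl_unit_marking (B : markedAlg K) (c : {linear B -> K^o}) m :
  m \in marking B -> compl_unit c m \in marking B.
Proof. by move=> mM; apply: submodB => //; apply: rpredZ; exact: marking1. Qed.

(** The two projections of a marked letter m (x) 1 + 1 (x) m' are m and m' without their unit parts,
    which stay in the markings because these contain the units. *)
Lemma unshuffle_Bsub s n p q b : size s = n -> count id s = p -> count negb s = q ->
  b \in @Bsub K T VT n ->
  tmap (Bbar_proj V p) (Bbar_proj V' q)
    (tmap (rhoL (bar V) p) (rhoL (bar V') q) (unshuffle V V' chi chi' s p q n b)) =
  tmap (rhoL (bar V) p) (rhoL (bar V') q) (unshuffle V V' chi chi' s p q n b).
Proof.
move=> sn sp sq; move: b; apply: Bsub_ind => [|a x y hx hy|w f fB].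
- by rewrite !linear0.
- by rewrite !linearP hx hy.
rewrite unshuffle_pure // /unshuffle_fun !tmap_comp; apply: eq_tmap => v.
  apply: Bbar_proj_id; apply/asboolP; exists (pure_word p v (fun k =>
    left_letter chi chi' (f (select s k)))) => //.
  apply: pure_word_Bsub => k; rewrite -sp => /selectP[h1 _ _]; rewrite sn in h1.
  have /tensor_markingP[m [m' [mM _ ->]]] := fB _ h1.
  by rewrite linearD left_letterl // left_letterr // addr0 compl_unit_marking.
apply: Bbar_proj_id; apply/asboolP.
exists (pure_word q v (fun k => right_letter chi chi' (f (select (map negb s)
  k)))) => //.
apply: pure_word_Bsub => k; rewrite -sq -count_negs => /selectP[h1 _ _].
rewrite size_map sn in h1.
have /tensor_markingP[m [m' [_ mM ->]]] := fB _ h1.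
by rewrite linearD right_letterl // right_letterr // add0r compl_unit_marking.
Qed.

(** A marked letter is its left part plus its right part plus a multiple of the unit, so this is
    [pure_word_expand] with one term per pattern. *)
Lemma shuffle_unshuffle_sum n b : b \in @Bsub K T VT n ->
  b - \sum_(s : n.-tuple bool) shuffle V V' s (count id s) (count negb s) n
        (unshuffle V V' chi chi' s (count id s) (count negb s) n b)
    \in @degenerate K (bar VT) n.
Proof.
pose F (s : seq bool) b := shuffle V V' s (count id s) (count negb s) n
  (unshuffle V V' chi chi' s (count id s) (count negb s) n b).
move: b; apply: Bsub_ind => [|a x y hx hy|w f fB].
- by rewrite sub0r rpredN big1 ?rpred0 // => s _; rewrite !linear0.
- rewrite (_ : \sum_s _ = a *: (\sum_(s : n.-tuple bool) F s x) +
      \sum_(s : n.-tuple bool) F s y).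
    by rewrite opprD addrACA -scalerBr rpredD ?rpredZ.
  rewrite scaler_sumr -big_split; apply: eq_bigr => s _.
  by rewrite /F !linearP.
pose u k : T := tens (left_letter chi chi' (f k)) aone.
pose u' k : T := tens aone (right_letter chi chi' (f k)).
rewrite (eq_bigr (fun s : n.-tuple bool =>
  pure_word (V := VT) n w (fun k => if nth false s k then u k else u' k)));
    last first.
  by move=> s _; rewrite shuffle_unshuffle_pure ?size_tuple.
have ex k : exists c : K, (k < n)%N -> f k = u k + u' k + c *: (aone : T).
  case: (ltnP k n) => kn; last by exists 0.
  have /tensor_markingP[m [m' [_ _ fE]]] := fB _ kn.
  exists ((chi m : K) + (chi' m' : K)) => _.
  rewrite /u /u' fE !linearD left_letterl // left_letterr // right_letterl //
    right_letterr // addr0 add0r.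
  have -> : (aone : T) = tens aone aone by [].
  rewrite scalerDl -tensZl -tensZr addrACA -tensDl -tensDr.
  by rewrite /compl_unit !subrK.
exact: (@pure_word_expand _ _ VT n w f u u' (fun k => projT1 (cid (ex k)))
  (fun k => projT2 (cid (ex k)))).
Qed.

End SwapMarked.

(** * The isomorphism *)

Lemma count_sorted p q : count id (sorted_pattern p q) = p.
Proof. by rewrite count_cat !count_nseq mul1n mul0n addn0. Qed.

Lemma count_negb_sorted p q : count negb (sorted_pattern p q) = q.
Proof. by rewrite count_cat !count_nseq mul1n mul0n. Qed.

Lemma size_sorted_pattern p q : size (sorted_pattern p q) = (p + q)%N.
Proof. by rewrite size_cat !size_nseq. Qed.

Lemma inversions_sorted p q : inversions (sorted_pattern p q) = 0%N.
Proof.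
elim: p => [|p IH] //=; elim: q => [|q IH] //=.
by rewrite -[inversions _]/(inversions (sorted_pattern 0 q)) IH addn0 count_nseq.
Qed.

Lemma std_tuple_subproof n (i : bidegree n) : size (sorted_pattern (bdl i) (bdr
  i)) == n.
Proof. by rewrite size_sorted_pattern bidegreeP. Qed.

Definition std_tuple n (i : bidegree n) : n.-tuple bool := Tuple
  (std_tuple_subproof i).

Lemma bideg_sorted n (i : bidegree n) : bideg (std_tuple i) = i.
Proof. by apply: bidegree_eq; rewrite /= ?count_sorted ?count_negb_sorted. Qed.

Section Functional.
Variables (K : fieldType) (A : kalgebra K).

(** A generalized inverse g of the map f : c |-> c 1 works: f (g (f 1)) = f 1 reads g(1) 1 = 1,
    where the unit is nonzero. *)
Lemma unit_functional : aone <> 0 :> A ->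
  exists chi : {linear A -> K^o}, chi aone = 1.
Proof.
move=> A1; have fL : linear (fun c : K^o => (c : K) *: (aone : A)).
  by move=> a x y; rewrite scalerDl scalerA.
have [g gE] := linear_ginv (linmap fL); exists g.
have := gE 1; rewrite /= scale1r => /eqP; rewrite -subr_eq0 -{3}[aone]scale1r.
by rewrite -scalerBl scaler_eq0 subr_eq0 => /orP[/eqP//|/eqP].
Qed.

Lemma bar_trivial (V : bimodule A) n (x : bar V n) : aone = 0 :> A -> x = 0.
Proof.
move=> A1; apply: (@bar_word_ext _ _ _ _ _ idfun \0) => v f /=.
rewrite -[v]ract1 A1 (linear0f ((ract_bilinear V).1 v)); exact: pure_word0l.
Qed.

End Functional.

(** * Projections onto Omega *)

Section OmegaProjection.
Variables (K : fieldType) (A : markedAlg K) (V : bimodule A).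

Lemma Bbar_coproj_linear n : linear (fun x : bar V n => x - Bbar_proj V n x).
Proof. by move=> a x y; rewrite linearP opprD addrACA -scalerBr. Qed.

Definition Bbar_coproj n : {linear bar V n -> bar V n} := linmap
  (@Bbar_coproj_linear n).

Lemma Bbar_coproj_proj n x : Bbar_coproj n (Bbar_proj V n x) = 0.
Proof. by rewrite /= [X in _ - X]Bbar_proj_id ?subrr //; exact: Bbar_proj_Bbar. Qed.

(* Vanishes on x in Bbar exactly when x is in Omega. *)
Definition defect n : {linear bar V n -> bar V n.-1} :=
  match n with
  | 0 => \0
  | m.+1 => Bbar_coproj m \o bd (unnormalized (bar V)) m
  end.

Lemma omegaE n (x : bar V n) :
  x \in @Bbar K A V n -> defect n x = 0 -> x \in @omega K A V n.
Proof.
case: n x => [//|n] x xB /= /eqP; rewrite subr_eq0 => /eqP e.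
by apply/andP; split=> //; rewrite /= e; exact: Bbar_proj_Bbar.
Qed.

Lemma omega_Bbar n (x : bar V n) : x \in @omega K A V n -> x \in @Bbar K A V n.
Proof. by case: n x => [//|n] x /andP[]. Qed.

Lemma omega_defect n (x : bar V n) : x \in @omega K A V n -> defect n x = 0.
Proof.
case: n x => [//|n] x /andP[_ h] /=.
by apply/eqP; rewrite subr_eq0; apply/eqP; rewrite [RHS]Bbar_proj_id.
Qed.

(** With r = [Bbar_proj] and g a generalized inverse of defect o r, the map r - r g defect r lands
    in the kernel of [defect]. The explicit shape matters after tensoring: such a map fixes whatever
    r fixes and [defect] kills. *)
Lemma omega_projection n :
  exists (w : {linear bar V n -> subspace_of (@omega K A V n)})
         (c : {linear bar V n.-1 -> bar V n}),
    forall x, val (w x) = Bbar_proj V n x - c (defect n (Bbar_proj V n x)).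
Proof.
have [g gE] := linear_ginv (defect n \o Bbar_proj V n).
pose c : {linear bar V n.-1 -> bar V n} := Bbar_proj V n \o g.
pose f x := Bbar_proj V n x - c (defect n (Bbar_proj V n x)).
have fE x : f x = Bbar_proj V n (x - g (defect n (Bbar_proj V n x))) by rewrite /f
  linearB.
have fO x : f x \in @omega K A V n.
  apply: omegaE; first by rewrite fE; exact: Bbar_proj_Bbar.
  have := gE x; rewrite fE -/((defect n \o Bbar_proj V n) _) linearB.
  by move=> h; rewrite [X in _ - X]h subrr.
have wL : linear (fun x => exist _ (f x) (fO x) : subspace_of (@omega K A V n)).
  by move=> a x y; apply: val_inj; rewrite /= /f !linearP /= addrACA -scalerDr.
by exists (linmap wL), c.
Qed.

End OmegaProjection.

Section Assembly.
Variables (K : fieldType) (A A' : markedAlg K) (V : bimodule A) (V' : bimodule A').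
Local Notation T := (tensor_marked A A').
Local Notation VT := (tensor_bimodule V V' : bimodule (tensor_marked A A')).
Local Notation "f \ox g" := (tmap f g) (at level 40).
Local Notation gbar := (graded_tensor (bar V) (bar V')).
Local Notation tbd := (@tensor_bd K (unnormalized (bar V)) (unnormalized (bar V')) _).

Lemma bd_moore (X : simplicial K) n (x : X n.+1) :
  x \in @moore K X n.+1 -> bd (unnormalized X) n x \in @moore K X n.
Proof.
move=> xM; rewrite [bd _ _ _]altface_moore //; move/mooreP: xM => xM.
case: n x xM => [//|n] x xM; apply/mooreP => i /andP[i0 iN].
case: i i0 iN => // i _ iN.
rewrite -[i.+1]/(i.+2.-1) -face_face; last by lia.
by rewrite xM ?raddf0.
Qed.

Lemma tensor_bd_moore n (y : gbar n.+1) : graded_moore y -> graded_moore (tbd y).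
Proof.
move=> ym i; rewrite tensor_bdE linearD linearZ_LR !tmap_comp.
rewrite -(ym (incl i)) -(ym (incr i)) !tmap_comp.
congr (_ + _ *: _); apply: eq_tmap => x.
- by apply/rho_id/(@bd_moore (bar V)); exact: rho_moore.
- exact/rho_id/rho_moore.
- exact/rho_id/rho_moore.
- by apply/rho_id/(@bd_moore (bar V')); exact: rho_moore.
Qed.

(** [Bbar_coproj] on the left factor kills the component of [tbd y], and also its summand with the
    differential on the right, whose left factor is still in Bbar. Only the left defect remains. In
    left degree 0 the defect is 0 by definition. *)
Lemma defect_l n (y : gbar n) : graded_Bbar y ->
  (if n is m.+1 then fun y : gbar m.+1 => graded_Bbar (tbd y) else fun=> True) y ->
  forall i, (defect V (bdl i) \ox idfun) (y i) = 0.
Proof.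
move=> yb; case: n y yb => [|n] y yb db [[|p] q P]; try (by apply: tmap0l).
pose i := Bidegree (pred_l P).
rewrite (eq_irrelevance P (bidegree_Sl i)) -/(incl i).
have := congr1 (Bbar_coproj V p \ox idfun) (@tensor_bdE K (unnormalized (bar V))
  (unnormalized (bar V')) n y i).
rewrite -(db i) tmap_comp tmap0l => [|x]; last exact: Bbar_coproj_proj.
rewrite linearD linearZ_LR tmap_comp -(yb (incr i)) !tmap_comp.
rewrite [X in _ *: X]tmap0l => [|x]; last exact: Bbar_coproj_proj.
by rewrite scaler0 addr0 => ->; exact: eq_tmap.
Qed.

Lemma defect_r n (y : gbar n) : graded_Bbar y ->
  (if n is m.+1 then fun y : gbar m.+1 => graded_Bbar (tbd y) else fun=> True) y ->
  forall i, (idfun \ox defect V' (bdr i)) (y i) = 0.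
Proof.
move=> yb; case: n y yb => [|n] y yb db [p [|q] P]; try (by apply: tmap0r);
  first by lia.
pose i := Bidegree (pred_r P).
rewrite (eq_irrelevance P (bidegree_Sr i)) -/(incr i).
have := congr1 (idfun \ox Bbar_coproj V' q) (@tensor_bdE K (unnormalized (bar V))
  (unnormalized (bar V')) n y i).
rewrite -(db i) tmap_comp tmap0r => [|x]; last exact: Bbar_coproj_proj.
rewrite linearD linearZ_LR !tmap_comp -(yb (incl i)) !tmap_comp.
rewrite [X in X + _]tmap0r => [|x]; last exact: Bbar_coproj_proj.
rewrite add0r => /esym/eqP; rewrite scaler_eq0 signr_eq0 => /eqP h.
by rewrite -[RHS]h -(yb (incr i)) !tmap_comp; exact: eq_tmap.
Qed.

Section WithFunctionals.
Variables (chi : {linear A -> K^o}) (chi' : {linear A' -> K^o}).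
Hypotheses (chi1 : chi aone = 1) (chi1' : chi' aone = 1).

(** A left inverse of [shuffle_sum] on tensors of Moore chains: the normalized component of the
    pattern left...left right...right. *)
Definition retract n (i : bidegree n) (x : bar VT n) : tensor (bar V (bdl i)) (bar
  V' (bdr i)) :=
  (rhoL (bar V) (bdl i) \ox rhoL (bar V') (bdr i))
    (unshuffle V V' chi chi' (sorted_pattern (bdl i) (bdr i)) (bdl i) (bdr i) n x).

Lemma retract_shuffle_sum n (y : gbar n) i : graded_moore y ->
  retract i (shuffle_sum y) = y i.
Proof.
move=> ym; rewrite /retract -[RHS]ym.
have si : size (sorted_pattern (bdl i) (bdr i)) = n by rewrite size_sorted_pattern
  bidegreeP.
pose G (s : seq bool) (j : bidegree n) := (-1) ^+ inversions s *:
  unshuffle V V' chi chi' (sorted_pattern (bdl i) (bdr i)) (bdl i) (bdr i) n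
    (shuffle V V' s (bdl j) (bdr j) n (y j)).
have -> : unshuffle V V' chi chi' (sorted_pattern (bdl i) (bdr i)) (bdl i) (bdr i)
  n (shuffle_sum y) =
    \sum_(s : n.-tuple bool) G s (bideg s).
  by rewrite /shuffle_sum linear_sum; apply: eq_bigr => s _; rewrite linearZ_LR.
rewrite (bigD1 (std_tuple i)) // big1 => [|s sN].
  rewrite [X in tmap _ _ X]addr0 bideg_sorted /G inversions_sorted scale1r.
  rewrite unshuffle_shuffle ?count_sorted ?count_negb_sorted // tmap_comp.
  by apply: eq_tmap => x; exact: rho_compl_units.
rewrite /G unshuffle_shuffle_ne ?scaler0 ?size_tuple ?count_sorted
  ?count_negb_sorted ?bidegreeP //.
Qed.

(** Write x = rho b with [b] in [Bsub]. Modulo degenerate chains [b] is the sum of the shuffles of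
    its components, these are signed copies of the sorted ones, and [shuffle_rho] lets them be
    normalized. The sum is then a Moore chain congruent to [b], hence equal to rho b. *)
Lemma shuffle_sum_onto n x : x \in @omega K T VT n ->
  exists2 y : gbar n, graded_Bbar y & x = shuffle_sum y.
Proof.
move=> xO; have /asboolP[b bB xb] := omega_Bbar xO.
exists (fun i => retract i b).
  by move=> i; apply: unshuffle_Bsub; rewrite ?count_sorted ?count_negb_sorted //
    size_sorted_pattern bidegreeP.
have ym : graded_moore (fun i : bidegree n => retract i b).
  by move=> i; rewrite /retract tmap_comp; apply: eq_tmap => u; apply: rho_id;
    exact: rho_moore.
have Rb (s : n.-tuple bool) : unshuffle V V' chi chi' s (count id s) (count negb
  s) n b =
    (-1) ^+ inversions s *: unshuffle V V' chi chi' (sorted_pattern (count id s)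
      (count negb s)) (count id s) (count negb s) n b.
  apply: unshuffle_inversions; rewrite ?size_tuple //.
  case: n x b xO bB xb {s ym} => [//|n] x b /andP[_ dx] bB xb.
  (* [b - x] is degenerate, hence so is its boundary, and the boundary of [x] is in Bbar. *)
  rewrite -[b](subrK x) [altface _](linearD (bd (unnormalized (bar VT)) n)).
  apply: rpredD; last exact: Bbar_Bdeg.
  by apply/mem_addsubr/altface_degenerate; rewrite xb; exact: rho_degenerate.
rewrite xb; apply: rho_unique; first exact: shuffle_sum_moore.
set y := shuffle_sum _.
pose S := \sum_(s : n.-tuple bool) shuffle V V' s (count id s) (count negb s) n
  (unshuffle V V' chi chi' s (count id s) (count negb s) n b).
have -> : b - y = (b - S) + (S - y) by rewrite addrA subrK.
apply: rpredD; first exact: shuffle_unshuffle_sum.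
rewrite /S /y /shuffle_sum -sumrB; apply: rpred_sum => s _.
rewrite Rb linearZ_LR -scalerBr -linearB; apply: rpredZ.
by apply: (@shuffle_rho _ _ _ V V' s (count id s) (count negb s) n);
  rewrite ?size_tuple.
Qed.

(** Serves to show that the boundary of a preimage is again in Bbar (x) Bbar'. [unshuffle] does not
    see the difference b - rho b, so [y] is the retract of a chain [b] in [Bsub]. *)
Lemma shuffle_sum_Bbar_inv n (y : gbar n) : graded_moore y ->
  shuffle_sum y \in @Bbar K T VT n -> graded_Bbar y.
Proof.
move=> ym /asboolP[b bB yb] i.
have si : size (sorted_pattern (bdl i) (bdr i)) = n by rewrite size_sorted_pattern
  bidegreeP.
have E : retract i (shuffle_sum y) = retract i b.
  rewrite /retract; congr (tmap _ _ _); apply/eqP; rewrite eq_sym -subr_eq0 -linearB.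
  apply/eqP/unshuffle_degenerate; rewrite ?count_sorted ?count_negb_sorted // yb.
  exact: rho_degenerate.
rewrite -(retract_shuffle_sum i ym) E.
by apply: unshuffle_Bsub; rewrite ?count_sorted ?count_negb_sorted.
Qed.

Definition incl_omega n (y : graded_tensor (Omega V) (Omega V') n) : gbar n :=
  fun i => tmap (val : {linear Omega V (bdl i) -> bar V (bdl i)})
    (val : {linear Omega V' (bdr i) -> bar V' (bdr i)}) (y i).

Lemma incl_omega_Bbar n (y : graded_tensor (Omega V) (Omega V') n) : graded_Bbar
  (incl_omega y).
Proof.
move=> i; rewrite /incl_omega tmap_comp; apply: eq_tmap => x.
  exact/Bbar_proj_id/omega_Bbar/valP.
exact/Bbar_proj_id/omega_Bbar/valP.
Qed.

Lemma incl_omega_bd n (y : graded_tensor (Omega V) (Omega V') n.+1) :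
  incl_omega (bd (chain_tensor (Omega V) (Omega V')) n y) = tbd (incl_omega y).
Proof.
apply: functional_extensionality_dep => i.
rewrite /incl_omega -[bd _ _ _]/(tensor_bd y) !tensor_bdE linearD linearZ_LR
  !tmap_comp.
by congr (_ + _ *: _); exact: eq_tmap.
Qed.

Lemma shuffle_sum_omega n (y : graded_tensor (Omega V) (Omega V') n) :
  shuffle_sum (incl_omega y) \in @omega K T VT n.
Proof.
case: n y => [|n] y; first exact/shuffle_sum_Bbar/incl_omega_Bbar.
apply/andP; split; first exact/shuffle_sum_Bbar/incl_omega_Bbar.
rewrite shuffle_sum_bd; last exact/graded_Bbar_moore/incl_omega_Bbar.
by rewrite -incl_omega_bd; exact/shuffle_sum_Bbar/incl_omega_Bbar.
Qed.

Lemma chain_iso_Omega :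
  chain_iso (Omega VT) (chain_tensor (Omega V) (Omega V')).
Proof.
pose F n (y : chain_tensor (Omega V) (Omega V') n) : Omega VT n :=
  exist _ (shuffle_sum (incl_omega y)) (shuffle_sum_omega y).
have FL n : linear (F n).
  move=> a x y; apply: val_inj; rewrite /= -shuffle_sum_linear; congr shuffle_sum.
  by apply: functional_extensionality_dep => i; exact: linearP.
pose w n := projT1 (cid (omega_projection V n)).
have wE n : exists c : {linear bar V n.-1 -> bar V n},
    forall x, val (w n x) = Bbar_proj V n x - c (defect V n (Bbar_proj V n x)).
  by rewrite /w; case: cid.
pose w' n := projT1 (cid (omega_projection V' n)).
have wE' n : exists c : {linear bar V' n.-1 -> bar V' n},
    forall x, val (w' n x) = Bbar_proj V' n x - c (defect V' n (Bbar_proj V' n x)).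
  by rewrite /w'; case: cid.
have wK n x : w n (val x) = x.
  apply: val_inj; have [c ->] := wE n; rewrite Bbar_proj_id ?(omega_Bbar (valP x)) //.
  by rewrite (omega_defect (valP x)) linear0 subr0.
have wK' n x : w' n (val x) = x.
  apply: val_inj; have [c ->] := wE' n; rewrite Bbar_proj_id ?(omega_Bbar (valP
    x)) //.
  by rewrite (omega_defect (valP x)) linear0 subr0.
apply: (@chain_iso_bij _ _ _ (fun n => linmap (FL n))) => [n x y|n x|n y].
- move=> /(congr1 val) /= e; apply: functional_extensionality_dep => i.
  have := congr1 (retract i) e.
  rewrite !retract_shuffle_sum; try exact/graded_Bbar_moore/incl_omega_Bbar.
  move=> /(congr1 (w _ \ox w' _)); rewrite /incl_omega !tmap_comp.
  have wid z : tmap (w (bdl i) \o val) (w' (bdr i) \o val) z = z.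
    by rewrite -[RHS]tmap_id; apply: eq_tmap => u; [exact: wK|exact: wK'].
  by rewrite !wid.
- have [y yb xE] := shuffle_sum_onto (valP x).
  have db : (if n is m.+1 then fun y : gbar m.+1 =>
    graded_Bbar (tbd y) else fun=> True) y.
    case: n x y yb xE => [//|n] x y yb xE.
    apply: shuffle_sum_Bbar_inv; first exact/tensor_bd_moore/graded_Bbar_moore.
    rewrite -shuffle_sum_bd -?xE; last exact: graded_Bbar_moore.
    by have /andP[] := valP x.
  exists (fun i => tmap (w (bdl i)) (w' (bdr i)) (y i)); apply: val_inj => /=.
  rewrite xE; congr shuffle_sum; apply: functional_extensionality_dep => i.
  rewrite /incl_omega tmap_comp.
  have yl : (Bbar_proj V (bdl i) \ox idfun) (y i) = y i.
    rewrite -{1}(yb i) tmap_comp -[RHS](yb i); apply: eq_tmap => // u.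
    exact/Bbar_proj_id/Bbar_proj_Bbar.
  have yr : (idfun \ox Bbar_proj V' (bdr i)) (y i) = y i.
    rewrite -{1}(yb i) tmap_comp -[RHS](yb i); apply: eq_tmap => // u.
    exact/Bbar_proj_id/Bbar_proj_Bbar.
  (* The projection onto Omega is applied in the left variable alone: its correction term factors
     through the left defect of [y], which is 0. The right variable is treated alike, and the two
     compose to w (x) w'. *)
  have wl : ((val \o w (bdl i)) \ox idfun) (y i) = y i.
    have [c cE] := wE (bdl i).
    transitivity ((Bbar_proj V (bdl i) \ox idfun) (y i) -
      (c \ox idfun) ((defect V (bdl i) \ox idfun) ((Bbar_proj V (bdl i) \ox idfun)
        (y i)))).
      apply/eqP; rewrite eq_sym subr_eq !tmap_comp; apply/eqP.
      transitivity ((((val \o w (bdl i)) \+ (c \o (defect V (bdl i) \o Bbar_proj V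
        (bdl i))))
        \ox idfun) (y i)); first by apply: eq_tmap => // u; rewrite /= cE subrK.
      by rewrite tmapDl; congr (_ + _); exact: eq_tmap.
    by rewrite yl defect_l // linear0 subr0.
  have wr : (idfun \ox (val \o w' (bdr i))) (y i) = y i.
    have [c cE] := wE' (bdr i).
    transitivity ((idfun \ox Bbar_proj V' (bdr i)) (y i) -
      (idfun \ox c) ((idfun \ox defect V' (bdr i)) ((idfun \ox Bbar_proj V' (bdr
        i)) (y i)))).
      apply/eqP; rewrite eq_sym subr_eq !tmap_comp; apply/eqP.
      transitivity ((idfun \ox ((val \o w' (bdr i)) \+
        (c \o (defect V' (bdr i) \o Bbar_proj V' (bdr i))))) (y i)).
        by apply: eq_tmap => // u; rewrite /= cE subrK.
      by rewrite tmapDr; congr (_ + _); exact: eq_tmap.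
    by rewrite yr defect_r // linear0 subr0.
  by rewrite -[RHS]wl -[in RHS]wr tmap_comp; exact: eq_tmap.
- apply: val_inj; rewrite /= incl_omega_bd -shuffle_sum_bd //.
  exact/graded_Bbar_moore/incl_omega_Bbar.
Qed.

End WithFunctionals.
End Assembly.

Lemma chain_iso_trivial (K : fieldType) (C D : chain K) :
  (forall n (x : C n), x = 0) -> (forall n (x : D n), x = 0) -> chain_iso C D.
Proof.
move=> C0 D0; apply: (@chain_iso_bij _ _ _ (fun n => \0)) => [n x y _|n x|n y].
- by rewrite (D0 _ x) (D0 _ y).
- by exists 0; rewrite (C0 _ x).
- by rewrite (C0 _ (bd _ _ _)).
Qed.

(* When one of the algebras is zero no functional takes the unit to 1, but then
   both complexes vanish. *)
Lemma Omega_tensor (K : fieldType) (A A' : markedAlg K) (V : bimodule A) (V' :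
  bimodule A') :
  chain_iso (@Omega K (tensor_marked A A') (tensor_bimodule V V'))
    (chain_tensor (Omega V) (Omega V')).
Proof.
have Om0 (B : markedAlg K) (W : bimodule B) n (x : Omega W n) : aone = 0 :> B ->
  x = 0.
  by move=> B1; apply: val_inj; exact: bar_trivial.
have [A1|A1] := pselect (aone = 0 :> A).
  apply: chain_iso_trivial => n x.
    by apply: Om0; rewrite [LHS]/(tens aone aone) A1; exact: tens0l.
  apply: functional_extensionality_dep => i.
  apply: (@tens_lift_ext _ _ _ _ idfun \0) => u v /=.
  by rewrite (Om0 _ _ _ u A1) tens0l.
have [A1'|A1'] := pselect (aone = 0 :> A').
  apply: chain_iso_trivial => n x.
    by apply: Om0; rewrite [LHS]/(tens aone aone) A1'; exact: tens0r.
  apply: functional_extensionality_dep => i.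
  apply: (@tens_lift_ext _ _ _ _ idfun \0) => u v /=.
  by rewrite (Om0 _ _ _ v A1') tens0r.
have [chi chi1] := unit_functional A1; have [chi' chi1'] := unit_functional A1'.
exact: chain_iso_Omega chi1 chi1'.
Qed.

(** The data of the two bimodules are convertible; only the proofs differ. *)
Lemma regular_tensor (K : fieldType) (A A' : kalgebra K) :
  regular_bimodule (tensor_algebra A A') =
  tensor_bimodule (regular_bimodule A) (regular_bimodule A').
Proof. by rewrite /tensor_bimodule /regular_bimodule; f_equal;
  exact: Prop_irrelevance. Qed.

Theorem proposition15p1 (K : fieldType) (A A' : markedAlg K)
    (V : bimodule A) (V' : bimodule A') :
  [/\ chain_iso (@Omega K (tensor_marked A A') (tensor_bimodule V V'))
                (chain_tensor (Omega V) (Omega V')),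
      chain_iso (Omega (regular_bimodule (tensor_marked A A')))
                (chain_tensor (Omega (regular_bimodule A))
                              (Omega (regular_bimodule A')))
    & forall n : nat,
        lin_iso (PHH (tensor_marked A A') n)
                (graded_tensor (PHH A) (PHH A') n)].
Proof.
have reg : chain_iso (Omega (regular_bimodule (tensor_marked A A')))
    (chain_tensor (Omega (regular_bimodule A)) (Omega (regular_bimodule A'))).
  rewrite [regular_bimodule (tensor_marked A A')]regular_tensor.
  exact: Omega_tensor.
split=> [||n]; [exact: Omega_tensor|exact: reg|].
apply: lin_iso_trans (lin_iso_homology n reg) _.
exact: kunneth.
Qed.
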